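(* Let $G$ be a two-party communication gadget. Suppose that for every partial Boolean function $f$ we have $\mathrm{Q}^{\mathrm{cc}}(f\circ G)=\widetilde{\Omega}(\mathrm{QS}(f))$. Then for every partial Boolean function $f$ we have $\mathrm{Q}^{\mathrm{cc}}(f\circ G)=\widetilde{\Omega}(\mathrm{Q}(f))$.
   Context: Quantum query model: the oracle $O_x$ acts by $O_x|i,b\rangle=|i,b\oplus x_i\rangle$. A $T$-query algorithm alternates input-independent unitaries with $T$ applications of $O_x$, starting from $|0^m\rangle$. It then measures, or outputs the state obtained by tracing out a fixed subset of qubits. The trace distance is $\|\rho-\sigma\|_{tr}=\tfrac12\|\rho-\sigma\|_1$. - $\mathrm{Q}(f)$ is the minimum number of queries to compute $f$ with success probability at least $2/3$ on every $x\in\mathrm{Dom}(f)$. - $\mathrm{QS}(f)$ is the smallest $k$ such that some $k$-query algorithm outputs states $\rho_x$ with $\|\rho_x-\rho_y\|_{tr}\ge1/6$ whenever $x,y\in\mathrm{Dom}(f)$ and $f(x)\ne f(y)$. A gadget is $G:\mathcal{X}\times\mathcal{Y}\to\{0,1\}$. For a partial $f$ on $n$ bits, $f\circ G$ is the two-party partial function with Alice holding $(a_i)\in\mathcal{X}^n$ and Bob holding $(b_i)\in\mathcal{Y}^n$. Its value is $f(G(a_1,b_1),\dots,G(a_n,b_n))$, defined when this string lies in $\mathrm{Dom}(f)$. $\mathrm{Q}^{\mathrm{cc}}(F)$ is the bounded-error quantum communication complexity of $F$. The notation $\widetilde{\Omega}(g)$ means $\Omega(g/\log^c g)$ for some constant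 $c$. *)

(* Defs.v *)
(* MathComp (+ mathcomp-classical boolp, real-closed complex numbers,
   Stdlib reals via Rstruct). *)
From HB Require Import structures.
From mathcomp Require Import all_boot all_order all_algebra.
From mathcomp Require Import boolp Rstruct.
From mathcomp.real_closed Require Import complex.
From Stdlib Require Rpower.

Set Implicit Arguments.
Unset Strict Implicit.
Unset Printing Implicit Defensive.
Import Order.TTheory GRing.Theory Num.Theory.
Local Open Scope ring_scope.

(** Real numbers (Stdlib's R, a realType/rcfType via Rstruct) and complex
    numbers C = R[i]. *)
Definition RR : rcfType := Rdefinitions.R.
Definition CC := RR[i].

(** ** Finite-dimensional linear algebra over C, with basis indexed by a finType *)
Definition vec (T : finType) := T -> CC.
Definition op (T : finType) := T -> T -> CC.

Definition apply_op (T : finType) (U : op T) (v : vec T) : vec T :=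
  fun i => \sum_(j : T) U i j * v j.

(** U^* U = 1 (equivalent to unitarity in finite dimension) *)
Definition unitary (T : finType) (U : op T) : Prop :=
  forall i j : T, \sum_(k : T) (U k i)^* * U k j = (i == j)%:R.

(** The computational basis vector |s>. *)
Definition ket (T : finType) (s : T) : vec T := fun t => (t == s)%:R.

(** Trace norm: ||A||_1 is the sum of the singular values of A.  We say
    [trace_norm_is A t] when A = U diag(s) V^* is a singular value
    decomposition (U, V unitary, s >= 0) and t = sum_c s_c.  Singular values
    are unique, so t is exactly ||A||_1. *)
Definition trace_norm_is (T : finType) (A : op T) (t : CC) : Prop :=
  exists (U V : op T) (s : T -> CC),
    [/\ unitary U, unitary V, (forall c, 0 <= s c),
        (forall a b, A a b = \sum_(c : T) U a c * s c * (V b c)^*)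
      & t = \sum_(c : T) s c].

(** trace distance ||rho - sigma||_tr = 1/2 ||rho - sigma||_1 *)
Definition trace_dist_is (T : finType) (rho sigma : op T) (d : CC) : Prop :=
  exists t, trace_norm_is (fun a b => rho a b - sigma a b) t
            /\ d = t / 2.

(** ** Partial Boolean functions *)
Definition bits (n : nat) := {ffun 'I_n -> bool}.
(** [f x = Some v] iff x \in Dom(f) and f(x) = v. *)
Definition pfun (n : nat) := bits n -> option bool.

(** Least natural number satisfying P (0 if there is none; never used in
    that case below, since all the complexities considered are finite). *)
Lemma ex_asbool (P : nat -> Prop) : (exists n, P n) -> exists n, `[< P n >].
Proof. by case=> n Pn; exists n; apply/asboolP. Qed.

Definition minnat (P : nat -> Prop) : nat :=
  match pselect (exists n, P n) with
  | left h => ex_minn (ex_asbool h)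
  | right _ => 0%N
  end.

(** ** Quantum query algorithms on n-bit inputs.
    Basis of the state space: ((i, b), (k, j)) where
      i : 'I_n.+1  is the query index register (index n is an idle index on
                   which the oracle acts trivially),
      b : bool     is the answer qubit of the oracle,
      k : 'I_dk.+1 is the part of the workspace that is kept at the end,
      j : 'I_dj.+1 is the part of the workspace that is traced out. *)
Definition qspace (n dk dj : nat) : finType :=
  (('I_n.+1 * bool) * ('I_dk.+1 * 'I_dj.+1))%type.

Definition qinit (n dk dj : nat) : qspace n dk dj :=
  ((ord0, false), (ord0, ord0)).

Definition xbit (n : nat) (x : bits n) (i : 'I_n.+1) : bool :=
  if unlift ord_max i is Some i' then x i' else false.

(** O_x |i, b, w> = |i, b xor x_i, w> *)
Definition oracle (n dk dj : nat) (x : bits n) : op (qspace n dk dj) :=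
  fun s' s => (s' == ((s.1.1, s.1.2 (+) xbit x s.1.1), s.2))%:R.

(** Final state of the algorithm U_T O_x U_{T-1} ... O_x U_0 |0> *)
Fixpoint qrun (n dk dj : nat) (U : nat -> op (qspace n dk dj)) (x : bits n)
    (t : nat) : vec (qspace n dk dj) :=
  match t with
  | 0 => apply_op (U 0%N) (ket (qinit n dk dj))
  | t'.+1 => apply_op (U t) (apply_op (@oracle n dk dj x) (qrun U x t'))
  end.

(** Probability that measuring the answer qubit yields v. *)
Definition qprob_out (n dk dj : nat) (psi : vec (qspace n dk dj)) (v : bool) : CC :=
  \sum_(s : qspace n dk dj | s.1.2 == v) `|psi s| ^+ 2.

(** Reduced state on the kept register (tracing out i, b and j). *)
Definition reduced (n dk dj : nat) (psi : vec (qspace n dk dj)) : op 'I_dk.+1 :=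
  fun k1 k2 => \sum_(i : 'I_n.+1) \sum_(b : bool) \sum_(j : 'I_dj.+1)
                 psi ((i, b), (k1, j)) * (psi ((i, b), (k2, j)))^*.

(** f is computed with success probability >= 2/3 by a T-query algorithm *)
Definition Q_computes (n : nat) (f : pfun n) (T : nat) : Prop :=
  exists (dk dj : nat) (U : nat -> op (qspace n dk dj)),
    (forall t, (t <= T)%N -> unitary (U t)) /\
    forall x v, f x = Some v -> 2 / 3 <= qprob_out (qrun U x T) v.

Definition Q (n : nat) (f : pfun n) : nat := minnat (Q_computes f).

(** a T-query algorithm whose output states distinguish f *)
Definition QS_distinguishes (n : nat) (f : pfun n) (T : nat) : Prop :=
  exists (dk dj : nat) (U : nat -> op (qspace n dk dj)),
    (forall t, (t <= T)%N -> unitary (U t)) /\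
    forall x y vx vy, f x = Some vx -> f y = Some vy -> vx != vy ->
      exists d, trace_dist_is (reduced (qrun U x T)) (reduced (qrun U y T)) d
                /\ 1 / 6 <= d.

Definition QS (n : nat) (f : pfun n) : nat := minnat (QS_distinguishes f).

(** ** Quantum communication protocols (Yao model, no prior entanglement).
    Basis of the global space: ((a, c), b) with a : 'I_da.+1 Alice's private
    register, c : bool the one-qubit channel, b : 'I_db.+1 Bob's private
    register.  A protocol of cost T has T steps; at step t (t = 0..T-1) the
    holder of the channel applies a unitary depending on its input to its
    private register and the channel, then sends the channel qubit (1 qubit of
    communication) to the other party: Alice acts at even steps, Bob at odd
    steps.  At the end the channel qubit is measured and gives the output. *)
Definition cspace (da db : nat) : finType := (('I_da.+1 * bool) * 'I_db.+1)%type.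

Definition cinit (da db : nat) : cspace da db := ((ord0, false), ord0).

Definition liftA (da db : nat) (U : op ('I_da.+1 * bool)%type) : op (cspace da db) :=
  fun s' s => if s'.2 == s.2 then U s'.1 s.1 else 0.

Definition liftB (da db : nat) (V : op (bool * 'I_db.+1)%type) : op (cspace da db) :=
  fun s' s => if s'.1.1 == s.1.1 then V (s'.1.2, s'.2) (s.1.2, s.2) else 0.

Fixpoint crun (XA YB : Type) (da db : nat)
    (UA : nat -> XA -> op ('I_da.+1 * bool)%type)
    (UB : nat -> YB -> op (bool * 'I_db.+1)%type) (x : XA) (y : YB) (t : nat)
    : vec (cspace da db) :=
  match t with
  | 0 => ket (cinit da db)
  | t'.+1 => apply_op (if odd t' then @liftB da db (UB t' y) else @liftA da db (UA t' x))
                      (crun UA UB x y t')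
  end.

Definition cprob_out (da db : nat) (psi : vec (cspace da db)) (v : bool) : CC :=
  \sum_(s : cspace da db | s.1.2 == v) `|psi s| ^+ 2.

(** F (a two-party partial function) is computed with success probability
    >= 2/3 by a protocol communicating T qubits. *)
Definition Qcc_computes (XA YB : finType) (F : XA -> YB -> option bool) (T : nat)
  : Prop :=
  exists (da db : nat) (UA : nat -> XA -> op ('I_da.+1 * bool)%type)
         (UB : nat -> YB -> op (bool * 'I_db.+1)%type),
    [/\ (forall t x, unitary (UA t x)), (forall t y, unitary (UB t y))
      & forall x y v, F x y = Some v -> 2 / 3 <= cprob_out (crun UA UB x y T) v].

Definition Qcc (XA YB : finType) (F : XA -> YB -> option bool) : nat :=
  minnat (Qcc_computes F).

(** ** Composition with a gadget G : X * Y -> {0,1} *)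
Definition compose_gadget (X Y : finType) (n : nat) (f : pfun n) (G : X -> Y -> bool)
  : {ffun 'I_n -> X} -> {ffun 'I_n -> Y} -> option bool :=
  fun a b => f [ffun i => G (a i) (b i)].

(** ** Asymptotic notation over the family of all partial Boolean functions.
    [OmegaTilde A B] : A(f) = \tilde\Omega(B(f)), i.e. there are constants
    c, kappa > 0 and a threshold N such that for all f with B(f) >= N (and
    B(f) >= 2, so that log B(f) > 0),  A(f) >= kappa * B(f) / log^c B(f). *)
Definition OmegaTilde (A B : forall n : nat, pfun n -> nat) : Prop :=
  exists (c : nat) (kappa : RR) (N : nat),
    0 < kappa /\
    forall (n : nat) (f : pfun n), (N <= B n f)%N -> (2 <= B n f)%N ->
      kappa * (B n f)%:R / (Rpower.ln (B n f)%:R) ^+ c <= (A n f)%:R.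

(* Main.v *)
(** From [f] one builds the function [lookup] whose input consists of [m]
    inputs of [f] and of [2 ^ m] extra cells, and whose value is the cell addressed by the [m]
    values of [f], with [m] of order [log (Q f)].

    Communication: evaluating [f o G] on the [m] blocks (with a majority vote) gives the address,
    and a single cell is then evaluated, so Qcc(lookup o G) is at most polylog(Q f) times
    Qcc(f o G).

    State distinguishing: flipping the addressed cell flips the value, so by the hybrid argument
    a [T]-query algorithm whose output states distinguish [lookup] puts query weight of order
    [1 / T] on the addressed cell, i.e. it guesses [m] values of [f].  If [T] is small compared
    with Q(f), this is excluded by a direct product theorem: when [f] has no cheap query algorithm,
    the dual adversary program has no solution of small cost (a solution gives an algorithm by
    running, from a uniform superposition of times, a unitary having the solution as a
    catalyst), hence by convex separation there is an adversary matrix [Gam].  The tensor power of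
    the kernel [M = 2 B - Gam / A] grows by a factor at most [1 + 2 / A] per query while
    [P_v <= 2/3 M] for both values [v] of [f], so [m] values are guessed with probability
    [O((2/3) ^ m)]. *)
Require Import Defs.
From HB Require Import structures.
From mathcomp Require Import all_boot all_order all_algebra.
From mathcomp Require Import boolp reals Rstruct.
From mathcomp.real_closed Require Import complex.
From mathcomp Require Import ring lra zify.
From Stdlib Require Rpower.

Set Implicit Arguments.
Unset Strict Implicit.
Unset Printing Implicit Defensive.
Import Order.TTheory GRing.Theory Num.Theory.
Local Open Scope ring_scope.

(** Output states that are pairwise far apart need not admit one measurement that reads off the
    value, so a lower bound on [Q] says nothing directly about [QS]. The addressed cell supplies
    such a measurement: observe the query register at a random time. It must show the address with
    probability of order $1/T^2$, and $(2/3)^m$ has to fall below this, which is why $m$ is a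
    multiple of the logarithm of [Q f].

    With so few copies a weak direct product statement is enough: all $T$ queries together may
    double the progress, which is guaranteed as soon as $4T \le A$. The starting value for $m$
    copies is kept below 2 by a kernel whose total is at most $1 + 1/(2m)$.

    Attaining the optimum of the adversary program, or of the Rayleigh quotient of [Gam], would call
    for a compactness argument. Near-optimal points are used instead; the losses go into the gap
    between [W + 1] and [W] and into the factor [1 + eta]. *)

Definition rc : RR -> CC := real_complex RR.
HB.instance Definition _ := GRing.RMorphism.on rc.

Lemma rc_le x y : (rc x <= rc y) = (x <= y).
Proof. by rewrite /rc lecR. Qed.

Lemma rc_conj x : (rc x)^* = rc x.
Proof. by apply/CrealP; rewrite /rc complex_real. Qed.

(** * Vectors and unitaries *)

Section InnerProduct.
Variable T : finType.
Implicit Types (v w : vec T) (U V : op T) (a : CC).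

Definition vadd v w : vec T := fun i => v i + w i.
Definition vscale a v : vec T := fun i => a * v i.
Definition dot v w : CC := \sum_i (v i)^* * w i.
Definition vnorm v : CC := sqrtC (dot v v).

Lemma dotDl v1 v2 w : dot (vadd v1 v2) w = dot v1 w + dot v2 w.
Proof. by rewrite -big_split /=; apply: eq_bigr => i _; rewrite rmorphD mulrDl. Qed.

Lemma dotDr v w1 w2 : dot v (vadd w1 w2) = dot v w1 + dot v w2.
Proof. by rewrite -big_split /=; apply: eq_bigr => i _; rewrite mulrDr. Qed.

Lemma dotZl a v w : dot (vscale a v) w = a^* * dot v w.
Proof. by rewrite mulr_sumr; apply: eq_bigr => i _; rewrite rmorphM mulrA. Qed.

Lemma dotZr a v w : dot v (vscale a w) = a * dot v w.
Proof. by rewrite mulr_sumr; apply: eq_bigr => i _; rewrite mulrCA. Qed.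

Lemma dot_conj v w : (dot v w)^* = dot w v.
Proof. by rewrite rmorph_sum; apply: eq_bigr => i _; rewrite rmorphM /= conjCK mulrC. Qed.

Lemma dot_normsq v : dot v v = \sum_i `|v i| ^+ 2.
Proof. by apply: eq_bigr => i _; rewrite normCKC. Qed.

Lemma dot_ge0 v : 0 <= dot v v.
Proof. by rewrite dot_normsq sumr_ge0 // => i _; rewrite exprn_ge0. Qed.

Lemma dot_eq0 v : dot v v = 0 -> forall i, v i = 0.
Proof.
rewrite dot_normsq => /eqP; rewrite psumr_eq0; last by move=> i _; rewrite exprn_ge0.
by move=> /allP h i; have := h i (mem_index_enum i); rewrite expf_eq0 /= normr_eq0 => /eqP.
Qed.

Lemma dot_ketl s v : dot (ket s) v = v s.
Proof.
rewrite /dot (bigD1 s) //= big1 ?addr0 /ket ?eqxx ?rmorph1 ?mul1r //.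
by move=> i /negbTE ->; rewrite rmorph0 mul0r.
Qed.

Lemma dot_0l v w : (forall i, v i = 0) -> dot v w = 0.
Proof. by move=> v0; apply: big1 => i _; rewrite v0 rmorph0 mul0r. Qed.

Lemma Cauchy_Schwarz v w : `|dot v w| ^+ 2 <= dot v v * dot w w.
Proof.
have [vv0|vvn0] := eqVneq (dot v v) 0.
  by rewrite dot_0l ?normr0 ?expr0n ?vv0 ?mul0r //; apply: dot_eq0.
have vvgt0 : 0 < dot v v by rewrite lt_def vvn0 dot_ge0.
set u := vadd (vscale (dot v v) w) (vscale (- dot v w) v).
have := dot_ge0 u.
rewrite /u !dotDl !dotDr !dotZl !dotZr rmorphN /= (geC0_conj (dot_ge0 v)) dot_conj.
have -> : `|dot v w| ^+ 2 = dot v w * dot w v by rewrite normCK dot_conj.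
set a := dot v v; set b := dot v w; set c := dot w v; set d := dot w w => h.
have h2 : 0 <= a * (a * d - b * c).
  by apply: le_trans h _; rewrite le_eqVlt; apply/orP; left; apply/eqP; ring.
by rewrite pmulr_rge0 // subr_ge0 in h2.
Qed.

Lemma vnorm_ge0 v : 0 <= vnorm v. Proof. by rewrite sqrtC_ge0 dot_ge0. Qed.

Lemma vnorm_sq v : vnorm v ^+ 2 = dot v v. Proof. exact: sqrtCK. Qed.

Lemma Cauchy_Schwarz_norm v w : `|dot v w| <= vnorm v * vnorm w.
Proof.
rewrite -(@ler_pXn2r _ 2) ?nnegrE ?mulr_ge0 ?vnorm_ge0 //.
by rewrite exprMn !vnorm_sq Cauchy_Schwarz.
Qed.

Lemma vnormD v w : vnorm (vadd v w) <= vnorm v + vnorm w.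
Proof.
rewrite -(@ler_pXn2r _ 2) ?nnegrE ?addr_ge0 ?vnorm_ge0 //.
rewrite vnorm_sq dotDl !dotDr sqrrD !vnorm_sq -(dot_conj v w).
have -> : dot v v + dot v w + ((dot v w)^* + dot w w) =
   dot v v + ('Re (dot v w) *+ 2) + dot w w.
  by rewrite ReE -mulr_natr mulfVK ?pnatr_eq0 // -!addrA.
rewrite lerD2r lerD2l lerMn2r /=.
apply: le_trans (Cauchy_Schwarz_norm v w).
apply: le_trans (leif_normC_Re_Creal _).1; by apply: real_ler_norm; exact: Creal_Re.
Qed.

End InnerProduct.

(** * Unitary operators: permutations, diagonal operators and reflections *)

Section Operators.
Variable T : finType.
Implicit Types (v w : vec T) (U V : op T) (a : CC).

Lemma apply_opD U v w : apply_op U (vadd v w) = vadd (apply_op U v) (apply_op U w).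
Proof. by apply/funext => i; rewrite /vadd -big_split; apply: eq_bigr => j _; rewrite mulrDr. Qed.

Lemma apply_opZ U a v : apply_op U (vscale a v) = vscale a (apply_op U v).
Proof. by apply/funext => i; rewrite /vscale mulr_sumr; apply: eq_bigr => j _; rewrite mulrCA. Qed.

Lemma apply_op_ket U s i : apply_op U (ket s) i = U i s.
Proof.
rewrite /apply_op (bigD1 s) //= big1 ?addr0 /ket ?eqxx ?mulr1 //.
by move=> j /negbTE ->; rewrite mulr0.
Qed.

Lemma dot_apply_op U v w :
  dot (apply_op U v) (apply_op U w) =
  \sum_i \sum_j (v i)^* * w j * \sum_k (U k i)^* * U k j.
Proof.
rewrite /dot /apply_op.
under eq_bigr => k _ do rewrite rmorph_sum big_distrlr /=.
rewrite exchange_big; apply: eq_bigr => i _; rewrite exchange_big.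
apply: eq_bigr => j _; rewrite mulr_sumr; apply: eq_bigr => k _.
by rewrite rmorphM /=; ring.
Qed.

Lemma dot_unitary U v w : unitary U -> dot (apply_op U v) (apply_op U w) = dot v w.
Proof.
move=> uU; rewrite dot_apply_op; apply: eq_bigr => i _.
rewrite (bigD1 i) //= uU eqxx mulr1 big1 ?addr0 // => j /negbTE ji.
by rewrite uU eq_sym ji mulr0.
Qed.

Lemma vnorm_unitary U v : unitary U -> vnorm (apply_op U v) = vnorm v.
Proof. by move=> uU; rewrite /vnorm dot_unitary. Qed.

Lemma unitaryP U : (forall v w, dot (apply_op U v) (apply_op U w) = dot v w) -> unitary U.
Proof.
move=> uU i j; transitivity (dot (apply_op U (ket i)) (apply_op U (ket j))).
  by apply: eq_bigr => k _; rewrite !apply_op_ket.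
by rewrite uU dot_ketl /ket.
Qed.

Definition op_mul U V : op T := fun i j => \sum_k U i k * V k j.

Lemma apply_op_mul U V v : apply_op (op_mul U V) v = apply_op U (apply_op V v).
Proof.
apply/funext => i; rewrite /apply_op /op_mul.
under eq_bigr => j _ do rewrite mulr_suml.
rewrite exchange_big; apply: eq_bigr => k _; rewrite mulr_sumr.
by apply: eq_bigr => j _; rewrite mulrA.
Qed.

Lemma unitary_mul U V : unitary U -> unitary V -> unitary (op_mul U V).
Proof. by move=> uU uV; apply: unitaryP => v w; rewrite !apply_op_mul !dot_unitary. Qed.

Definition op1 : op T := fun i j => (i == j)%:R.

Lemma apply_op1 v : apply_op op1 v = v.
Proof.
apply/funext => i; rewrite /apply_op (bigD1 i) //= /op1 eqxx mul1r big1 ?addr0 //.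
by move=> j /negbTE ji; rewrite eq_sym ji mul0r.
Qed.

Lemma unitary1 : unitary op1.
Proof. by apply: unitaryP => v w; rewrite !apply_op1. Qed.

Definition op_perm (p : T -> T) : op T := fun i j => (i == p j)%:R.

Lemma apply_op_perm p q v : cancel q p -> cancel p q ->
  apply_op (op_perm p) v = v \o q.
Proof.
move=> qK pK; apply/funext => i; rewrite /apply_op (bigD1 (q i)) //= /op_perm qK eqxx mul1r.
rewrite big1 ?addr0 // => j jq; case: eqP => [e|_]; last by rewrite mul0r.
by move: jq; rewrite e pK eqxx.
Qed.

Lemma unitary_perm p q : cancel q p -> cancel p q -> unitary (op_perm p).
Proof.
move=> qK pK; apply: unitaryP => v w; rewrite !(apply_op_perm _ qK pK) /dot.
by rewrite [RHS](reindex q) //=; exists p => i _; rewrite ?qK ?pK.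
Qed.

Definition op_diag (d : T -> CC) : op T := fun i j => (i == j)%:R * d i.

Lemma apply_op_diag d v i : apply_op (op_diag d) v i = d i * v i.
Proof.
rewrite /apply_op (bigD1 i) //= /op_diag eqxx mul1r big1 ?addr0 //.
by move=> j /negbTE ji; rewrite eq_sym ji !mul0r.
Qed.

Lemma unitary_diag d : (forall i, `|d i| = 1) -> unitary (op_diag d).
Proof.
move=> d1; apply: unitaryP => v w; apply: eq_bigr => i _.
rewrite !apply_op_diag rmorphM /= mulrACA.
by rewrite -(normCKC (d i)) d1 expr1n mul1r.
Qed.

Definition adj_apply U v : vec T := fun c => \sum_a (U a c)^* * v a.

Lemma dot_adj U v w : dot (apply_op U v) w = dot v (adj_apply U w).
Proof.
rewrite /dot /apply_op /adj_apply.
under eq_bigr => i _ do rewrite rmorph_sum mulr_suml.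
rewrite exchange_big; apply: eq_bigr => j _; rewrite mulr_sumr.
by apply: eq_bigr => i _; rewrite rmorphM /=; ring.
Qed.

(* Bessel's inequality: the columns of U are orthonormal. *)
Lemma adj_apply_contracts U v : unitary U ->
  dot (adj_apply U v) (adj_apply U v) <= dot v v.
Proof.
move=> uU; set w := adj_apply U v.
have e1 : dot (apply_op U w) v = dot w w by rewrite dot_adj.
have := dot_ge0 (vadd v (vscale (-1) (apply_op U w))).
rewrite !dotDl !dotDr !dotZl !dotZr dot_unitary // e1 -(dot_conj (apply_op U w) v) e1.
rewrite (geC0_conj (dot_ge0 w)) rmorphN rmorph1 => h; rewrite -subr_ge0.
by apply: le_trans h _; rewrite le_eqVlt; apply/orP; left; apply/eqP; ring.
Qed.

(** The Householder reflection along [v]. For [v] zero the convention that the inverse of 0 is 0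
    makes it the identity. *)
Definition op_house v : op T := fun i j => (i == j)%:R - 2 / dot v v * v i * (v j)^*.

Lemma apply_op_house v w :
  apply_op (op_house v) w = vadd w (vscale (- (2 / dot v v * dot v w)) v).
Proof.
apply/funext => i; rewrite /apply_op /op_house.
under eq_bigr => j _ do rewrite mulrBl.
rewrite sumrB; congr (_ + _); first exact: (congr1 (@^~ i) (apply_op1 w)).
rewrite /vscale /dot mulNr mulr_sumr mulr_suml; congr (- _).
by apply: eq_bigr => j _; ring.
Qed.

Lemma unitary_house v : unitary (op_house v).
Proof.
have [v0|vn0] := eqVneq (dot v v) 0.
  suff -> : op_house v = op1 by exact: unitary1.
  by do 2!apply/funext => ?; rewrite /op_house v0 invr0 mulr0 !mul0r subr0.
apply: unitaryP => w1 w2; rewrite !apply_op_house !dotDl !dotDr !dotZl !dotZr.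
have hr : (2 / dot v v)^* = 2 / dot v v by rewrite geC0_conj // divr_ge0 ?dot_ge0.
have hd : dot v v = 2 / (2 / dot v v) by rewrite invf_div mulrC divfK ?pnatr_eq0.
have cn0 : 2 / dot v v != 0 by rewrite mulf_neq0 ?invr_eq0 ?pnatr_eq0.
move: (2 / dot v v) hr hd cn0 => c hr -> cn0.
rewrite !rmorphN !rmorphM /= hr dot_conj.
by field.
Qed.

(* [U] is the identity minus twice the orthogonal projection on the span of [vs]. *)
Lemma reflection_through (vs : seq (vec T)) : exists U : op T,
  [/\ unitary U, (forall v, List.In v vs -> apply_op U v = vscale (-1) v)
    & forall w, (forall v, List.In v vs -> dot v w = 0) -> apply_op U w = w].
Proof.
(* The induction also carries that [U] is an involution, which together with unitarity makes it
   self-adjoint. *)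
suff [U [uU UU Uv Uw]] : exists U : op T,
  [/\ unitary U, (forall v, apply_op U (apply_op U v) = v),
     (forall v, List.In v vs -> apply_op U v = vscale (-1) v)
    & forall w, (forall v, List.In v vs -> dot v w = 0) -> apply_op U w = w].
  by exists U.
elim: vs => [|v vs [U [uU UU Uv Uw]]].
  by exists op1; split=> //; [exact: unitary1|move=> v; rewrite !apply_op1|move=> w; rewrite apply_op1].
(* [e] is twice the component of [v] fixed by [U], that is, orthogonal to the earlier vectors
   (Gram-Schmidt without normalisation). If it vanishes, [v] is already negated; otherwise one
   composes with the reflection along it. *)
set e := vadd v (apply_op U v).
have Ue : apply_op U e = e.
  by rewrite /e apply_opD UU; apply/funext => i; rewrite /vadd addrC.
have self w1 w2 : dot (apply_op U w1) w2 = dot w1 (apply_op U w2).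
  by rewrite -[in LHS](UU w2) dot_unitary.
have [e0|en0] := eqVneq (dot e e) 0.
  exists U; split=> //.
    move=> w [<-|]; last exact: Uv.
    apply/funext => i; have := dot_eq0 e0 i; rewrite /e /vadd /vscale mulN1r => /eqP.
    by rewrite addrC addr_eq0 => /eqP.
  by move=> w h; apply: Uw => v' hv; apply: h; right.
have dev : dot e e = 2 * dot e v.
  by rewrite {2}/e dotDr -self Ue mulr2n mulrDl mul1r.
have comm w : apply_op U (apply_op (op_house e) w) = apply_op (op_house e) (apply_op U w).
  by rewrite !apply_op_house apply_opD apply_opZ Ue -self Ue.
exists (op_mul U (op_house e)); split.
- exact: unitary_mul (unitary_house _).
- move=> w; rewrite !apply_op_mul -comm UU !apply_op_house dotDr dotZr.
  apply/funext => i; rewrite /vadd /vscale.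
  by field.
- move=> w [<-|hw].
    rewrite apply_op_mul comm apply_op_house.
    have -> : dot e (apply_op U v) = dot e v by rewrite -self Ue.
    have -> : 2 / dot e e * dot e v = 1 by rewrite mulrAC -dev divff.
    by apply/funext => i; rewrite /e /vadd /vscale; ring.
  rewrite apply_op_mul apply_op_house.
  have -> : dot e w = 0.
    by rewrite /e dotDl self (Uv w hw) dotZr mulN1r subrr.
  rewrite mulr0 -(Uv w hw); congr (apply_op U _).
  by apply/funext => i; rewrite /vadd /vscale oppr0 mul0r addr0.
- move=> w hw; rewrite apply_op_mul apply_op_house.
  have hw' : apply_op U w = w by apply: Uw => v' hv'; apply: hw; right.
  have -> : dot e w = 0.
    by rewrite /e dotDl self hw' (hw v) ?addr0 //; left.
  rewrite mulr0 -[RHS]hw'; congr (apply_op U _).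
  by apply/funext => i; rewrite /vadd /vscale oppr0 mul0r addr0.
Qed.

Lemma reflection_family (J : finType) (P : pred J) (F : J -> vec T) : exists U : op T,
  [/\ unitary U, (forall j, P j -> apply_op U (F j) = vscale (-1) (F j))
    & forall w, (forall j, P j -> dot (F j) w = 0) -> apply_op U w = w].
Proof.
have [U [uU Un Uf]] := reflection_through [seq F j | j <- enum P].
have inP v : List.In v [seq F j | j <- enum P] <-> exists2 j, P j & F j = v.
  have -> : (exists2 j, P j & F j = v) <-> (exists2 j, j \in enum P & F j = v).
    by split=> -[j hj e]; exists j; rewrite ?mem_enum // mem_enum in hj *.
  elim: (enum P) => [|j s IH] /=; first by split=> // -[].
  rewrite IH; split=> [[<-|[k ks <-]]|[k]].
  - by exists j; rewrite ?mem_head.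
  - by exists k; rewrite // inE ks orbT.
  - by rewrite inE => /predU1P[-> <-|ks <-]; [left|right; exists k].
exists U; split=> // [j Pj|w wo]; first by apply: Un; apply/inP; exists j.
by apply: Uf => v /inP[j Pj <-]; exact: wo.
Qed.

End Operators.

(* [p] and [a] are the coordinates of a bijection of [S] with [P * A]; [op_ext] is [U]
   acting on the factor [P], controlled by the factor [A]. *)
Section Extension.
Variables (S P A : finType) (p : S -> P) (a : S -> A) (mk : P -> A -> S).
Hypotheses (p_mk : forall x c, p (mk x c) = x) (a_mk : forall x c, a (mk x c) = c)
  (mkK : forall s, mk (p s) (a s) = s).

Definition op_ext (U : A -> op P) : op S :=
  fun s' s => if a s' == a s then U (a s) (p s') (p s) else 0.

Lemma sum_ext (F : S -> CC) : \sum_s F s = \sum_c \sum_x F (mk x c).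
Proof.
rewrite pair_big (reindex (fun xc => mk xc.2 xc.1)) //=.
exists (fun s => (a s, p s)) => [[c x]|s] _ /=; by rewrite ?a_mk ?p_mk ?mkK.
Qed.

Lemma apply_op_ext U v s :
  apply_op (op_ext U) v s = \sum_x U (a s) (p s) x * v (mk x (a s)).
Proof.
rewrite /apply_op sum_ext (bigD1 (a s)) //= [X in _ + X]big1 ?addr0.
  by apply: eq_bigr => x _; rewrite /op_ext a_mk p_mk eqxx.
move=> c /negbTE cs; apply: big1 => x _.
by rewrite /op_ext a_mk eq_sym cs mul0r.
Qed.

Lemma unitary_ext U : (forall c, unitary (U c)) -> unitary (op_ext U).
Proof.
move=> uU; apply: unitaryP => v w; rewrite /dot !sum_ext; apply: eq_bigr => c _.
rewrite -[RHS](dot_unitary (fun x => v (mk x c)) (fun x => w (mk x c)) (uU c)).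
by apply: eq_bigr => x _; rewrite !apply_op_ext !a_mk !p_mk.
Qed.

End Extension.

(** * Relabelling of registers *)

Section Transport.
Variables (S S' : finType) (h : S -> S') (h' : S' -> S).
Hypotheses (hK : cancel h h') (h'K : cancel h' h).

Lemma sum_transport (F : S -> CC) (Q : pred S) : \sum_(s | Q s) F s = \sum_(s' | Q (h' s')) F (h' s').
Proof. by rewrite (reindex h') //; exists h => s _; rewrite ?hK ?h'K. Qed.

Definition op_transport (U : op S) : op S' := fun i j => U (h' i) (h' j).

Lemma apply_op_transport U v : apply_op (op_transport U) (v \o h') = apply_op U v \o h'.
Proof. by apply/funext => i; rewrite /apply_op /= [RHS]sum_transport. Qed.

Lemma unitary_transport U : unitary U -> unitary (op_transport U).
Proof.
move=> uU i j; rewrite /op_transport -(sum_transport (fun k => (U k (h' i))^* * U k (h' j)) xpredT).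
by rewrite uU (can_eq h'K).
Qed.

End Transport.

(** The two models fix registers of type ['I_d.+1] started at [ord0]. This lets the constructions
    use any finite register with any start point; the enumeration is corrected by the transposition
    of [e w0] and [ord0]. *)
Lemma pointed_ordinal (W : finType) (w0 : W) :
  exists d (h : W -> 'I_d.+1) (h' : 'I_d.+1 -> W), [/\ cancel h h', cancel h' h & h w0 = ord0].
Proof.
have c0 : (0 < #|W|)%N by apply/card_gt0P; exists w0.
have cE : #|W| = #|W|.-1.+1 by rewrite prednK.
pose e w := cast_ord cE (enum_rank w); pose e' i := enum_val (cast_ord (esym cE) i).
have eK : cancel e e' by move=> w; rewrite /e /e' cast_ordK enum_rankK.
have e'K : cancel e' e by move=> i; rewrite /e /e' enum_valK cast_ordKV.
have sw (i : 'I_#|W|.-1.+1) :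
    (if (if i == ord0 then e w0 else if i == e w0 then ord0 else i) == ord0 then e w0
     else if (if i == ord0 then e w0 else if i == e w0 then ord0 else i) == e w0 then ord0
     else (if i == ord0 then e w0 else if i == e w0 then ord0 else i)) = i.
  have [->|i0] := eqVneq i ord0; first by have [->|_] := eqVneq (e w0) ord0; rewrite ?eqxx.
  have [->|ie] := eqVneq i (e w0); first by rewrite eqxx.
  by rewrite (negbTE i0) (negbTE ie).
pose t i := if i == ord0 then e w0 else if i == e w0 then ord0 else i.
exists #|W|.-1, (t \o e), (e' \o t); split.
- by move=> w; rewrite /= /t sw eK.
- by move=> i; rewrite /= e'K /t sw.
- by rewrite /= /t eqxx; case: ifP => // /eqP.
Qed.

(** * Gram kernels *)

Section Gram.
Variable R : rcfType.
Implicit Types (S T : finType).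

(** Positive semidefiniteness, as an explicit sum of squares: in this form it is visibly stable
    under sums, entrywise products and pullbacks, hence under tensor powers. *)
Definition gram T (A : T -> T -> R) := exists (K : finType) (g : K -> T -> R),
  forall x y, A x y = \sum_k g k x * g k y.

Lemma eq_gram T (A B : T -> T -> R) : (forall x y, A x y = B x y) -> gram A -> gram B.
Proof. by move=> e [K [g h]]; exists K, g => x y; rewrite -e. Qed.

Lemma gram_rank1 T (g : T -> R) : gram (fun x y => g x * g y).
Proof. by exists unit, (fun=> g) => x y; rewrite big_const card_unit /= addr0. Qed.

Lemma gram_const T (c : R) : 0 <= c -> gram (fun _ _ : T => c).
Proof.
move=> c0; apply: (eq_gram _ (gram_rank1 (fun=> Num.sqrt c))) => x y.
by rewrite -expr2 sqr_sqrtr.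
Qed.

Lemma gramD T (A B : T -> T -> R) : gram A -> gram B -> gram (fun x y => A x y + B x y).
Proof.
move=> [K [g hg]] [L [h hh]].
exists (K + L)%type, (fun k => match k with inl k => g k | inr l => h l end) => x y.
by rewrite big_sumType /= hg hh.
Qed.

Lemma gramM T (A B : T -> T -> R) : gram A -> gram B -> gram (fun x y => A x y * B x y).
Proof.
move=> [K [g hg]] [L [h hh]].
exists (K * L)%type, (fun k x => g k.1 x * h k.2 x) => x y.
rewrite hg hh big_distrlr /= pair_big /=.
by apply: eq_bigr => -[k l] _ /=; ring.
Qed.

Lemma gram_comp S T (f : S -> T) (A : T -> T -> R) : gram A -> gram (fun x y => A (f x) (f y)).
Proof. by move=> [K [g hg]]; exists K, (fun k => g k \o f) => x y; rewrite hg. Qed.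

Lemma gram_prod T (I : Type) (r : seq I) (A : I -> T -> T -> R) :
  (forall i, gram (A i)) -> gram (fun x y => \prod_(i <- r) A i x y).
Proof.
move=> gA; elim: r => [|i r IH].
  by apply: (eq_gram _ (gram_const _ ler01)) => x y; rewrite big_nil.
by apply: (eq_gram _ (gramM (gA i) IH)) => x y; rewrite big_cons.
Qed.

(** Entrywise products are monotone for the semidefinite order between positive kernels: the
    difference telescopes, one factor [B i - A i] at a time. *)
Lemma gram_prodB T (I : Type) (r : seq I) (A B : I -> T -> T -> R) :
  (forall i, gram (A i)) -> (forall i, gram (fun x y => B i x y - A i x y)) ->
  gram (fun x y => \prod_(i <- r) B i x y - \prod_(i <- r) A i x y).
Proof.
move=> gA gBA.
have gB i : gram (B i).
  by apply: (eq_gram _ (gramD (gBA i) (gA i))) => x y; rewrite subrK.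
elim: r => [|i r IH].
  by apply: (eq_gram _ (gram_const _ (lexx 0))) => x y; rewrite !big_nil subrr.
apply: (eq_gram _ (gramD (gramM (gBA i) (gram_prod r gB)) (gramM (gA i) IH))) => x y.
by rewrite !big_cons; ring.
Qed.

Definition qform T (A : T -> T -> R) (v : T -> R) := \sum_x \sum_y A x y * v x * v y.

Definition psd T (A : T -> T -> R) :=
  (forall x y, A x y = A y x) /\ (forall v, 0 <= qform A v).

Lemma qform_delta T (A : T -> T -> R) (a : T) : qform A (fun x => (x == a)%:R) = A a a.
Proof.
rewrite /qform (bigD1 a) //= [X in _ + X]big1 ?addr0 => [|x /negbTE ->]; last first.
  by apply: big1 => y _; rewrite mulr0 mul0r.
rewrite (bigD1 a) //= big1 ?addr0 => [|x /negbTE ->]; last by rewrite mulr0.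
by rewrite eqxx !mulr1.
Qed.

Lemma qform_update T (A : T -> T -> R) (a : T) (v : T -> R) (s : R) :
  (forall x y, A x y = A y x) ->
  qform A (fun x => v x + s * (x == a)%:R) =
  qform A v + 2 * s * (\sum_x A a x * v x) + s ^+ 2 * A a a.
Proof.
move=> sA.
have sum1 (F : T -> R) : \sum_x F x * (x == a)%:R = F a.
  by rewrite (bigD1 a) //= big1 ?addr0 ?eqxx ?mulr1 // => x /negbTE ->; rewrite mulr0.
have -> : qform A (fun x => v x + s * (x == a)%:R) =
  qform A v + s * (\sum_x \sum_y A x y * v x * (y == a)%:R)
   + s * (\sum_x (\sum_y A x y * v y) * (x == a)%:R)
   + s ^+ 2 * (\sum_x (\sum_y A x y * (y == a)%:R) * (x == a)%:R).
  rewrite /qform !mulr_sumr -!big_split /=; apply: eq_bigr => x _.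
  rewrite !mulr_suml !mulr_sumr -!big_split /=; apply: eq_bigr => y _.
  by ring.
rewrite !sum1; under eq_bigr => x _ do rewrite sum1 sA.
by ring.
Qed.

(* Cholesky: eliminate one nonzero diagonal entry at a time. *)
Lemma psd_gram T (A : T -> T -> R) : psd A -> gram A.
Proof.
have [n] := ubnP #|[set x | A x x != 0]|.
elim: n A => // n IH A ltn [sA pA].
have d0 x : 0 <= A x x by rewrite -qform_delta.
(* A zero diagonal entry kills its row: otherwise the multiple of the basis vector at [x] added here
   to the one at [y] makes the form equal to -1. *)
have cross x y : A x x = 0 -> A x y = 0.
  move=> Axx; apply/eqP/contraT => Axy.
  set v := fun z : T => (z == y)%:R : R.
  have := pA (fun z => v z + (- (A y y + 1) / (2 * A x y)) * (z == x)%:R).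
  rewrite qform_update // /v qform_delta Axx mulr0 addr0.
  have -> : \sum_z A x z * (z == y)%:R = A x y.
    by rewrite (bigD1 y) //= big1 ?addr0 ?eqxx ?mulr1 // => z /negbTE ->; rewrite mulr0.
  have -> : A y y + 2 * (- (A y y + 1) / (2 * A x y)) * A x y = -1 by field.
  by rewrite oppr_ge0 ler10.
have [a|all0] := pickP [pred x | A x x != 0]; last first.
  apply: (eq_gram _ (gram_const _ (lexx 0))) => x y; rewrite cross //.
  by apply/eqP; have /negbFE := all0 x.
rewrite /= => aan0; have aa0 : 0 < A a a by rewrite lt_def aan0 d0.
(* The Schur complement at [a]. Its form at [v] is the minimum of the form of [A] along the line
   through [v] in direction [a], hence nonnegative, and its diagonal has one nonzero entry fewer. *)
pose B x y := A x y - A a x * A a y / A a a.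
have gB : gram B.
  apply: IH; last split.
  - have Bd x : A x x = 0 -> B x x = 0.
      by move=> h; rewrite /B h sA (cross x) // !mul0r subr0.
    have Baa : B a a = 0 by rewrite /B mulfK // subrr.
    rewrite -ltnS; apply: leq_trans ltn; rewrite ltnS; apply: proper_card; apply/properP; split.
      apply/subsetP => x; rewrite !inE; apply: contraNN => /eqP h.
      by rewrite Bd.
    by exists a; rewrite !inE ?Baa ?eqxx.
  - by move=> x y; rewrite /B sA; ring.
  - move=> v; have := pA (fun x => v x + (- (\sum_x A a x * v x) / A a a) * (x == a)%:R).
    rewrite qform_update //; congr (_ <= _).
    set s := \sum_x A a x * v x.
    have -> : qform B v = qform A v - s * s / A a a.
      rewrite /qform /s big_distrlr /= mulr_suml -sumrB; apply: eq_bigr => x _.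
      rewrite mulr_suml -sumrB; apply: eq_bigr => y _.
      by rewrite /B; ring.
    by field.
apply: (eq_gram _ (gramD gB (gram_rank1 (fun x => A a x / Num.sqrt (A a a))))) => x y.
rewrite /B.
have -> : A a x / Num.sqrt (A a a) * (A a y / Num.sqrt (A a a)) =
  A a x * A a y / (Num.sqrt (A a a) ^+ 2).
  by rewrite expr2 invfM; ring.
by rewrite sqr_sqrtr ?ltW // subrK.
Qed.

End Gram.

(** * Duality for the adversary bound *)

(** Without such a point every value could be raised by more than [e], and finitely many raises
    would pass the bound [b]. *)
Lemma almost_max (R : archiRealFieldType) (S : Type) (F : S -> R) (b e : R) (s0 : S) :
  (forall s, F s <= b) -> 0 < e -> exists s, forall t, F t <= F s + e.
Proof.
move=> Fb e0; apply: contrapT => h.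
have step s : exists t, F s + e < F t.
  apply: contrapT => h2; apply: h; exists s => t; rewrite leNgt; apply/negP => h3.
  by apply: h2; exists t.
have climb k : exists s, F s0 + e *+ k <= F s.
  elim: k => [|k [s hs]]; first by exists s0; rewrite addr0.
  have [t ht] := step s; exists t.
  by rewrite mulrSr addrA (le_trans _ (ltW ht)) // lerD2r.
have q0 : 0 <= (b - F s0) / e by apply: divr_ge0; rewrite ?subr_ge0 ?Fb ?(ltW e0).
have := archi_boundP q0; set k := Num.Def.archi_bound _ => hk.
have [s hs] := climb k; rewrite ltr_pdivrMr // mulr_natl in hk.
by have := Fb s; rewrite leNgt; apply/negP; rewrite negbK; lra.
Qed.

Section Duality.
Variables (R : realType) (D I : finType) (g : D -> bool) (bit : D -> I -> bool).

Definition adv_sum (K : finType) (u : D -> I -> K -> R) (x y : D) : R :=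
  \sum_i \sum_k (bit x i != bit y i)%:R * (u x i k * u y i k).

Definition adv_cost (K : finType) (u : D -> I -> K -> R) (x : D) : R :=
  \sum_i \sum_k u x i k ^+ 2.

(** The minimisation form of the general adversary bound, with real vectors and the same family on
    both sides of each inner product. *)
Definition adv_feasible (W : R) := exists (K : finType) (u : D -> I -> K -> R),
  (forall x y, g x != g y -> adv_sum u x y = 1) /\ (forall x, adv_cost u x <= W).

(** A certificate against cost [W]: for a feasible [u] of cost at most [W], summing [Gam x y] times
    [adv_sum u x y] gives the total of [Gam], while the bound for each index keeps it below [W]
    times the total of [beta]. *)
Definition adv_witness (W : R) (Gam : D -> D -> R) (beta : D -> R) :=
  [/\ forall x y, Gam x y = Gam y x, forall x y, g x = g y -> Gam x y = 0,
      forall x, 0 < beta x,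
      forall i v, \sum_x \sum_y (bit x i != bit y i)%:R * (Gam x y * v x * v y)
                  <= \sum_x beta x * v x ^+ 2
    & W * \sum_x beta x < \sum_x \sum_y Gam x y].

(** Concatenation adds sums and costs, and scaling by [a] multiplies both by $a^2$; so the
    achievable pairs of sums and costs form a convex cone. *)
Definition adv_cat (K L : finType) (u : D -> I -> K -> R) (w : D -> I -> L -> R) :
  D -> I -> (K + L)%type -> R :=
  fun x i k => match k with inl k => u x i k | inr l => w x i l end.

Lemma adv_sum_cat (K L : finType) (u : D -> I -> K -> R) (w : D -> I -> L -> R) x y :
  adv_sum (adv_cat u w) x y = adv_sum u x y + adv_sum w x y.
Proof. by rewrite -big_split; apply: eq_bigr => i _; rewrite big_sumType. Qed.

Lemma adv_cost_cat (K L : finType) (u : D -> I -> K -> R) (w : D -> I -> L -> R) x :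
  adv_cost (adv_cat u w) x = adv_cost u x + adv_cost w x.
Proof. by rewrite -big_split; apply: eq_bigr => i _; rewrite big_sumType. Qed.

Definition adv_scale (a : R) (K : finType) (u : D -> I -> K -> R) := fun x i k => a * u x i k.

Lemma adv_sum_scale a (K : finType) (u : D -> I -> K -> R) x y :
  adv_sum (adv_scale a u) x y = a ^+ 2 * adv_sum u x y.
Proof.
rewrite mulr_sumr; apply: eq_bigr => i _; rewrite mulr_sumr.
by apply: eq_bigr => k _; rewrite /adv_scale; ring.
Qed.

Lemma adv_cost_scale a (K : finType) (u : D -> I -> K -> R) x :
  adv_cost (adv_scale a u) x = a ^+ 2 * adv_cost u x.
Proof.
rewrite mulr_sumr; apply: eq_bigr => i _; rewrite mulr_sumr.
by apply: eq_bigr => k _; rewrite /adv_scale exprMn.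
Qed.

Lemma adv_sumC (K : finType) (u : D -> I -> K -> R) x y : adv_sum u x y = adv_sum u y x.
Proof. by do 2!(apply: eq_bigr => ? _); rewrite eq_sym [u x _ _ * _]mulrC. Qed.

Section Repair.
Variables (K : finType) (u : D -> I -> K -> R) (h : R).
Hypothesis sep : forall x y, g x != g y -> exists i, bit x i != bit y i.
Hypothesis h_gt0 : 0 < h.
Hypothesis sum_near : forall x y, g x != g y -> `|1 - adv_sum u x y| <= h ^+ 2.

(** Each pair with values false and true gets a private coordinate, placed at one index where the
    two inputs differ. The entries [h] and (missing amount) / [h] multiply to the missing amount. *)
Definition repair : D -> I -> (D * D)%type -> R := fun x i ab =>
  [&& ~~ g ab.1, g ab.2 & [pick j | bit ab.1 j != bit ab.2 j] == Some i]%:R *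
  ((x == ab.1)%:R * h + (x == ab.2)%:R * ((1 - adv_sum u ab.1 ab.2) / h)).

Lemma adv_sum_repair_lt x y : ~~ g x -> g y -> adv_sum repair x y = 1 - adv_sum u x y.
Proof.
move=> gx gy.
have gxy : g x != g y by rewrite (negbTE gx) gy.
case ej : [pick j | bit x j != bit y j] => [j|]; last first.
  move: ej; case: pickP => // h0 _; have [i hi] := sep gxy.
  by have := h0 i; rewrite /= hi.
have bj : bit x j != bit y j by move: ej; case: pickP => // j' hj' [<-].
have hn0 := lt0r_neq0 h_gt0.
rewrite [LHS]/adv_sum (bigD1 j) //= [X in _ + X]big1 ?addr0; last first.
  move=> i ij; apply: big1 => -[a b] _; rewrite /repair /=.
  have [/and3P[ga gb /eqP eab]|] := boolP [&& _, _ & _]; last by rewrite !mul0r mulr0.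
  have [xa|xa] := eqVneq x a; last first.
    have [xb|xb] := eqVneq x b; first by rewrite xb gb in gx.
    by rewrite !mul0r addr0 mulr0 mul0r mulr0.
  have [yb|yb] := eqVneq y b; last first.
    have [ya|ya] := eqVneq y a; first by rewrite -ya gy in ga.
    by rewrite !mul0r addr0 !mulr0.
  by move: eab; rewrite -xa -yb ej => -[ji]; rewrite ji eqxx in ij.
rewrite (bigD1 (x, y)) //= [X in _ + X]big1 ?addr0; last first.
  move=> [a b] abxy; rewrite /repair /=.
  have [/and3P[ga gb /eqP eab]|] := boolP [&& _, _ & _]; last by rewrite !mul0r mulr0.
  have [xa|xa] := eqVneq x a; last first.
    have [xb|xb] := eqVneq x b; first by rewrite xb gb in gx.
    by rewrite !mul0r addr0 mulr0 mul0r mulr0.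
  have [yb|yb] := eqVneq y b; last first.
    have [ya|ya] := eqVneq y a; first by rewrite -ya gy in ga.
    by rewrite !mul0r addr0 !mulr0.
  by rewrite xa yb eqxx in abxy.
rewrite bj /repair /= ej gx gy !eqxx /=.
have -> : (x == y) = false by apply/eqP => xy; rewrite xy eqxx in gxy.
have -> : (y == x) = false by apply/eqP => xy; rewrite xy eqxx in gxy.
by rewrite ?mulr1n ?mulr0n; field.
Qed.

Lemma adv_sum_repair x y : g x != g y -> adv_sum (adv_cat u repair) x y = 1.
Proof.
rewrite adv_sum_cat; have [gx|gx] := boolP (g x); have [gy|gy] // := boolP (g y) => _.
  by rewrite adv_sumC [adv_sum repair x y]adv_sumC adv_sum_repair_lt // addrC subrK.
by rewrite adv_sum_repair_lt // addrC subrK.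
Qed.

(** An input occurs in at most $2|D|$ ordered pairs, and each of its entries has square at most
    $h^2$ because the missing amounts are at most $h^2$. *)
Lemma adv_cost_repair x : adv_cost repair x <= 2 * #|D|%:R * h ^+ 2.
Proof.
have hn0 := lt0r_neq0 h_gt0.
apply: (@le_trans _ _ (\sum_(ab : D * D) ((x == ab.1)%:R + (x == ab.2)%:R) * h ^+ 2)).
  rewrite /adv_cost exchange_big; apply: ler_sum => -[a b] _ /=.
  case ej : [pick j | bit a j != bit b j] => [j|]; last first.
    rewrite big1 ?mulr_ge0 ?addr_ge0 ?exprn_ge0 ?ler0n ?ltW // => i _.
    by rewrite /repair /= ej !andbF mul0r expr0n.
  rewrite (bigD1 j) //= big1 ?addr0 => [|i ij]; last first.
    rewrite /repair /= ej; have -> : (Some j == Some i) = false.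
      by apply/eqP => -[ji]; rewrite ji eqxx in ij.
    by rewrite !andbF mul0r expr0n.
  rewrite /repair /= ej eqxx andbT.
  have [/andP[ga gb]|_] := boolP (~~ g a && g b); last first.
    by rewrite mul0r expr0n mulr_ge0 ?addr_ge0 ?exprn_ge0 ?ler0n ?ltW.
  have ab : a != b by apply/eqP => e; rewrite e gb in ga.
  have gab : g a != g b by rewrite (negbTE ga) gb.
  have le2 : ((1 - adv_sum u a b) / h) ^+ 2 <= h ^+ 2.
    rewrite -real_normK ?num_real // ler_pXn2r ?nnegrE ?normr_ge0 ?(ltW h_gt0) //.
    by rewrite normrM normfV (gtr0_norm h_gt0) ler_pdivrMr // -expr2 sum_near.
  have [xa|xa] := eqVneq x a.
    by rewrite xa (negbTE ab) /= mul1r mul0r !addr0 !mul1r.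
  have [xb|xb] := eqVneq x b; last by rewrite !mul0r !addr0 mul1r expr0n mul0r.
  by rewrite !mul1r mul0r !add0r mul1r.
have -> : \sum_(ab : D * D) ((x == ab.1)%:R + (x == ab.2)%:R) * h ^+ 2 =
  \sum_(a : D) \sum_(b : D) ((x == a)%:R + (x == b)%:R) * h ^+ 2 by rewrite pair_big.
have sum1 : \sum_(a : D) (x == a)%:R = 1 :> R.
  by rewrite (bigD1 x) //= eqxx big1 ?addr0 // => a; rewrite eq_sym => /negbTE ->.
under eq_bigr => a _.
  rewrite -mulr_suml big_split /= sum1 sumr_const; over.
rewrite -mulr_suml big_split /= sumr_const sumrMnl sum1.
by rewrite -[1 *+ #|D|]/(#|D|%:R) le_eqVlt; apply/orP; left; apply/eqP; ring.
Qed.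

End Repair.

Let target (x y : D) : R := (g x != g y)%:R.
Let masked (K : finType) (u : D -> I -> K -> R) (x y : D) : R := target x y * adv_sum u x y.

(** Squared Euclidean distance from the achieved point to the ideal one, where all costs equal [W];
    sums between inputs of equal value are masked out, being unconstrained. *)
Definition adv_dist (W : R) (K : finType) (u : D -> I -> K -> R) : R :=
  \sum_x \sum_y (target x y - masked u x y) ^+ 2 + \sum_x (adv_cost u x - W) ^+ 2.

Lemma adv_dist_ge0 W (K : finType) (u : D -> I -> K -> R) : 0 <= adv_dist W u.
Proof.
by rewrite addr_ge0 // sumr_ge0 // => x _; rewrite ?sumr_ge0 ?sqr_ge0 // => y _; rewrite sqr_ge0.
Qed.

(** Every sum and every cost is then within $h^2$ of its target. Repairing the sums costs $2|D|h^2$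
    more, and the total excess $(2|D|+1)h^2$ is at most 1. *)
Lemma adv_dist_small (W : R) (K : finType) (u : D -> I -> K -> R) (h : R) :
  (forall x y, g x != g y -> exists i, bit x i != bit y i) ->
  0 < h -> (2 * #|D|%:R + 1) * h ^+ 2 <= 1 -> adv_dist W u <= h ^+ 4 -> adv_feasible (W + 1).
Proof.
move=> sep h0 h1 dh.
have sum_term (F : D -> R) x : (forall y, 0 <= F y) -> F x <= \sum_y F y.
  by move=> F0; rewrite (bigD1 x) //= lerDl sumr_ge0.
have sqr_small a : a ^+ 2 <= h ^+ 4 -> `|a| <= h ^+ 2.
  have -> : h ^+ 4 = (h ^+ 2) ^+ 2 by rewrite -exprM.
  by rewrite -(real_normK (num_real a)) ler_pXn2r ?nnegrE ?normr_ge0 ?exprn_ge0 ?(ltW h0).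
have near x y : g x != g y -> `|1 - adv_sum u x y| <= h ^+ 2.
  move=> gxy; apply: sqr_small; apply: le_trans dh.
  rewrite /adv_dist -[leLHS]addr0 lerD //; last by rewrite sumr_ge0 // => z _; rewrite sqr_ge0.
  pose G x' := \sum_y (target x' y - masked u x' y) ^+ 2.
  have G0 x' : 0 <= G x' by rewrite sumr_ge0 // => z _; rewrite sqr_ge0.
  apply: le_trans (sum_term G x G0).
  have := sum_term (fun y => (target x y - masked u x y) ^+ 2) y (fun y => sqr_ge0 _).
  by rewrite /masked /target gxy mul1r.
have cost x : adv_cost u x <= W + h ^+ 2.
  rewrite -lerBlDl; apply: le_trans (ler_norm _) _; apply: sqr_small; apply: le_trans dh.
  rewrite /adv_dist -[leLHS]add0r lerD //.
    by rewrite sumr_ge0 // => z _; rewrite sumr_ge0 // => t _; rewrite sqr_ge0.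
  exact: (sum_term (fun x => (adv_cost u x - W) ^+ 2) x (fun y => sqr_ge0 _)).
exists (K + D * D)%type, (adv_cat u (repair u h)); split.
  by move=> x y gxy; apply: adv_sum_repair.
move=> x; rewrite adv_cost_cat.
have := adv_cost_repair h0 near x; have := cost x.
by move: h1; rewrite mulrDl mul1r; lra.
Qed.

(* The separating functional is the displacement from an approximate projection
   of the target onto the cone of achievable (sum, cost) pairs. *)
Theorem adv_duality (W : R) :
  (forall x y, g x != g y -> exists i, bit x i != bit y i) -> 0 <= W ->
  ~ adv_feasible (W + 1) -> exists Gam beta, adv_witness W Gam beta.
Proof.
move=> sep W0 infeas.
(* For constant [g] the empty family is feasible. *)
have [x0 [y0 gxy0]] : exists x y, g x != g y.
  apply: contrapT => h; apply: infeas; exists void, (fun _ _ => of_void R); split.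
    by move=> x y gxy; case: h; exists x, y.
  move=> x; rewrite /adv_cost big1 ?addr_ge0 // => i _.
  by apply: big1 => -[].
have [i0 _] := sep _ _ gxy0.
set P : R := \sum_x \sum_y target x y ^+ 2 + \sum_(x : D) W ^+ 2.
have P0 : 0 <= P.
  by rewrite addr_ge0 // sumr_ge0 // => x _; rewrite ?sumr_ge0 ?sqr_ge0 // => y _; rewrite sqr_ge0.
set h : R := (2 * #|D|%:R + 1)^-1.
have D0 : 0 <= #|D|%:R :> R by rewrite ler0n.
have h0 : 0 < h by rewrite invr_gt0; lra.
have h1 : (2 * #|D|%:R + 1) * h ^+ 2 <= 1.
  rewrite expr2 mulrA mulfV ?mul1r; last by lra.
  by rewrite invf_le1; lra.
(* [c] collects the errors of order [eta] met below: the first summand from the scaling of [u], the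
   second from the shift of [beta]. The choice of [eta] keeps their total below $h^4$, hence below
   the distance. *)
pose c := (4 * P + 3) / 2 + 2 * W * #|D|%:R + 1.
have c0 : 0 < c.
  have : 0 <= W * #|D|%:R by rewrite mulr_ge0.
  by rewrite /c; lra.
have h40 : 0 < h ^+ 4 by rewrite exprn_gt0.
pose eta := h ^+ 4 / (h ^+ 4 + c).
have hc0 : 0 < h ^+ 4 + c by apply: addr_gt0.
have eta0 : 0 < eta by apply: divr_gt0.
have eta1 : eta <= 1 by rewrite ler_pdivrMr // mul1r lerDl ltW.
have etac : eta * c < h ^+ 4.
  by rewrite /eta mulrAC ltr_pdivrMr // ltr_pM2l // ltrDr.
pose S := {K : finType & D -> I -> K -> R}.
pose s0 : S := @existT finType (fun K : finType => D -> I -> K -> R) void (fun _ _ => of_void R).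
have dist_le0 (s : S) : - adv_dist W (projT2 s) <= 0 by rewrite oppr_le0 adv_dist_ge0.
have [[K u] umax] := almost_max s0 dist_le0 (exprn_gt0 2 eta0).
have {}umax (L : finType) (w : D -> I -> L -> R) : adv_dist W u <= adv_dist W w + eta ^+ 2.
  by have := umax (@existT finType (fun K : finType => D -> I -> K -> R) L w); rewrite /=; lra.
(* [Gam] and [- b] are the two components of the displacement from the achieved point to the ideal
   one. *)
pose Gam x y := target x y - masked u x y.
pose b x := adv_cost u x - W.
have dE : adv_dist W u = \sum_x \sum_y Gam x y ^+ 2 + \sum_x b x ^+ 2 by [].
have far : h ^+ 4 < adv_dist W u.
  by rewrite ltNge; apply/negP => hd; apply: infeas; exact: adv_dist_small hd.
have GamT x y : Gam x y * target x y = Gam x y.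
  by rewrite /Gam /masked /target; case: (g x != g y); rewrite ?mul0r ?subrr ?mul0r ?mul1r ?mulr1.
(* First-order optimality against adding a small family supported on index [i] with entries [v]. Its
   squared scale [tau], equal to [eta / N], balances the quadratic term against the slack $\eta^2$
   of near-optimality. *)
have Zbound i v : \sum_x \sum_y (bit x i != bit y i)%:R * (Gam x y * v x * v y)
     - \sum_x b x * v x ^+ 2 <= 3 / 2 * eta * \sum_x v x ^+ 2.
  set Z := (X in X <= _); set N := \sum_x v x ^+ 2.
  have N0 : 0 <= N by rewrite sumr_ge0 // => x _; rewrite sqr_ge0.
  have [NE|Nn0] := eqVneq N 0.
    have v0 x : v x = 0.
      apply/eqP; rewrite -sqrf_eq0; move/eqP: NE; rewrite psumr_eq0; last by move=> z _; rewrite sqr_ge0.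
      by move=> /allP/(_ x (mem_index_enum x)).
    rewrite NE mulr0 /Z !big1 ?subr0 // => x _; first by rewrite v0 expr0n mulr0.
    by rewrite big1 // => y _; rewrite !v0 !mulr0.
  have Ngt0 : 0 < N by rewrite lt_def Nn0.
  pose w (x : D) (i' : I) (k : unit) := (i' == i)%:R * v x.
  have sumw x y : adv_sum w x y = (bit x i != bit y i)%:R * (v x * v y).
    rewrite /adv_sum (bigD1 i) //= [X in _ + X]big1 ?addr0; last first.
      by move=> j /negbTE ji; apply: big1 => k _; rewrite /w ji !mul0r mulr0.
    by under eq_bigr => k _ do rewrite /w eqxx !mul1r; rewrite big_const card_unit /= addr0.
  have costw x : adv_cost w x = v x ^+ 2.
    rewrite /adv_cost (bigD1 i) //= [X in _ + X]big1 ?addr0; last first.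
      by move=> j /negbTE ji; apply: big1 => k _; rewrite /w ji mul0r expr0n.
    by under eq_bigr => k _ do rewrite /w eqxx mul1r; rewrite big_const card_unit /= addr0.
  pose tau := eta / N.
  have tau0 : 0 < tau by rewrite divr_gt0.
  pose r := Num.sqrt tau; have r2 : r ^+ 2 = tau by rewrite sqr_sqrtr // ltW.
  have := umax _ (adv_cat u (adv_scale r w)).
  pose q x y : R := target x y * ((bit x i != bit y i)%:R * (v x * v y)).
  have -> : adv_dist W (adv_cat u (adv_scale r w)) = adv_dist W u - 2 * tau * Z
     + tau ^+ 2 * (\sum_x \sum_y q x y ^+ 2 + \sum_x (v x ^+ 2) ^+ 2).
    rewrite {1}/adv_dist.
    have -> : \sum_x \sum_y (target x y - masked (adv_cat u (adv_scale r w)) x y) ^+ 2 =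
       \sum_x \sum_y Gam x y ^+ 2 - 2 * tau *
       (\sum_x \sum_y (bit x i != bit y i)%:R * (Gam x y * v x * v y)) +
       tau ^+ 2 * \sum_x \sum_y q x y ^+ 2.
      rewrite !mulr_sumr -sumrB -big_split; apply: eq_bigr => x _ /=.
      rewrite !mulr_sumr -sumrB -big_split; apply: eq_bigr => y _ /=.
      rewrite /masked adv_sum_cat adv_sum_scale r2 sumw mulrDr opprD addrA -/(masked u x y) -/(Gam x y).
      by rewrite -{3}GamT /q; ring.
    have -> : \sum_x (adv_cost (adv_cat u (adv_scale r w)) x - W) ^+ 2 =
       \sum_x b x ^+ 2 + 2 * tau * (\sum_x b x * v x ^+ 2) + tau ^+ 2 * \sum_x (v x ^+ 2) ^+ 2.
      rewrite !mulr_sumr -!big_split; apply: eq_bigr => x _ /=.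
      by rewrite adv_cost_cat adv_cost_scale r2 costw /b; ring.
    by rewrite dE /Z; ring.
  have q2 : \sum_x \sum_y q x y ^+ 2 <= N ^+ 2.
    rewrite expr2 big_distrlr /=; apply: ler_sum => x _; apply: ler_sum => y _.
    rewrite /q /target; case: (g x != g y); case: (bit x i != bit y i);
    by rewrite ?mul1r ?mul0r ?mulr0 ?expr0n ?exprMn //= mulr_ge0 ?sqr_ge0.
  have v4 : \sum_x (v x ^+ 2) ^+ 2 <= N ^+ 2.
    rewrite [leRHS]expr2 big_distrlr /=; apply: ler_sum => x _.
    rewrite (bigD1 x) //= -expr2 lerDl sumr_ge0 // => y _.
    by rewrite mulr_ge0 ?sqr_ge0.
  set A := \sum_x \sum_y q x y ^+ 2 in q2 *; set B := \sum_x (v x ^+ 2) ^+ 2 in v4 *.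
  move=> ineq.
  have : 2 * tau * Z <= 3 * eta ^+ 2.
    have : tau ^+ 2 * (A + B) <= tau ^+ 2 * (2 * N ^+ 2).
      by rewrite ler_wpM2l ?sqr_ge0 //; lra.
    have -> : tau ^+ 2 * (2 * N ^+ 2) = 2 * eta ^+ 2 by rewrite /tau; field.
    by move: ineq; lra.
  have -> : 2 * tau * Z = (2 * eta) * (Z / N) by rewrite /tau; ring.
  move=> h2; have eta2 : 0 < 2 * eta by lra.
  by rewrite -ler_pdivrMr // -(ler_pM2l eta2); move: h2; rewrite expr2; lra.
(* [Zbound] at a basis vector gives [b x >= - 3/2 eta], so the shift makes [beta] positive; it also
   absorbs the error in [Zbound] for general [v]. *)
pose beta x := b x + 2 * eta.
have GamE : \sum_x \sum_y Gam x y * target x y = \sum_x \sum_y Gam x y.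
  by apply: eq_bigr => x _; apply: eq_bigr => y _; rewrite GamT.
exists Gam, beta; split.
- by move=> x y; rewrite /Gam /masked /target adv_sumC eq_sym.
- by move=> x y gxy; rewrite -GamT /target gxy eqxx mulr0.
- move=> x; have := Zbound i0 (fun z => (z == x)%:R).
  have sum1 (F : D -> R) : \sum_z F z * (z == x)%:R ^+ 2 = F x.
    rewrite (bigD1 x) //= big1 ?addr0 ?eqxx ?expr1n ?mulr1 // => z /negbTE ->.
    by rewrite expr0n mulr0.
  rewrite sum1 (_ : \sum_z (z == x)%:R ^+ 2 = 1); last first.
    by rewrite -[RHS](sum1 (fun=> 1)); apply: eq_bigr => z _; rewrite mul1r.
  rewrite big1; first by rewrite /beta; lra.
  move=> z _; apply: big1 => y _.
  have [->|] := eqVneq z x; last by rewrite mulr0 mul0r mulr0.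
  by have [->|] := eqVneq y x; rewrite ?eqxx ?mul0r ?mulr0.
- move=> i v; have := Zbound i v.
  have N0 : 0 <= \sum_x v x ^+ 2 by rewrite sumr_ge0 // => x _; rewrite sqr_ge0.
  have -> : \sum_x beta x * v x ^+ 2 = \sum_x b x * v x ^+ 2 + 2 * eta * \sum_x v x ^+ 2.
    by rewrite mulr_sumr -big_split; apply: eq_bigr => x _; rewrite /= /beta mulrDl.
  have : 3 / 2 * eta * (\sum_x v x ^+ 2) <= 2 * eta * \sum_x v x ^+ 2.
    by rewrite ler_wpM2r // ler_wpM2r ?ltW //; lra.
  by lra.
pose dd x := adv_cost u x.
pose Q := \sum_x \sum_y masked u x y ^+ 2 + \sum_x dd x ^+ 2.
pose ip := \sum_x \sum_y Gam x y * masked u x y - \sum_x b x * dd x.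
(* Comparing with the empty family, whose distance is [P], bounds the distance of [u] by [P + 1],
   and hence the size of the achieved point. *)
have Q0 : Q <= 4 * P + 2.
  have QPd : Q <= 2 * P + 2 * adv_dist W u.
    have -> : 2 * P + 2 * adv_dist W u =
      (\sum_x \sum_y (2 * target x y ^+ 2 + 2 * Gam x y ^+ 2)) +
       \sum_x (2 * W ^+ 2 + 2 * b x ^+ 2).
      under eq_bigr => x _ do rewrite big_split /= -!mulr_sumr.
      rewrite !big_split /= -!mulr_sumr dE /P; rewrite -[\sum_(x : D) W ^+ 2]/(\sum_(x : D) W * W) -mulr_sumr; ring.
    apply: lerD; apply: ler_sum => x _; last first.
      have -> : dd x = b x + W by rewrite /b subrK.
      by have := sqr_ge0 (b x - W); rewrite !expr2; lra.
    apply: ler_sum => y _.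
    have -> : masked u x y = target x y - Gam x y by rewrite /Gam; ring.
    by have := sqr_ge0 (target x y + Gam x y); rewrite !expr2; lra.
  have := umax _ (projT2 s0).
  have -> : adv_dist W (projT2 s0) = P.
    congr (_ + _); apply: eq_bigr => x _.
      apply: eq_bigr => y _; rewrite /masked /adv_sum big1 ?mulr0 ?subr0 // => i _.
      by rewrite big1 // => -[].
    by rewrite /adv_cost big1 ?sub0r ?sqrrN // => i _; rewrite big1 // => -[].
  have : eta ^+ 2 <= 1 by rewrite expr_le1 // ltW.
  by lra.
(* Shrinking [u] by $\sqrt{1-\eta}$ moves the achieved point along its ray. For an exact projection
   the displacement would be orthogonal to this ray; near-optimality gives the half of this that is
   used. *)
have ip_lb : - (eta * (4 * P + 3) / 2) <= ip.
  pose r := Num.sqrt (1 - eta).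
  have r2 : r ^+ 2 = 1 - eta by rewrite sqr_sqrtr // subr_ge0.
  have := umax _ (adv_scale r u).
  have -> : adv_dist W (adv_scale r u) = adv_dist W u + 2 * eta * ip + eta ^+ 2 * Q.
    rewrite {1}/adv_dist.
    have -> : \sum_x \sum_y (target x y - masked (adv_scale r u) x y) ^+ 2 =
       \sum_x \sum_y Gam x y ^+ 2 + 2 * eta * (\sum_x \sum_y Gam x y * masked u x y) +
       eta ^+ 2 * \sum_x \sum_y masked u x y ^+ 2.
      rewrite !mulr_sumr -!big_split; apply: eq_bigr => x _ /=.
      rewrite !mulr_sumr -!big_split; apply: eq_bigr => y _ /=.
      by rewrite /Gam /masked adv_sum_scale r2; ring.
    have -> : \sum_x (adv_cost (adv_scale r u) x - W) ^+ 2 =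
       \sum_x b x ^+ 2 - 2 * eta * (\sum_x b x * dd x) + eta ^+ 2 * \sum_x dd x ^+ 2.
      rewrite !mulr_sumr -sumrB -big_split; apply: eq_bigr => x _ /=.
      by rewrite adv_cost_scale r2 /b /dd; ring.
    by rewrite dE /ip /Q; ring.
  have : eta ^+ 2 * Q <= eta ^+ 2 * (4 * P + 2) by rewrite ler_wpM2l ?sqr_ge0.
  move=> hQ hu.
  have : eta * - (eta * (4 * P + 3) / 2) <= eta * ip.
    have -> : eta * - (eta * (4 * P + 3) / 2) = - (eta ^+ 2 * (4 * P + 2) + eta ^+ 2) / 2 by ring.
    by lra.
  by rewrite ler_pM2l.
have -> : \sum_x beta x = \sum_x b x + 2 * eta * #|D|%:R.
  by rewrite big_split /= sumr_const mulr_natr.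
have : adv_dist W u + ip = \sum_x \sum_y Gam x y - W * \sum_x b x.
  rewrite -GamE dE /ip mulr_sumr.
  transitivity (\sum_x \sum_y (Gam x y ^+ 2 + Gam x y * masked u x y) +
     \sum_x (b x ^+ 2 - b x * dd x)).
    under [\sum_x \sum_y (_ + _)]eq_bigr => x _ do rewrite big_split.
    by rewrite big_split sumrB /=; ring.
  rewrite -sumrN; congr (_ + _); apply: eq_bigr => x _; last by rewrite /b /dd; ring.
  by apply: eq_bigr => y _; rewrite /Gam; ring.
move: etac; rewrite /c => etac.
have -> : W * (\sum_x b x + 2 * eta * #|D|%:R) = W * (\sum_x b x) + eta * (2 * W * #|D|%:R) by ring.
by move: ip_lb far etac; rewrite !mulrDr mulr1; lra.
Qed.

End Duality.

(** * Query algorithms over arbitrary workspaces *)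

Definition qstate (n : nat) (W : finType) : finType := (('I_n.+1 * bool) * W)%type.

Definition flip_query n W (x : bits n) (s : qstate n W) : qstate n W :=
  ((s.1.1, s.1.2 (+) xbit x s.1.1), s.2).

Lemma flip_queryK n W (x : bits n) : involutive (@flip_query n W x).
Proof. by move=> [[i b] w]; rewrite /flip_query /= addbK. Qed.

Definition query n W (x : bits n) : op (qstate n W) := op_perm (@flip_query n W x).

Lemma apply_query n W (x : bits n) v : apply_op (@query n W x) v = v \o @flip_query n W x.
Proof. exact: apply_op_perm (flip_queryK x) (flip_queryK x). Qed.

Lemma unitary_query n W (x : bits n) : unitary (@query n W x).
Proof. exact: unitary_perm (flip_queryK x) (flip_queryK x). Qed.

Fixpoint run_queries n W (V : nat -> op (qstate n W)) (eta : vec (qstate n W)) x t :=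
  match t with
  | 0 => apply_op (V 0%N) eta
  | t'.+1 => apply_op (V t) (apply_op (query x) (run_queries V eta x t'))
  end.

Lemma qrun_transport n (Wk Wj : finType) (k0 : Wk) (j0 : Wj) (V : nat -> op (qstate n (Wk * Wj)%type))
    (T : nat) :
  (forall t, (t <= T)%N -> unitary (V t)) ->
  exists dk dj (hk : 'I_dk.+1 -> Wk) (hj : 'I_dj.+1 -> Wj) (U : nat -> op (qspace n dk dj)),
  [/\ bijective hk, bijective hj, (forall t, (t <= T)%N -> unitary (U t))
    & forall x t s, qrun U x t s =
       run_queries V (ket ((ord0, false), (k0, j0))) x t (s.1, (hk s.2.1, hj s.2.2))].
Proof.
move=> uV; have [dk [hk [hk' [hkK hk'K hk0]]]] := pointed_ordinal k0.
have [dj [hj [hj' [hjK hj'K hj0]]]] := pointed_ordinal j0.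
pose h (s : qstate n (Wk * Wj)%type) : qspace n dk dj := (s.1, (hk s.2.1, hj s.2.2)).
pose h' (s : qspace n dk dj) : qstate n (Wk * Wj)%type := (s.1, (hk' s.2.1, hj' s.2.2)).
have hK : cancel h h' by move=> [p [k j]]; rewrite /h' /h /= hkK hjK.
have h'K : cancel h' h by move=> [p [k j]]; rewrite /h' /h /= hk'K hj'K.
exists dk, dj, hk', hj', (fun t => op_transport h' (V t)); split.
- by exists hk.
- by exists hj.
- by move=> t tT; apply: unitary_transport hK h'K _ (uV t tT).
move=> x t s.
suff -> : qrun (fun t => op_transport h' (V t)) x t =
   run_queries V (ket ((ord0, false), (k0, j0))) x t \o h' by [].
elim: t {s} => [|t IH] /=.
  rewrite -(apply_op_transport hK h'K); congr apply_op.
  apply/funext => s; rewrite /ket /= -(can_eq hK) h'K /h /= hk0 hj0.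
  by [].
rewrite IH -(apply_op_transport hK h'K); congr apply_op.
by rewrite -[oracle x]/(query x) !apply_query.
Qed.

Lemma Q_computes_run n (f : pfun n) (T : nat) (Wk Wj : finType) (k0 : Wk) (j0 : Wj)
    (V : nat -> op (qstate n (Wk * Wj)%type)) :
  (forall t, (t <= T)%N -> unitary (V t)) ->
  (forall x v, f x = Some v ->
    2 / 3 <= \sum_(s : qstate n (Wk * Wj)%type | s.1.2 == v)
       `|run_queries V (ket ((ord0, false), (k0, j0))) x T s| ^+ 2) ->
  Q_computes f T.
Proof.
move=> uV hV; have [dk [dj [hk [hj [U [[hk' hkK hk'K] [hj' hjK hj'K] uU rU]]]]]] := qrun_transport k0 j0 uV.
exists dk, dj, U; split=> // x v /hV /le_trans; apply; rewrite le_eqVlt; apply/orP; left; apply/eqP.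
rewrite /qprob_out.
pose h (s : qspace n dk dj) : qstate n (Wk * Wj)%type := (s.1, (hk s.2.1, hj s.2.2)).
pose h' (s : qstate n (Wk * Wj)%type) : qspace n dk dj := (s.1, (hk' s.2.1, hj' s.2.2)).
have hK : cancel h h' by move=> [p [k j]]; rewrite /h' /h /= hkK hjK.
have h'K : cancel h' h by move=> [p [k j]]; rewrite /h' /h /= hk'K hj'K.
rewrite (sum_transport h'K hK); apply: eq_bigr => s _.
by rewrite rU.
Qed.

(* Two flag qubits are added to the workspace; the flag [(true, false)] marks the start state,
   which is swapped with [eta] before and after the computation. *)
Lemma Q_computes_projective n (f : pfun n) (T : nat) (W : finType)
    (eta : vec (qstate n W)) (V : nat -> op (qstate n W)) :
  dot eta eta = 1 -> (forall t, (t <= T)%N -> unitary (V t)) ->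
  (forall x, f x = Some true -> 2 / 3 <= `|dot eta (run_queries V eta x T)| ^+ 2) ->
  (forall x, f x = Some false -> `|dot eta (run_queries V eta x T)| ^+ 2 <= 1 / 3) ->
  Q_computes f T.
Proof.
move=> eta1 uV htrue hfalse.
have [[[i0 b0] w0] _] : exists s, eta s != 0.
  apply: contrapT => h; move: eta1; rewrite dot_0l; first by move/eqP; rewrite eq_sym oner_eq0.
  by move=> s; apply: contrapT => hs; apply: h; exists s; apply/eqP.
pose S := qstate n (W * (bool * bool))%type.
pose p (s : S) : qstate n W := (s.1, s.2.1).
pose a (s : S) : bool * bool := s.2.2.
pose mk (x : qstate n W) (c : bool * bool) : S := (x.1, (x.2, c)).
have p_mk x c : p (mk x c) = x by case: x.
have a_mk x c : a (mk x c) = c by [].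
have mkK s : mk (p s) (a s) = s by case: s => ? [].
pose emb (v : vec (qstate n W)) : vec S := fun s => v (p s) * (a s == (false, false))%:R.
have dot_emb v w : dot (emb v) (emb w) = dot v w.
  rewrite /dot (sum_ext p_mk a_mk mkK) (bigD1 (false, false)) //= [X in _ + X]big1 ?addr0.
    by apply: eq_bigr => x _; rewrite /emb p_mk a_mk eqxx !mulr1.
  by move=> c /negbTE c0; apply: big1 => x _; rewrite /emb a_mk c0 !mulr0.
pose lift U : op S := op_ext p a (fun _ => U).
have lift_emb U v : apply_op (lift U) (emb v) = emb (apply_op U v).
  apply/funext => s; rewrite (apply_op_ext p_mk a_mk mkK) /emb /apply_op mulr_suml.
  by apply: eq_bigr => x _; rewrite p_mk a_mk mulrA.
have query_emb x v : apply_op (query x) (emb v) = emb (apply_op (query x) v).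
  by rewrite !apply_query; apply/funext => s.
pose e0 : S := ((ord0, false), (w0, (true, false))).
have emb_e0 v : emb v e0 = 0 by rewrite /emb /= mulr0.
(* The reflection along the difference of two orthogonal unit vectors swaps them. *)
pose d : vec S := vadd (ket e0) (vscale (-1) (emb eta)).
have ket1 : dot (ket e0) (ket e0) = 1 by rewrite dot_ketl /ket eqxx.
have ke v : dot (ket e0) (emb v) = 0 by rewrite dot_ketl emb_e0.
have ek v : dot (emb v) (ket e0) = 0 by rewrite -dot_conj ke rmorph0.
have dd : dot d d = 2.
  rewrite /d !dotDl !dotDr !dotZl !dotZr ket1 ke ek dot_emb eta1 rmorphN rmorph1.
  by ring.
have house v : apply_op (op_house d) v = vadd v (vscale (- dot d v) d).
  by rewrite apply_op_house dd divff ?pnatr_eq0 // mul1r.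
(* The answer qubit receives the parity of the two flags, which is 1 on the start state and 0 on the
   embedded space; its old content is parked in the second flag to keep the map invertible. *)
pose out (s : S) : S := ((s.1.1, s.2.2.1 (+) s.2.2.2), (s.2.1, (s.2.2.1, s.1.2))).
pose out' (s : S) : S := ((s.1.1, s.2.2.2), (s.2.1, (s.2.2.1, s.2.2.1 (+) s.1.2))).
have outK : cancel out out' by move=> [[i b] [w [c e]]]; rewrite /out /out' /= addKb.
have out'K : cancel out' out by move=> [[i b] [w [c e]]]; rewrite /out /out' /= addKb.
(* The preparation and the final test are merged into the first and last unitaries, so the number of
   queries stays [T]; for [T = 0] both go into the same one. *)
pose V' t := if t == T then
   op_mul (op_mul (op_perm out) (op_house d)) (if t == 0%N then op_mul (lift (V t)) (op_house d) else lift (V t))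
   else if t == 0%N then op_mul (lift (V t)) (op_house d) else lift (V t).
have ulift t : (t <= T)%N -> unitary (lift (V t)).
  by move=> tT; apply: (unitary_ext p_mk a_mk mkK) => _; exact: uV.
have start : apply_op (op_house d) (ket e0) = emb eta.
  rewrite house; have -> : dot d (ket e0) = 1 by rewrite /d dotDl dotZl ket1 ek mulr0 addr0.
  by apply/funext => s; rewrite /d /vadd /vscale; ring.
have run t x : (t < T)%N -> run_queries V' (ket e0) x t = emb (run_queries V eta x t).
  elim: t => [|t IH] tT /=.
    by rewrite /V' (ltn_eqF tT) eqxx apply_op_mul start lift_emb.
  by rewrite /V' (ltn_eqF tT) /= IH ?(ltnW tT) // query_emb lift_emb.
have final x : run_queries V' (ket e0) x T =
   apply_op (op_perm out) (apply_op (op_house d) (emb (run_queries V eta x T))).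
  have [T0|Tpos] := posnP T.
    by rewrite T0 /= /V' T0 !eqxx !apply_op_mul start lift_emb.
  rewrite -(prednK Tpos) /= run ?prednK // query_emb /V' eqxx (gtn_eqF Tpos).
  by rewrite !apply_op_mul lift_emb.
have prob1 x : dot (run_queries V eta x T) (run_queries V eta x T) = 1.
  have : forall t, (t <= T)%N -> dot (run_queries V eta x t) (run_queries V eta x t) = 1.
    elim=> [|t IH] tT /=; first by rewrite (dot_unitary _ _ (uV _ tT)) eta1.
    by rewrite (dot_unitary _ _ (uV _ tT)) (dot_unitary _ _ (unitary_query x)) IH // ltnW.
  by apply.
apply: (@Q_computes_run n f T W (bool * bool)%type w0 (true, false) V').
  have uH := unitary_house d; have uO := unitary_perm out'K outK.
  have uI t : (t <= T)%N -> unitary (if t == 0%N then op_mul (lift (V t)) (op_house d) else lift (V t)).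
    by move=> tT; case: ifP => _; [exact: (unitary_mul (ulift t tT) uH)|exact: ulift].
  move=> t tT; rewrite /V'; case: ifP => _; last exact: uI.
  exact: (unitary_mul (unitary_mul uO uH) (uI t tT)).
move=> x v fx; rewrite -/e0 final.
set psi := run_queries V eta x T; set c := dot eta psi.
have -> : apply_op (op_house d) (emb psi) = vadd (emb (vadd psi (vscale (- c) eta))) (vscale c (ket e0)).
  rewrite house; have -> : dot d (emb psi) = - c.
    by rewrite /d dotDl dotZl ke dot_emb rmorphN rmorph1 add0r mulN1r.
  by apply/funext => s; rewrite /d /emb /vadd /vscale; ring.
rewrite (apply_op_perm _ out'K outK).
rewrite (sum_transport out'K outK).
under eq_bigr => s _ do rewrite /= outK.
rewrite big_mkcond /= (sum_ext p_mk a_mk mkK) (bigD1 (false, false)) //= (bigD1 (true, false)) //=.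
rewrite [X in _ + (_ + X)]big1 ?addr0; last first.
  move=> -[c1 c2] /andP[/negbTE n1 /negbTE n2]; apply: big1 => y _; case: ifP => // _.
  rewrite /vadd /vscale /emb /ket a_mk n1 mulr0 add0r; have -> : (mk y (c1, c2) == e0) = false.
    apply/eqP => /(congr1 a); rewrite a_mk /e0 /= => ce.
    by rewrite ce eqxx in n2.
  by rewrite mulr0 normr0 expr0n.
case: v fx => fx /=.
  rewrite big1 ?add0r //; apply: le_trans (htrue x fx) _; rewrite -/psi -/c.
  rewrite (bigD1 ((ord0, false), w0)) //= /vadd /vscale /emb a_mk mulr0 add0r.
  have -> : mk ((ord0, false), w0) (true, false) = e0 by [].
  have -> : ket e0 e0 = 1 by rewrite /ket eqxx.
  rewrite mulr1 lerDl sumr_ge0 // => y _; exact: exprn_ge0.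
rewrite [X in _ + X]big1 ?addr0 //.
pose r := vadd psi (vscale (- c) eta).
rewrite (eq_bigr (fun y => `|r y| ^+ 2)) => [|y _]; last first.
  rewrite /vadd /vscale /emb p_mk a_mk eqxx mulr1 /ket.
  have -> : (mk y (false, false) == e0) = false by apply/eqP => /(congr1 a).
  by rewrite mulr0 addr0.
rewrite -dot_normsq /r !dotDl !dotDr !dotZl !dotZr eta1 prob1 -/c -(dot_conj eta psi) -/c.
have := hfalse x fx; rewrite -/psi -/c normCK rmorphN /= => h.
have -> : 1 + - c * c^* + (- c^* * c + - c^* * (- c * 1)) = 1 - c * c^* by ring.
by rewrite lerBrDl -lerBrDr (_ : 1 - 2 / 3 = 1 / 3) //; field.
Qed.

(** * From a feasible adversary solution to a query algorithm *)

Definition dom n (f : pfun n) : finType := {x : bits n | isSome (f x)}.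
Definition dom_val n (f : pfun n) (x : dom f) : bool := f (val x) == Some true.
Definition dom_bit n (f : pfun n) (x : dom f) (i : 'I_n) : bool := val x i.

Lemma sum_qstate n (W : finType) (F : qstate n W -> CC) :
  \sum_s F s = \sum_b \sum_w F ((ord_max, b), w) +
               \sum_(i < n) \sum_b \sum_w F ((lift ord_max i, b), w).
Proof.
have -> : \sum_s F s = \sum_i \sum_b \sum_w F ((i, b), w).
  by rewrite pair_big pair_big /=; apply: eq_bigr => -[[i b] w].
by rewrite (bigD1_ord ord_max).
Qed.

Lemma sum_unlift n (W : finType) (F : 'I_n -> bool -> W -> CC) :
  \sum_(s : qstate n W) (if unlift ord_max s.1.1 is Some i then F i s.1.2 s.2 else 0) =
  \sum_i \sum_b \sum_w F i b w.
Proof.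
rewrite sum_qstate big1 ?add0r => [|b _]; last by apply: big1 => w _; rewrite unlift_none.
by apply: eq_bigr => i _; apply: eq_bigr => b _; apply: eq_bigr => w _; rewrite liftK.
Qed.

Section Upper.
Variables (n : nat) (f : pfun n) (K : finType) (u : dom f -> 'I_n -> K -> RR) (W : RR) (L : nat).
Hypothesis (u_sum : forall x y : dom f, dom_val x != dom_val y ->
  adv_sum (@dom_bit n f) u x y = 1).
Hypothesis (u_cost : forall x, adv_cost u x <= W).
Hypotheses (L_gt0 : (0 < L)%N) (W_le : 18 * W <= L%:R).

Let Wk : finType := (K + 'I_L)%type.
Let S := qstate n Wk.
Implicit Types (s : S) (x y : dom f) (v : vec S).

(** Clock states sit on the idle query index. Those with answer qubit false will collect the phase
    of [f x]; those with answer qubit true stay fixed as a reference. *)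
Definition clock (b : bool) (t : 'I_L) : vec S := ket ((ord_max, b), inr t).

(** For inputs of different value, the answer qubits agree exactly at the indices where the inputs
    differ, and the signs multiply to -1. So the constraint on [u] makes the inner product of the
    two catalysts equal to -1. *)
Definition catalyst x : vec S := fun s =>
  if unlift ord_max s.1.1 is Some i then
    if s.2 is inl k then
      (s.1.2 == dom_bit x i (+) dom_val x)%:R * (-1) ^+ (~~ dom_val x) * rc (u x i k)
    else 0
  else 0.

Lemma catalyst_idle x b w : catalyst x ((ord_max, b), w) = 0.
Proof. by rewrite /catalyst unlift_none. Qed.

Lemma dot_catalyst x y : dot (catalyst x) (catalyst y) =
  (-1) ^+ (dom_val x (+) dom_val y) *
  \sum_i \sum_k (dom_bit x i (+) dom_val x == dom_bit y i (+) dom_val y)%:R *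
     rc (u x i k * u y i k).
Proof.
transitivity (\sum_i \sum_b \sum_(w : Wk) (if w is inl k then
   (b == dom_bit x i (+) dom_val x)%:R * (b == dom_bit y i (+) dom_val y)%:R
   * (-1) ^+ (dom_val x (+) dom_val y) * rc (u x i k * u y i k) else 0)).
  rewrite -sum_unlift; apply: eq_bigr => -[[i b] w] _; rewrite /catalyst /=.
  case: (unlift _ _) => [j|]; last by rewrite mulr0.
  case: w => [k|t]; last by rewrite mulr0.
  rewrite !rmorphM rmorphXn rmorphN rmorph1 rmorph_nat /= rc_conj.
  by case: (dom_val x); case: (dom_val y) => /=; rewrite ?expr0 ?expr1; ring.
rewrite mulr_sumr; apply: eq_bigr => i _; rewrite mulr_sumr big_bool !big_sumType /=.
rewrite !big1_eq !addr0 -big_split /=; apply: eq_bigr => k _.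
by case: (dom_bit x i (+) _); case: (dom_bit y i (+) _) => /=; ring.
Qed.

Lemma catalyst_norm x : dot (catalyst x) (catalyst x) <= rc W.
Proof.
rewrite dot_catalyst addbb expr0 mul1r.
apply: le_trans (_ : rc (adv_cost u x) <= _); last by rewrite rc_le.
rewrite /adv_cost rmorph_sum le_eqVlt; apply/orP; left; apply/eqP.
apply: eq_bigr => i _; rewrite rmorph_sum; apply: eq_bigr => k _ /=.
by rewrite eqxx mul1r expr2.
Qed.

Lemma catalyst_cross x y : dom_val x != dom_val y -> dot (catalyst x) (catalyst y) = -1.
Proof.
move=> gxy; rewrite dot_catalyst addbC.
have -> : dom_val y (+) dom_val x = true by case: (dom_val x) gxy; case: (dom_val y).
have := u_sum gxy => /(congr1 rc); rewrite rmorph1 => h.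
rewrite expr1 mulN1r; congr (- _); rewrite -[RHS]h /adv_sum rmorph_sum.
apply: eq_bigr => i _; rewrite rmorph_sum; apply: eq_bigr => k _ /=.
rewrite [RHS]rmorphM rmorph_nat; congr (_%:R * _).
move: gxy; case: (dom_val x); case: (dom_val y) => // _;
by case: (dom_bit x i); case: (dom_bit y i).
Qed.

Lemma dot_clockl b t v : dot (clock b t) v = v ((ord_max, b), inr t).
Proof. exact: dot_ketl. Qed.

(** This reflection is independent of the input, yet it multiplies clock plus catalyst by the sign
    of [f x] for every [x]: if [f x] is true, the vector is orthogonal to all the negated ones,
    since 1 from the clock cancels -1 from the catalysts. *)
Lemma mirror_exists (t : 'I_L) : exists U : op S,
  [/\ unitary U,
      forall x, ~~ dom_val x -> apply_op U (vadd (clock false t) (catalyst x)) =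
         vscale (-1) (vadd (clock false t) (catalyst x))
    & forall v, (forall x, ~~ dom_val x -> dot (vadd (clock false t) (catalyst x)) v = 0) ->
         apply_op U v = v].
Proof.
have [U [uU Un Uf]] := reflection_family (fun x => ~~ dom_val x)
  (fun x => vadd (clock false t) (catalyst x)).
by exists U.
Qed.

(** Between two queries this is a sign -1 where the answer qubit equals the queried bit, which on
    the catalyst happens exactly when [f x] is false. It cancels the mirror's sign on the catalyst
    and leaves it on the clock. *)
Let kick : op S := op_diag (fun s => if (s.1.1 != ord_max) && ~~ s.1.2 then -1 else 1).

Lemma unitary_kick : unitary kick.
Proof. by apply: unitary_diag => s; case: ifP; rewrite ?normrN normr1. Qed.

Let oracle_kick x v : vec S :=
  apply_op (query (val x)) (apply_op kick (apply_op (query (val x)) v)).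

Lemma oracle_kickE x v s : oracle_kick x v s =
  (if (s.1.1 != ord_max) && ~~ (s.1.2 (+) xbit (val x) s.1.1) then -1 else 1) * v s.
Proof. by rewrite /oracle_kick !apply_query /= apply_op_diag /= flip_queryK. Qed.

Lemma oracle_kick_idle x v : (forall s, s.1.1 != ord_max -> v s = 0) -> oracle_kick x v = v.
Proof.
move=> v0; apply/funext => s; rewrite oracle_kickE.
have [|/v0 ->] := eqVneq s.1.1 ord_max; [by rewrite mul1r|by rewrite mulr0].
Qed.

Lemma oracle_kick_catalyst x :
  oracle_kick x (catalyst x) = vscale ((-1) ^+ (~~ dom_val x)) (catalyst x).
Proof.
apply/funext => -[[i b] w]; rewrite oracle_kickE /vscale /catalyst /=.
case: unliftP => [j ->|->]; last by rewrite mulr0 mulr0.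
case: w => [k|t]; last by rewrite !mulr0.
rewrite [lift _ _ == _]eq_sym neq_lift /xbit liftK -/(dom_bit x j) /=.
by case: (dom_bit x j); case: (dom_val x); case: b; rewrite /= ?mul0r ?mulr0 ?expr0 ?expr1 ?mul1r.
Qed.

Lemma oracle_kickD x v1 v2 :
  oracle_kick x (vadd v1 v2) = vadd (oracle_kick x v1) (oracle_kick x v2).
Proof. by rewrite /oracle_kick !apply_opD. Qed.

Lemma oracle_kickZ x a v : oracle_kick x (vscale a v) = vscale a (oracle_kick x v).
Proof. by rewrite /oracle_kick !apply_opZ. Qed.

(* After [t] rounds the phase of [f x] sits on the first [t] clock states. *)
Let phase x (t : nat) : vec S := fun s =>
  if s.1.1 == ord_max then
    if s.2 is inr t' then
      if ~~ s.1.2 && (t' < t)%N then (-1) ^+ (~~ dom_val x) else 1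
    else 0
  else 0.

Lemma dot_phase_catalyst x t y : dot (phase x t) (catalyst y) = 0.
Proof.
apply: big1 => -[[i b] w] _; rewrite /phase /catalyst /=.
have [->|_] := eqVneq i ord_max; last by rewrite rmorph0 mul0r.
by rewrite unlift_none mulr0.
Qed.

Lemma dot_phase x t t' : dot (phase x t) (phase x t') =
  \sum_(j < L) (1 + (if (j < t)%N then (-1) ^+ (~~ dom_val x) else 1)
                   * (if (j < t')%N then (-1) ^+ (~~ dom_val x) else 1)).
Proof.
rewrite /dot sum_qstate [X in _ + X]big1 ?addr0; last first.
  move=> i _; rewrite big1 // => b _; rewrite big1 // => w _; rewrite /phase /=.
  by rewrite [lift _ _ == _]eq_sym (negbTE (neq_lift _ _)) rmorph0 mul0r.
have zero b : \sum_(k : K) (phase x t (ord_max, b, inl k))^* * phase x t' (ord_max, b, inl k) = 0.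
  by apply: big1 => k _; rewrite /phase eqxx /= rmorph0 mul0r.
rewrite big_bool !big_sumType /= !zero !add0r.
rewrite -big_split /=; apply: eq_bigr => j _; rewrite /phase eqxx /=.
rewrite rmorph1 mul1r; congr (_ + _ * _); case: ifP => _; last by rewrite rmorph1.
by rewrite rmorphXn rmorphN rmorph1.
Qed.

Section Round.
Variables (t : 'I_L) (U : op S).
Hypotheses (U_flip : forall x, ~~ dom_val x -> apply_op U (vadd (clock false t) (catalyst x)) =
         vscale (-1) (vadd (clock false t) (catalyst x)))
  (U_fix : forall v, (forall x, ~~ dom_val x -> dot (vadd (clock false t) (catalyst x)) v = 0) ->
         apply_op U v = v).

Lemma round_step x : oracle_kick x (apply_op U (vadd (phase x t) (catalyst x))) =
  vadd (phase x t.+1) (catalyst x).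
Proof.
pose rest := vadd (phase x t) (vscale (-1) (clock false t)).
have clock_idle v c : (forall s, s.1.1 != ord_max -> v s = 0) ->
    forall s, s.1.1 != ord_max -> vadd v (vscale c (clock false t)) s = 0.
  move=> v0 s sm; rewrite /vadd /vscale v0 // add0r /clock /ket.
  have [e|] := eqVneq s; last by rewrite mulr0.
  by rewrite e eqxx in sm.
have phase_idle r s : s.1.1 != ord_max -> phase x r s = 0 by rewrite /phase => /negbTE ->.
have rest_idle s : s.1.1 != ord_max -> rest s = 0 by exact: (clock_idle _ _ (phase_idle t)).
have clock1 : dot (clock false t) (clock false t) = 1 by rewrite dot_clockl /clock /ket eqxx.
have clock_cat y : dot (clock false t) (catalyst y) = 0 by rewrite dot_clockl catalyst_idle.
have cat_clock y : dot (catalyst y) (clock false t) = 0 by rewrite -dot_conj clock_cat rmorph0.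
have clock_rest : dot (clock false t) rest = 0.
  rewrite /rest dotDr dotZr clock1 mulr1 dot_clockl /phase eqxx /= ltnn; exact: subrr.
have cat_rest y : dot (catalyst y) rest = 0.
  by rewrite /rest dotDr dotZr cat_clock mulr0 addr0 -dot_conj dot_phase_catalyst rmorph0.
have U_rest : apply_op U rest = rest.
  by apply: U_fix => y _; rewrite dotDl clock_rest cat_rest addr0.
have -> : vadd (phase x t) (catalyst x) = vadd rest (vadd (clock false t) (catalyst x)).
  by apply/funext => s; rewrite /rest /vadd /vscale; ring.
rewrite apply_opD U_rest oracle_kickD oracle_kick_idle //.
have -> : apply_op U (vadd (clock false t) (catalyst x)) =
   vscale ((-1) ^+ (~~ dom_val x)) (vadd (clock false t) (catalyst x)).
  have [gx|gx] := boolP (dom_val x); last by rewrite U_flip.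
  rewrite U_fix => [|y gy]; first by apply/funext => s; rewrite /vscale mul1r.
  rewrite dotDl !dotDr clock1 clock_cat cat_clock catalyst_cross ?gx //; first by ring.
  by rewrite (negbTE gy).
have -> : vadd (clock false t) (catalyst x) = vadd (catalyst x) (vscale 1 (clock false t)).
  by apply/funext => s; rewrite /vadd /vscale; ring.
rewrite oracle_kickZ oracle_kickD oracle_kick_catalyst oracle_kickZ (@oracle_kick_idle x (clock _ _)).
  apply/funext => -[[i b] w]; rewrite /rest /vadd /vscale.
  have -> : phase x t.+1 (i, b, w) = phase x t (i, b, w) + ((-1) ^+ (~~ dom_val x) - 1) * clock false t (i, b, w).
    rewrite /phase /clock /ket /= !xpair_eqE.
    case: (i == ord_max) => /=; last by rewrite mulr0 addr0.
    case: w => [k|t'] /=; first by rewrite andbF mulr0 addr0.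
    case: b => /=; first by rewrite mulr0 addr0.
    rewrite ltnS leq_eqVlt -[inr t' == _]/(t' == t) -[t' == t]/(val t' == val t).
    by case: (ltngtP t' t) => /= _; ring.
  by case: (dom_val x); rewrite ?expr0 ?expr1; ring.
move=> s sm; rewrite /clock /ket; have [e|//] := eqVneq s.
by rewrite e eqxx in sm.
Qed.

End Round.

Theorem query_algorithm : Q_computes f (2 * L).
Proof.
have [[x0]|noD] := pselect (inhabited (dom f)); last first.
  exists 0%N, 0%N, (fun=> @op1 _); split=> [t _|x v fx]; first exact: unitary1.
  by case: noD; split; exists x; rewrite fx.
have [R hR] := choice mirror_exists.
pose r t : op S := if insub t is Some i then R i else @op1 S.
have rE (t : 'I_L) : r t = R t by rewrite /r valK.
have ur t : unitary (r t).
  by rewrite /r; case: insubP => [i _ _|_]; [have [] := hR i|exact: unitary1].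
pose V t := if odd t then kick else r t./2.
have uV t : unitary (V t) by rewrite /V; case: ifP => _; [exact: unitary_kick|exact: ur].
(* The amplitude of the uniform superposition over the [2 * L] clock states. *)
pose a : CC := (sqrtC (2 * L)%:R)^-1.
have a2 : a ^+ 2 * (2 * L)%:R = 1.
  by rewrite exprVn sqrtCK mulVf // pnatr_eq0 muln_eq0 /= -lt0n.
have a0 : 0 <= a by rewrite invr_ge0 sqrtC_ge0 ler0n.
have ac : a^* = a by rewrite geC0_conj.
pose base : vec S := fun s => if s.1.1 == ord_max then if s.2 is inr _ then 1 else 0 else 0.
have phase0 x : phase x 0 = base.
  apply/funext => -[[i b] w]; rewrite /phase /base /=.
  by case: ifP => // _; case: w => // t; rewrite andbF.
pose eta := vscale a base.
have eta1 : dot eta eta = 1.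
  rewrite /eta dotZl dotZr ac mulrA -expr2.
  rewrite -(phase0 x0) dot_phase.
  under eq_bigr => j _ do rewrite ltn0 mulr1.
  by rewrite sumr_const card_ord -mulr_natr -[1 + 1]/(2%:R) -natrM a2.
pose pre x := fix pre t := if t is t'.+1 then oracle_kick x (apply_op (r t') (pre t')) else eta.
have run x t : run_queries V eta (val x) t.*2 = apply_op (r t) (pre x t).
  elim: t => [|t IH]; first by [].
  by rewrite doubleS /= IH /V /= !odd_double /= ?doubleK ?uphalf_double.
have rL : r L = @op1 S by rewrite /r insubF // ltnn.
(* The actual run starts without the catalyst. The missing vector is carried along by unitaries, so
   the error keeps its initial squared norm, at most [W / (2 L)], hence at most 1/36. *)
have close x t : (t <= L)%N -> exists2 del : vec S,
    pre x t = vadd (vscale a (vadd (phase x t) (catalyst x))) del &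
    dot del del = a ^+ 2 * dot (catalyst x) (catalyst x).
  elim: t => [_|t IH tL].
    exists (vscale (- a) (catalyst x)).
      by rewrite /= phase0 /eta; apply/funext => s; rewrite /vadd /vscale; ring.
    by rewrite dotZl dotZr rmorphN /= ac; ring.
  have [del e1 e2] := IH (ltnW tL).
  exists (oracle_kick x (apply_op (r t) del)).
    rewrite /= e1 apply_opD apply_opZ oracle_kickD oracle_kickZ.
    have [_ Rn Rf] := hR (Ordinal tL).
    by rewrite -[t]/(val (Ordinal tL)) rE (round_step Rn Rf).
  rewrite -e2 /oracle_kick (dot_unitary _ _ (unitary_query _)).
  by rewrite (dot_unitary _ _ unitary_kick) (dot_unitary _ _ (unitary_query _)) dot_unitary.
have overlap x : exists2 z : CC, `|z| ^+ 2 <= 1 / 36 &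
    dot eta (run_queries V eta (val x) (2 * L)) = (if dom_val x then 1 else 0) + z.
  have [del e1 e2] := close x L (leqnn L).
  exists (dot eta del).
    apply: le_trans (Cauchy_Schwarz _ _) _; rewrite eta1 mul1r e2.
    apply: le_trans (_ : a ^+ 2 * rc W <= _).
      by rewrite ler_wpM2l ?exprn_ge0 ?catalyst_norm.
    have -> : 1 / 36 = a ^+ 2 * rc (L%:R / 18).
      transitivity (1 / 36 * (a ^+ 2 * (2 * L)%:R)); first by rewrite a2 mulr1.
      by rewrite fmorph_div !rmorph_nat natrM; field.
    by rewrite ler_wpM2l ?exprn_ge0 // rc_le; have := W_le; lra.
  rewrite mul2n run rL apply_op1 e1 dotDr; congr (_ + _).
  rewrite dotZr dotDr /eta !dotZl ac -(phase0 x) dot_phase_catalyst mulr0 addr0 dot_phase.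
  under eq_bigr => j _ do rewrite ltn0 ltn_ord mul1r.
  rewrite sumr_const card_ord mulrA -expr2.
  case: (dom_val x); last by rewrite expr1 subrr mul0rn mulr0.
  by rewrite expr0 -mulr_natr -[1 + 1]/(2%:R) -natrM a2.
apply: (@Q_computes_projective n f (2 * L) Wk eta V) => //.
  move=> x fx; have fxs : isSome (f x) by rewrite fx.
  have [z hz] := overlap (exist _ x fxs); rewrite /dom_val /= fx eqxx => ->.
  have z6 : `|z| <= 1 / 6.
    by rewrite -(@ler_pXn2r _ 2) ?nnegrE ?divr_ge0 ?normr_ge0 ?ler01 ?ler0n // (le_trans hz) // le_eqVlt; apply/orP; left; apply/eqP; field.
  have h56 : 5 / 6 <= `|1 + z|.
    apply: le_trans (lerB_normD _ _); rewrite normr1 lerBrDl -lerBrDr (_ : 1 - 5 / 6 = 1 / 6) //.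
    by field.
  apply: le_trans (_ : (5 / 6) ^+ 2 <= _).
    rewrite -subr_ge0 (_ : (5 / 6) ^+ 2 - 2 / 3 = 1 / 36); first by rewrite divr_ge0 ?ler01 ?ler0n.
    by field.
  by rewrite ler_pXn2r ?nnegrE ?divr_ge0 ?normr_ge0 ?ler0n.
move=> x fx; have fxs : isSome (f x) by rewrite fx.
have [z hz] := overlap (exist _ x fxs); rewrite /dom_val /= fx add0r => ->.
apply: le_trans hz _; rewrite -subr_ge0 (_ : 1 / 3 - 1 / 36 = 11 / 36); first by rewrite divr_ge0 ?ler0n.
by field.
Qed.

End Upper.

(** * The multiplicative adversary kernel *)

Lemma gram_diag (R : rcfType) (T : finType) (c : T -> R) :
  (forall x, 0 <= c x) -> gram (fun x y => (x == y)%:R * c x).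
Proof.
move=> c0; exists T, (fun k x => (x == k)%:R * Num.sqrt (c x)) => x y.
rewrite (bigD1 x) //= big1 ?addr0 => [|k kx]; last by rewrite eq_sym (negbTE kx) !mul0r.
rewrite eqxx mul1r [y == x]eq_sym; case: eqP => [->|_]; last by rewrite !mul0r mulr0.
by rewrite !mul1r -expr2 sqr_sqrtr.
Qed.

Section Kernel.
Variables (R : realType) (D I : finType) (g : D -> bool) (bit : D -> I -> bool).

Definition differ_sign (x y : D) (i : I) : R := if bit x i != bit y i then -1 else 1.

(* With [B] the diagonal form of [beta] and [A] the top of the spectrum of [Gam] relative
   to [B], the kernel is [2 B - Gam / A]. *)
Lemma adv_kernel (W : R) Gam beta (eta : R) : adv_witness g bit W Gam beta ->
  1 <= W -> 0 < eta < 1 ->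
  exists (A : R) (M : D -> D -> R) (b : D -> R),
  [/\ [/\ W <= A, gram M, forall x, 0 <= b x & \sum_x b x = 1],
      \sum_x \sum_y M x y <= 1 + eta,
      forall i, gram (fun x y => (1 + 2 / A) * M x y - differ_sign x y i * M x y)
    & forall v, gram (fun x y => 2 / 3 * M x y - (x == y)%:R * ((g x == v)%:R * b x))].
Proof.
move=> [GamC Gam0 beta0 Gami Gamtop] W1 /andP[eta0 eta1].
pose B (v : D -> R) := \sum_x beta x * v x ^+ 2.
pose Q v := qform Gam v.
have B0 v : 0 <= B v by rewrite sumr_ge0 // => x _; rewrite mulr_ge0 ?sqr_ge0 ?ltW.
have Bterm v x : beta x * v x ^+ 2 <= B v.
  by rewrite /B (bigD1 x) //= lerDl sumr_ge0 // => y _; rewrite mulr_ge0 ?sqr_ge0 ?ltW.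
pose c := \sum_x \sum_y `|Gam x y| * ((beta x)^-1 + (beta y)^-1).
have Qc v : Q v <= c * B v.
  rewrite /Q /qform /c mulr_suml; apply: ler_sum => x _.
  rewrite mulr_suml; apply: ler_sum => y _.
  have sq z : v z ^+ 2 <= (beta z)^-1 * B v by rewrite ler_pdivlMl.
  apply: le_trans (ler_norm _) _; rewrite -mulrA normrM -mulrA ler_wpM2l //.
  rewrite mulrDl; apply: le_trans (lerD (sq x) (sq y)).
  rewrite normrM -(real_normK (num_real (v x))) -(real_normK (num_real (v y))).
  by have := sqr_ge0 (`|v x| - `|v y|); have := sqr_ge0 `|v x|; have := sqr_ge0 `|v y|; rewrite !expr2; lra.
have c0 : 0 <= c.
  rewrite sumr_ge0 // => x _; rewrite sumr_ge0 // => y _.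
  by rewrite mulr_ge0 // addr_ge0 // invr_ge0 ltW.
have Fc v : Q v / B v <= c.
  have [->|Bn0] := eqVneq (B v) 0; first by rewrite invr0 mulr0.
  by rewrite ler_pdivrMr // lt_def Bn0 B0.
(* A near-maximiser of the Rayleigh quotient of [Gam] relative to [B], with value 0 where [B]
   vanishes. Adding [eta] makes [A] an upper bound for all quotients, and the constant vector shows
   that it exceeds [W]. *)
have [de hde] := almost_max (fun=> 1 : R) Fc eta0.
pose A := Q de / B de + eta.
have one : W < Q (fun=> 1) / B (fun=> 1).
  have BE : B (fun=> 1) = \sum_x beta x by apply: eq_bigr => x _; rewrite expr1n mulr1.
  have QE : Q (fun=> 1) = \sum_x \sum_y Gam x y.
    by apply: eq_bigr => x _; apply: eq_bigr => y _; rewrite !mulr1.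
  have Bpos : 0 < \sum_x beta x.
    rewrite lt_def -BE B0 andbT; apply/eqP => Bz.
    move: Gamtop; rewrite -BE Bz mulr0 -QE.
    by have := Qc (fun=> 1); rewrite Bz mulr0; lra.
  by rewrite BE QE ltr_pdivlMr.
have WA : W < A by apply: lt_le_trans one (hde _).
have A0 : 0 < A by lra.
have An0 := lt0r_neq0 A0.
have FdeE : Q de / B de = A - eta by rewrite /A addrK.
have Bde : 0 < B de.
  rewrite lt_def B0 andbT; apply/eqP => Bz.
  by move: FdeE; rewrite Bz invr0 mulr0; lra.
have QA v : Q v <= A * B v.
  have [Bz|Bn0] := eqVneq (B v) 0; first by have := Qc v; rewrite Bz !mulr0.
  by rewrite -ler_pdivrMr ?hde // lt_def Bn0 B0.
pose r := Num.sqrt (B de).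
have r2 : r ^+ 2 = B de by rewrite sqr_sqrtr // ltW.
have r0 : 0 < r by rewrite sqrtr_gt0.
have rn0 := lt0r_neq0 r0.
(* The normalised near-eigenvector. Weighting the kernel by [d] turns its value there, $2 -
   (A-\eta)/A$, into the sum of all entries of [M]. *)
pose d x := de x / r.
have Bd : B d = 1.
  rewrite /B /d; under eq_bigr => x _ do rewrite expr_div_n mulrA.
  by rewrite -mulr_suml r2 divff // lt0r_neq0.
have Qd : Q d = A - eta.
  rewrite -FdeE -r2 /Q /qform mulr_suml; apply: eq_bigr => x _.
  by rewrite mulr_suml; apply: eq_bigr => y _; rewrite /d; field.
pose M0 x y := 2 * ((x == y)%:R * beta x) - Gam x y / A.
have diag_sum (h v : D -> R) x : \sum_y (x == y)%:R * h x * v x * v y = h x * v x ^+ 2.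
  rewrite (bigD1 x) //= big1 ?addr0 => [|y yx]; last by rewrite eq_sym (negbTE yx) !mul0r.
  by rewrite eqxx mul1r; ring.
have QM0 v : qform M0 v = 2 * B v - Q v / A.
  rewrite /qform /B /Q /qform mulr_sumr mulr_suml -sumrB; apply: eq_bigr => x _.
  rewrite -diag_sum mulr_sumr mulr_suml -sumrB; apply: eq_bigr => y _.
  by rewrite /M0; ring.
have QAd v : Q v / A <= B v by rewrite ler_pdivrMr // mulrC.
have M0C x y : M0 x y = M0 y x.
  by rewrite /M0 eq_sym GamC; case: eqP => [->|_] //; rewrite !mul0r.
have gM0 : gram M0.
  by apply: psd_gram; split=> // v; rewrite QM0; have := QAd v; have := B0 v; lra.
have rank_d F : gram F -> gram (fun x y => d x * d y * F x y).
  by move=> gF; apply: gramM gF; exact: gram_rank1.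
exists A, (fun x y => d x * d y * M0 x y), (fun x => beta x * d x ^+ 2); split.
- split; [exact: ltW|exact: rank_d| |exact: Bd].
  by move=> x; rewrite mulr_ge0 ?sqr_ge0 // ltW.
- have -> : \sum_x \sum_y d x * d y * M0 x y = qform M0 d.
    by apply: eq_bigr => x _; apply: eq_bigr => y _; ring.
  rewrite QM0 Bd Qd mulrBl divff // mulr1.
  have : eta / A <= eta by rewrite ler_piMr ?(ltW eta0) // invf_le1 //; lra.
  by lra.
(* Here the coefficient 2 in the kernel is used: one [B] dominates [Gam / A], the other dominates
   the part of [Gam] on pairs that differ at [i]. *)
- move=> i; pose K x y := 2 / A * (M0 x y - (bit x i != bit y i)%:R * Gam x y).
  have gK : gram K.
    apply: psd_gram; split=> [x y|v]; first by rewrite /K M0C GamC eq_sym.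
    have -> : qform K v = 2 / A * (2 * B v - Q v / A -
       \sum_x \sum_y (bit x i != bit y i)%:R * (Gam x y * v x * v y)).
      rewrite -QM0 /qform -sumrB mulr_sumr; apply: eq_bigr => x _.
      rewrite -sumrB mulr_sumr; apply: eq_bigr => y _.
      by rewrite /K; ring.
    apply: mulr_ge0; first by rewrite divr_ge0 // ltW.
    by have := QAd v; have := Gami i v; rewrite -/(B v); lra.
  apply: (eq_gram _ (rank_d _ gK)) => x y; rewrite /K /differ_sign.
  have [e|ne] := eqVneq (bit x i) (bit y i); first by rewrite /= mul0r; ring.
  have -> : M0 x y = - Gam x y / A.
    by rewrite /M0; have [xy|_] := eqVneq x y; [rewrite xy eqxx in ne|rewrite /= mul0r; ring].
  by rewrite /=; field.
- move=> v; pose K x y := 2 / 3 * M0 x y - (x == y)%:R * ((g x == v)%:R * beta x).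
  have gK : gram K.
    apply: psd_gram; split=> [x y|w].
      by rewrite /K M0C eq_sym; case: eqP => [->|_] //; rewrite !mul0r.
    (* [Gam] only pairs different values, so doubling [w] on one side doubles the form of [Gam].
       Applying [Gam <= A B] to [w'] gives the sharper bound $Q/A \le 2B - \frac32 B_v$, whose main
       term matches the kernel. *)
    pose w' x := if g x == v then w x else 2 * w x.
    pose Bv := \sum_x ((g x == v)%:R * beta x) * w x ^+ 2.
    have -> : qform K w = 2 / 3 * (2 * B w - Q w / A) - Bv.
      rewrite -QM0 /Bv /qform mulr_sumr -sumrB; apply: eq_bigr => x _.
      rewrite -(diag_sum (fun x => (g x == v)%:R * beta x) w x) mulr_sumr -sumrB; apply: eq_bigr => y _.
      by rewrite /K; ring.
    have Qw' : Q w' = 2 * Q w.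
      rewrite /Q /qform mulr_sumr; apply: eq_bigr => x _.
      rewrite mulr_sumr; apply: eq_bigr => y _; rewrite /w'.
      have [e|ne] := eqVneq (g x) (g y); first by rewrite Gam0 // !mul0r mulr0.
      by move: ne; case: (g x); case: (g y); case: v {K Bv w'} => //= _; ring.
    have Bw' : B w' = 4 * B w - 3 * Bv.
      rewrite /B /Bv !mulr_sumr -sumrB; apply: eq_bigr => x _; rewrite /w'.
      by case: (g x == v); rewrite /= ?mulr1n ?mulr0n; ring.
    by have := QAd w'; rewrite Qw' Bw' -mulrA; lra.
  apply: (eq_gram _ (rank_d _ gK)) => x y; rewrite /K.
  have [->|_] := eqVneq x y; first by ring.
  by rewrite !mul0r; ring.
Qed.
End Kernel.

(** * Progress of a query algorithm *)

Lemma sum_conj_pair (I : finType) (g a : I -> CC) : (forall x, (g x)^* = g x) ->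
  \sum_x \sum_y g x * g y * ((a x)^* * a y) = `|\sum_x g x * a x| ^+ 2.
Proof.
move=> gr; rewrite normCKC rmorph_sum big_distrlr /=; apply: eq_bigr => x _.
by apply: eq_bigr => y _; rewrite rmorphM /= gr; ring.
Qed.

Lemma gram_form_ge0 (T : finType) (K : T -> T -> RR) (a : T -> CC) : gram K ->
  0 <= \sum_x \sum_y rc (K x y) * ((a x)^* * a y).
Proof.
move=> [J [h hE]].
have -> : \sum_x \sum_y rc (K x y) * ((a x)^* * a y) =
   \sum_k \sum_x \sum_y rc (h k x) * rc (h k y) * ((a x)^* * a y).
  rewrite [RHS]exchange_big; apply: eq_bigr => x _ /=; rewrite [RHS]exchange_big; apply: eq_bigr => y _ /=.
  by rewrite hE rmorph_sum mulr_suml; apply: eq_bigr => k _; rewrite rmorphM.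
apply: sumr_ge0 => k _; rewrite sum_conj_pair => [|x]; last exact: rc_conj.
exact: exprn_ge0.
Qed.

(** The potential of the multiplicative adversary method. It depends on the states only through
    their inner products, so input-independent unitaries preserve it. *)
Definition progress (T S : finType) (K : T -> T -> RR) (phi : T -> vec S) : CC :=
  \sum_x \sum_y rc (K x y) * dot (phi x) (phi y).

Lemma progressE (T S : finType) (K : T -> T -> RR) (phi : T -> vec S) :
  progress K phi = \sum_s \sum_x \sum_y rc (K x y) * ((phi x s)^* * phi y s).
Proof.
rewrite /progress exchange_big; under [RHS]eq_bigr => s _ do rewrite exchange_big.
rewrite [RHS]exchange_big; apply: eq_bigr => y _ /=; rewrite [RHS]exchange_big.
by apply: eq_bigr => x _; rewrite mulr_sumr.
Qed.

Lemma progress_unitary (T S : finType) (K : T -> T -> RR) (U : op S) (phi : T -> vec S) :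
  unitary U -> progress K (fun x => apply_op U (phi x)) = progress K phi.
Proof. by move=> uU; do 2!(apply: eq_bigr => ? _); rewrite dot_unitary. Qed.

(* In the Fourier basis of the answer qubit a query only multiplies the [-] component
   by the sign of the queried bit. *)
Lemma progress_query (T W : finType) (N : nat) (z : T -> bits N) (K : T -> T -> RR)
    (e : RR) (phi : T -> vec (qstate N W)) :
  0 <= e -> gram K ->
  (forall i, gram (fun x y => (1 + e) * K x y -
     (if xbit (z x) i != xbit (z y) i then -1 else 1) * K x y)) ->
  progress K (fun x => apply_op (query (z x)) (phi x)) <= (1 + rc e) * progress K phi.
Proof.
move=> e0 gK gKi; rewrite -subr_ge0 !progressE.
pose pl i w x := phi x ((i, false), w) + phi x ((i, true), w).
pose mi i w x := phi x ((i, false), w) - phi x ((i, true), w).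
pose Ki i x y := (1 + e) * K x y - (if xbit (z x) i != xbit (z y) i then -1 else 1) * K x y.
suff -> : (1 + rc e) * (\sum_s \sum_x \sum_y rc (K x y) * ((phi x s)^* * phi y s)) -
   \sum_s \sum_x \sum_y rc (K x y) * ((apply_op (query (z x)) (phi x) s)^*
     * apply_op (query (z y)) (phi y) s) =
   \sum_i \sum_w (1 / 2 * (rc e * \sum_x \sum_y rc (K x y) * ((pl i w x)^* * pl i w y)
     + \sum_x \sum_y rc (Ki i x y) * ((mi i w x)^* * mi i w y))).
  apply: sumr_ge0 => i _; apply: sumr_ge0 => w _.
  apply: mulr_ge0; first by rewrite divr_ge0 ?ler01 ?ler0n.
  apply: addr_ge0; last exact: (gram_form_ge0 _ (gKi i)).
  apply: mulr_ge0; last exact: (gram_form_ge0 _ gK).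
  by rewrite -(rmorph0 rc) rc_le.
have split_sum (F : qstate N W -> CC) :
    \sum_s F s = \sum_i \sum_w (F ((i, false), w) + F ((i, true), w)).
  have -> : \sum_s F s = \sum_i \sum_b \sum_w F ((i, b), w).
    by rewrite pair_big pair_big /=; apply: eq_bigr => -[[i b] w].
  by apply: eq_bigr => i _; rewrite big_bool -big_split /=; apply: eq_bigr => w _; rewrite addrC.
rewrite !split_sum mulr_sumr -sumrB; apply: eq_bigr => i _.
rewrite mulr_sumr -sumrB; apply: eq_bigr => w _.
rewrite -!big_split mulrDr /= !mulr_sumr -!big_split -sumrB /=; apply: eq_bigr => x _.
rewrite !mulr_sumr -!big_split !mulr_sumr -sumrB /=; apply: eq_bigr => y _.
rewrite !apply_query /= /flip_query /= /pl /mi /Ki.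
rewrite !(rmorphB, rmorphD, rmorphM) rmorph1 /=.
by case: (xbit (z x) i); case: (xbit (z y) i); rewrite /= ?rmorphN ?rmorph1 /=; field.
Qed.

(** * Distinguishing states needs query weight on the differing bit *)

Lemma sum_qspace n dk dj (F : qspace n dk dj -> CC) :
  \sum_s F s = \sum_i \sum_b \sum_j \sum_k F ((i, b), (k, j)).
Proof.
transitivity (\sum_p \sum_q F (p, q)); first by rewrite pair_bigA; apply: eq_bigr => -[].
transitivity (\sum_i \sum_b \sum_q F ((i, b), q)); first by rewrite [RHS]pair_bigA; apply: eq_bigr => -[].
do 2!(apply: eq_bigr => ? _); rewrite [RHS]exchange_big pair_bigA /=.
by apply: eq_bigr => -[].
Qed.

Definition adj_kept n dk dj (U : op 'I_dk.+1) (v : vec (qspace n dk dj)) : vec (qspace n dk dj) :=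
  fun s => adj_apply U (fun k => v (s.1, (k, s.2.2))) s.2.1.

Lemma adj_kept_contracts n dk dj (U : op 'I_dk.+1) (v : vec (qspace n dk dj)) : unitary U ->
  vnorm (adj_kept U v) <= vnorm v.
Proof.
move=> uU; rewrite ler_sqrtC ?qualifE /= ?dot_ge0 //.
rewrite /dot !sum_qspace; apply: ler_sum => i _; apply: ler_sum => b _; apply: ler_sum => j _.
exact: (adj_apply_contracts (fun k => v ((i, b), (k, j))) uU).
Qed.

(** In the singular bases, the trace norm is the difference of two inner products built from [v] and
    from [w]. Telescoping through [v - w] bounds it by twice the norm of [v - w], and the factor 1/2
    in the trace distance cancels the 2. *)
Lemma trace_dist_le n dk dj (v w : vec (qspace n dk dj)) d :
  vnorm v = 1 -> vnorm w = 1 -> trace_dist_is (reduced v) (reduced w) d ->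
  d <= vnorm (vadd v (vscale (-1) w)).
Proof.
move=> v1 w1 [t [[U [V [s [uU uV s0 AE tE]]]] ->]].
set del := vadd v (vscale (-1) w).
have sE c : s c = \sum_a \sum_b (U a c)^* * (reduced v a b - reduced w a b) * V b c.
  transitivity (\sum_c' s c' * (\sum_a (U a c)^* * U a c') * (\sum_b (V b c')^* * V b c)).
    rewrite (bigD1 c) //= [X in _ + X]big1 ?addr0 => [|c' cc]; first by rewrite uU uV eqxx !mulr1.
    by rewrite uU eq_sym (negbTE cc) mulr0 mul0r.
  under eq_bigr => c' _ do rewrite -mulrA big_distrlr /= mulr_sumr.
  rewrite exchange_big; apply: eq_bigr => a _.
  under eq_bigr => c' _ do rewrite mulr_sumr.
  rewrite exchange_big; apply: eq_bigr => b _; rewrite AE mulr_sumr mulr_suml.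
  by apply: eq_bigr => c' _; ring.
have red (u : vec (qspace n dk dj)) : \sum_c \sum_a \sum_b (U a c)^* * reduced u a b * V b c =
   dot (adj_kept V u) (adj_kept U u).
  rewrite /dot sum_qspace.
  transitivity (\sum_c \sum_i \sum_b \sum_j (adj_kept V u ((i, b), (c, j)))^* * adj_kept U u ((i, b), (c, j))).
    apply: eq_bigr => c _.
    transitivity (\sum_i \sum_b \sum_j \sum_a \sum_a' (U a c)^* * (u ((i, b), (a, j)) * (u ((i, b), (a', j)))^*) * V a' c).
      rewrite /reduced; under eq_bigr => a _ do under eq_bigr => a' _ do
        rewrite mulr_sumr mulr_suml.
      under eq_bigr => a _ do rewrite exchange_big.
      rewrite exchange_big; apply: eq_bigr => i _.
      under eq_bigr => a _ do under eq_bigr => a' _ do rewrite mulr_sumr mulr_suml.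
      under eq_bigr => a _ do rewrite exchange_big.
      rewrite exchange_big; apply: eq_bigr => b _.
      under eq_bigr => a _ do under eq_bigr => a' _ do rewrite mulr_sumr mulr_suml.
      under eq_bigr => a _ do rewrite exchange_big.
      by rewrite exchange_big.
    do 3!(apply: eq_bigr => ? _); rewrite /adj_kept /adj_apply /= rmorph_sum mulrC big_distrlr /=.
    by do 2!(apply: eq_bigr => ? _); rewrite rmorphM /= conjCK; ring.
  rewrite exchange_big; apply: eq_bigr => i _; rewrite exchange_big; apply: eq_bigr => b _.
  by rewrite exchange_big.
have tE2 : t = dot (adj_kept V del) (adj_kept U v) + dot (adj_kept V w) (adj_kept U del).
  have lin (Z : op 'I_dk.+1) : adj_kept Z del = vadd (adj_kept Z v) (vscale (-1) (adj_kept Z w)).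
    apply/funext => z; rewrite /adj_kept /adj_apply /vadd /vscale mulr_sumr -big_split.
    by apply: eq_bigr => a _; rewrite /del /vadd /vscale /=; ring.
  rewrite !lin dotDl dotDr dotZl dotZr rmorphN rmorph1 tE.
  under eq_bigr => c _.
    rewrite sE; under eq_bigr => a _ do under eq_bigr => b _ do rewrite mulrBr mulrBl.
    under eq_bigr => a _ do rewrite sumrB.
    rewrite sumrB; over.
  by rewrite sumrB !red; ring.
have t0 : 0 <= t by rewrite tE sumr_ge0.
rewrite ler_pdivrMr ?ltr0n // -(ger0_norm t0) tE2 mulrC mulr2n mulrDl mul1r.
apply: le_trans (ler_normD _ _) _; apply: lerD; apply: le_trans (Cauchy_Schwarz_norm _ _) _.
  by rewrite -[leRHS]mulr1 -v1 ler_pM ?vnorm_ge0 ?adj_kept_contracts.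
by rewrite -[leRHS]mul1r -w1 ler_pM ?vnorm_ge0 ?adj_kept_contracts.
Qed.

Definition query_weight n (W : finType) (v : vec (qstate n W)) (i : 'I_n.+1) : CC :=
  \sum_b \sum_w `|v ((i, b), w)| ^+ 2.

Definition query_part n (W : finType) (i : 'I_n.+1) (v : vec (qstate n W)) : vec (qstate n W) :=
  fun s => if s.1.1 == i then v s else 0.

Lemma vnorm_query_part n (W : finType) (i : 'I_n.+1) (v : vec (qstate n W)) :
  vnorm (query_part i v) ^+ 2 = query_weight v i.
Proof.
rewrite vnorm_sq dot_normsq.
have -> : \sum_s `|query_part i v s| ^+ 2 = \sum_j \sum_b \sum_w `|query_part i v ((j, b), w)| ^+ 2.
  by rewrite pair_big pair_big /=; apply: eq_bigr => -[[j b] w].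
rewrite (bigD1 i) //= [X in _ + X]big1 ?addr0 => [|j ji].
  by do 2!(apply: eq_bigr => ? _); rewrite /query_part /= eqxx.
by do 2!(apply: big1 => ? _); rewrite /query_part /= (negbTE ji) normr0 expr0n.
Qed.

Lemma vnormZ (T : finType) a (v : vec T) : vnorm (vscale a v) = `|a| * vnorm v.
Proof.
rewrite /vnorm dotZl dotZr mulrA -normCKC rootCMl ?exprn_ge0 //.
by rewrite -/(sqrtC _) sqrCK.
Qed.

(** The two oracles act differently only on the part of the state that queries [i]. Each step adds
    that part once for each oracle, whence the factor 2; all weights are measured in the run on
    [x]. *)
Lemma hybrid n dk dj (U : nat -> op (qspace n dk dj)) (x y : bits n) (i : 'I_n) T :
  (forall t, (t <= T)%N -> unitary (U t)) -> (forall j, j != i -> x j = y j) ->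
  vnorm (vadd (qrun U x T) (vscale (-1) (qrun U y T))) <=
  \sum_(t < T) 2 * vnorm (query_part (lift ord_max i) (qrun U x t)).
Proof.
move=> + xy; elim: T => [|T IH] uU.
  rewrite big_ord0 (_ : vadd _ _ = fun=> 0).
    by rewrite /vnorm dot_0l // sqrtC0.
  by apply/funext => s; rewrite /vadd /vscale /= mulN1r subrr.
rewrite big_ord_recr /=.
set u := qrun U x T; set w := qrun U y T; set k := lift ord_max i.
have -> : vadd (apply_op (U T.+1) (apply_op (oracle x) u))
    (vscale (-1) (apply_op (U T.+1) (apply_op (oracle y) w))) =
  apply_op (U T.+1) (vadd (apply_op (query y) (vadd u (vscale (-1) w)))
    (vadd (apply_op (query x) (query_part k u)) (vscale (-1) (apply_op (query y) (query_part k u))))).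
  rewrite -[oracle x]/(query x) -[oracle y]/(query y) -!(apply_opZ, apply_opD); congr apply_op.
  apply/funext => s; rewrite apply_opD !apply_opZ !apply_query /vadd /vscale /= /query_part /=.
  have [e|ne] := eqVneq s.1.1 k; first by ring.
  suff -> : flip_query x s = flip_query y s by ring.
  rewrite /flip_query /xbit; case: unliftP => // j sj; congr (_, _ (+) _, _).
  by apply: xy; apply: contraNneq ne => ji; rewrite sj ji.
rewrite vnorm_unitary; last exact: uU.
apply: le_trans (vnormD _ _) _; apply: lerD.
  by rewrite (vnorm_unitary _ (unitary_query _)); apply: IH => t tT; apply: uU; exact: leqW.
apply: le_trans (vnormD _ _) _.
by rewrite vnormZ normrN1 mul1r !(vnorm_unitary _ (unitary_query _)) mulr2n mulrDl !mul1r.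
Qed.

Lemma qrun_norm n dk dj (U : nat -> op (qspace n dk dj)) (x : bits n) T :
  (forall t, (t <= T)%N -> unitary (U t)) -> vnorm (qrun U x T) = 1.
Proof.
elim: T => [|T IH] uU /=.
  by rewrite vnorm_unitary; [rewrite /vnorm dot_ketl /ket eqxx sqrtC1|exact: uU].
rewrite vnorm_unitary; last exact: uU.
rewrite (_ : apply_op _ _ = apply_op (query x) (qrun U x T)) // (vnorm_unitary _ (unitary_query _)).
by apply: IH => t tT; apply: uU; exact: leqW.
Qed.

(** The hybrid bound gives 1/12 for the sum of the norms, and Cauchy-Schwarz over the [T] queries
    turns this into squared norms: $144 = 12^2$. *)
Lemma distinguishing_weight n dk dj (U : nat -> op (qspace n dk dj)) (x y : bits n) (i : 'I_n) T d :
  (forall t, (t <= T)%N -> unitary (U t)) -> (forall j, j != i -> x j = y j) ->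
  trace_dist_is (reduced (qrun U x T)) (reduced (qrun U y T)) d -> 1 / 6 <= d ->
  1 / 144 <= T%:R * \sum_(t < T) query_weight (qrun U x t) (lift ord_max i).
Proof.
move=> uU xy hd d6; pose w t := vnorm (query_part (lift ord_max i) (qrun U x t)).
have h1 : 1 / 12 <= \sum_(t < T) w t.
  have := le_trans (trace_dist_le (qrun_norm x uU) (qrun_norm y uU) hd) (hybrid uU xy).
  move=> /(le_trans d6); rewrite -mulr_sumr -ler_pdivrMl ?ltr0n //.
  by congr (_ <= _); field.
have s0 : 0 <= \sum_(t < T) w t by rewrite sumr_ge0 // => t _; exact: vnorm_ge0.
have := Cauchy_Schwarz (fun _ : 'I_T => 1 : CC) (fun t : 'I_T => w t).
have -> : dot (fun _ : 'I_T => 1 : CC) (fun t : 'I_T => w t) = \sum_(t < T) w t.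
  by apply: eq_bigr => t _; rewrite rmorph1 mul1r.
have -> : dot (fun _ : 'I_T => 1 : CC) (fun _ : 'I_T => 1 : CC) = T%:R.
  by rewrite /dot; under eq_bigr => t _ do rewrite rmorph1 mul1r; rewrite sumr_const card_ord.
have -> : dot (fun t : 'I_T => w t) (fun t : 'I_T => w t) =
   \sum_(t < T) query_weight (qrun U x t) (lift ord_max i).
  apply: eq_bigr => t _; rewrite -vnorm_query_part -/(w t) geC0_conj ?expr2 //; exact: vnorm_ge0.
rewrite ger0_norm //; apply: le_trans.
have -> : 1 / 144 = (1 / 12) ^+ 2 :> CC by field.
by rewrite ler_pXn2r ?nnegrE ?divr_ge0 ?ler01 ?ler0n.
Qed.

(** * The lookup function *)

Section Lookup.
Variables (n m : nat) (f : pfun n).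

Definition lookup_index : finType := (('I_m * 'I_n) + {ffun 'I_m -> bool})%type.
Definition lookup_size := #|lookup_index|.

Definition lookup_block (T : Type) (z : {ffun 'I_lookup_size -> T}) (j : 'I_m) : {ffun 'I_n -> T} :=
  [ffun i => z (enum_rank (inl (j, i) : lookup_index))].

Definition lookup_cell (T : Type) (z : {ffun 'I_lookup_size -> T}) (l : {ffun 'I_m -> bool}) : T :=
  z (enum_rank (inr l : lookup_index)).

Definition lookup_address (z : bits lookup_size) : option {ffun 'I_m -> bool} :=
  if [forall j, isSome (f (lookup_block z j))]
  then Some [ffun j => odflt false (f (lookup_block z j))] else None.

Definition lookup : pfun lookup_size := fun z => omap (lookup_cell z) (lookup_address z).

Let D := dom f.
Let X : finType := {ffun 'I_m -> D}.

Definition address (x : X) : {ffun 'I_m -> bool} := [ffun j => dom_val (x j)].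

Definition lookup_input (x : X) (Y : {ffun 'I_m -> bool} -> bool) : bits lookup_size :=
  [ffun k => match enum_val k : lookup_index with inl ji => val (x ji.1) ji.2 | inr l => Y l end].

Lemma lookup_block_input x Y j : lookup_block (lookup_input x Y) j = val (x j).
Proof. by apply/ffunP => i; rewrite !ffunE enum_rankK. Qed.

Lemma lookup_inputE x Y : lookup (lookup_input x Y) = Some (Y (address x)).
Proof.
rewrite /lookup /lookup_address.
have -> : [forall j, isSome (f (lookup_block (lookup_input x Y) j))].
  by apply/forallP => j; rewrite lookup_block_input; exact: (valP (x j)).
rewrite /= /lookup_cell ffunE enum_rankK; congr (Some (Y _)).
apply/ffunP => j; rewrite !ffunE lookup_block_input /dom_val.
by have := valP (x j); case: (f _) => [[]|].
Qed.

Definition cell_index (l : {ffun 'I_m -> bool}) : 'I_lookup_size.+1 :=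
  lift ord_max (enum_rank (inr l : lookup_index)).

Section Weight.
Variables (M : D -> D -> RR) (b : D -> RR).
Hypotheses (b_ge0 : forall x, 0 <= b x) (gM : gram M)
  (gMb : forall v, gram (fun x y => 2 / 3 * M x y - (x == y)%:R * ((dom_val x == v)%:R * b x))).

Definition prod_kernel (x y : X) : RR := \prod_j M (x j) (y j).

Lemma gram_prod_kernel : gram prod_kernel.
Proof. by apply: gram_prod => j; apply: (gram_comp (fun x : X => x j)). Qed.

(** On each coordinate the diagonal kernel of [b] restricted to the value [l j] lies below [2/3 M].
    By [gram_prodB] the product over the coordinates lies below $(2/3)^m$ times the product
    kernel. *)
Lemma address_weight (a : X -> CC) (l : {ffun 'I_m -> bool}) :
  \sum_x (address x == l)%:R * rc (\prod_j b (x j)) * `|a x| ^+ 2 <=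
  rc ((2 / 3) ^+ m) * \sum_x \sum_y rc (prod_kernel x y) * ((a x)^* * a y).
Proof.
pose P (j : 'I_m) (x y : X) := (x j == y j)%:R * ((dom_val (x j) == l j)%:R * b (x j)) : RR.
pose N (j : 'I_m) (x y : X) := 2 / 3 * M (x j) (y j) : RR.
have gP j : gram (P j).
  apply: (gram_comp (fun x : X => x j) (A := fun x y => (x == y)%:R * ((dom_val x == l j)%:R * b x))).
  by apply: gram_diag => x; rewrite mulr_ge0.
have gNP j : gram (fun x y => N j x y - P j x y).
  exact: (gram_comp (fun x : X => x j) (gMb (l j))).
have ge0 := gram_form_ge0 a (gram_prodB (index_enum 'I_m) gP gNP).
rewrite -subr_ge0; move: ge0.
have PE x y : \prod_j P j x y = (x == y)%:R * ((address x == l)%:R * \prod_j b (x j)).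
  have [<-|xy] := eqVneq x y; last first.
    have [j hj] : exists j, x j != y j.
      apply/existsP; apply: contraNT xy; rewrite negb_exists => /forallP h.
      by apply/eqP/ffunP => j; apply/eqP; rewrite -[_ == _]negbK; exact: h.
    by rewrite (bigD1 j) //= /P (negbTE hj) !mul0r.
  rewrite mul1r; have [xl|xl] := eqVneq (address x) l.
    rewrite mul1r; apply: eq_bigr => j _; rewrite /P eqxx mul1r -xl ffunE eqxx mul1r.
    by [].
  have [j hj] : exists j, dom_val (x j) != l j.
    apply/existsP; apply: contraNT xl; rewrite negb_exists => /forallP h.
    by apply/eqP/ffunP => j; apply/eqP; rewrite ffunE -[_ == _]negbK; exact: h.
  by rewrite (bigD1 j) //= /P (negbTE hj) !mul0r mulr0 mul0r.
have NE x y : \prod_j N j x y = (2 / 3) ^+ m * prod_kernel x y.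
  by rewrite /N big_split /= prodr_const card_ord.
have -> : \sum_x \sum_y rc (\prod_j N j x y - \prod_j P j x y) * ((a x)^* * a y) =
  rc ((2 / 3) ^+ m) * (\sum_x \sum_y rc (prod_kernel x y) * ((a x)^* * a y)) -
  \sum_x (address x == l)%:R * rc (\prod_j b (x j)) * `|a x| ^+ 2.
  rewrite mulr_sumr -sumrB; apply: eq_bigr => x _.
  transitivity (\sum_y (rc ((2 / 3) ^+ m) * (rc (prod_kernel x y) * ((a x)^* * a y)) -
     (x == y)%:R * ((address x == l)%:R * rc (\prod_j b (x j)) * ((a x)^* * a y)))).
    apply: eq_bigr => y _; rewrite NE PE rmorphB !rmorphM !rmorph_nat /=; ring.
  rewrite sumrB -mulr_sumr; congr (_ - _).
  rewrite (bigD1 x) //= [X in _ + X]big1 ?addr0 => [|y yx]; first by rewrite eqxx mul1r normCKC.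
  by rewrite eq_sym (negbTE yx) mul0r.
by [].
Qed.

(** The query register is read as a guess of the address. Distinct addresses name distinct cells, so
    summing [address_weight] over the addresses uses every basis state at most once. *)
Lemma cell_weight (W : finType) (phi : X -> vec (qstate lookup_size W)) :
  \sum_(x : X) rc (\prod_j b (x j)) * query_weight (phi x) (cell_index (address x)) <=
  rc ((2 / 3) ^+ m) * progress prod_kernel phi.
Proof.
pose frm s := \sum_x \sum_y rc (prod_kernel x y) * ((phi x s)^* * phi y s).
have frm0 s : 0 <= frm s by exact: gram_form_ge0 gram_prod_kernel.
pose G i := \sum_b' \sum_w frm ((i, b'), w).
have G0 i : 0 <= G i by rewrite sumr_ge0 // => b' _; rewrite sumr_ge0.
have -> : progress prod_kernel phi = \sum_i G i.
  by rewrite progressE [RHS]pair_big [RHS]pair_big /=; apply: eq_bigr => -[[i b'] w].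
have le1 : \sum_l G (cell_index l) <= \sum_i G i.
  rewrite [leRHS](bigD1_ord ord_max) //= -[leLHS]add0r lerD //.
  rewrite [leRHS](reindex (@enum_rank lookup_index)); last first.
    by apply: onW_bij; exact: enum_rank_bij.
  by rewrite big_sumType /= -[leLHS]add0r lerD // sumr_ge0.
have c0 : 0 <= rc ((2 / 3) ^+ m).
  by rewrite -(rmorph0 rc) rc_le exprn_ge0 // divr_ge0.
apply: le_trans (ler_wpM2l c0 le1); rewrite mulr_sumr.
apply: le_trans (_ : \sum_l \sum_b' \sum_w \sum_x (address x == l)%:R * rc (\prod_j b (x j))
    * `|phi x ((cell_index l, b'), w)| ^+ 2 <= _); last first.
  apply: ler_sum => l _; rewrite mulr_sumr; apply: ler_sum => b' _.
  rewrite mulr_sumr; apply: ler_sum => w _.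
  exact: address_weight.
rewrite le_eqVlt; apply/orP; left; apply/eqP.
under [RHS]eq_bigr => l _ do under eq_bigr => b' _ do rewrite exchange_big.
under [RHS]eq_bigr => l _ do rewrite exchange_big.
rewrite [RHS]exchange_big; apply: eq_bigr => x _ /=.
rewrite (bigD1 (address x)) //= [X in _ + X]big1 ?addr0 => [|l lx].
  rewrite /query_weight mulr_sumr; apply: eq_bigr => b' _.
  by rewrite mulr_sumr; apply: eq_bigr => w _; rewrite eqxx mul1r.
by do 2!(apply: big1 => ? _); rewrite eq_sym (negbTE lx) !mul0r.
Qed.

End Weight.

(** By induction, $(1+e)^t(1-te) \le 1$, where the second factor is at least 1/2. *)
Lemma pow1_bound (F : realFieldType) (e : F) t : 0 <= e -> t%:R * e <= 1 / 2 -> (1 + e) ^+ t <= 2.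
Proof.
move=> e0 te; have : (1 + e) ^+ t * (1 - t%:R * e) <= 1.
  elim: t te => [|t IH] te; first by rewrite expr0 mul0r subr0 mulr1.
  have te' : t%:R * e <= 1 / 2 by apply: le_trans te; rewrite ler_wpM2r // ler_nat.
  apply: le_trans (IH te'); rewrite exprSr -mulrA ler_wpM2l ?exprn_ge0 ?addr_ge0 //.
  have : 0 <= t%:R * e ^+ 2 by rewrite mulr_ge0 ?exprn_ge0.
  by rewrite -[t.+1]addn1 natrD expr2; have := sqr_ge0 e; rewrite expr2; lra.
have p0 : 0 <= (1 + e) ^+ t by rewrite exprn_ge0 ?addr_ge0.
have : (1 + e) ^+ t * (1 / 2) <= (1 + e) ^+ t * (1 - t%:R * e) by rewrite ler_wpM2l //; lra.
by lra.
Qed.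

Theorem lookup_lower (W : RR) (L T : nat) :
  (0 < m)%N -> (0 < L)%N -> 1 <= W -> 18 * (W + 1) <= L%:R -> ~ Q_computes f (2 * L) ->
  4 * T%:R <= W -> (576 * T ^ 2 * 2 ^ m < 3 ^ m)%N -> ~ QS_distinguishes lookup T.
Proof.
move=> m0 L0 W1 WL hQ TW Tm [dk [dj [U [uU dist]]]].
have infeas : ~ adv_feasible (@dom_val n f) (@dom_bit n f) (W + 1).
  by move=> [K [u [u_sum u_cost]]]; apply: hQ; exact: (query_algorithm u_sum u_cost).
have sep (x y : D) : dom_val x != dom_val y -> exists i, dom_bit x i != dom_bit y i.
  move=> gxy; apply/existsP; apply: contraNT gxy; rewrite negb_exists => /forallP h.
  rewrite (_ : x = y) //; apply: val_inj; apply/ffunP => i; apply/eqP.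
  by rewrite -[_ == _]negbK; exact: h.
have [Gam [beta wit]] := adv_duality sep (le_trans ler01 W1) infeas.
have m0' : 0 < m%:R :> RR by rewrite ltr0n.
(* With this choice the initial progress, at most $(1+\eta)^m$, is at most 2. *)
pose eta : RR := 1 / (2 * m%:R).
have eta0 : 0 < eta by rewrite divr_gt0 ?mulr_gt0.
have eta1 : eta < 1.
  rewrite ltr_pdivrMr ?mulr_gt0 // mul1r; have : 1 <= m%:R :> RR by rewrite ler1n.
  by lra.
have eta01 : 0 < eta < 1 by rewrite eta0 eta1.
have [A [M [b [[WA gM b0 b1] sumM gMi gMb]]]] := adv_kernel wit W1 eta01.
have A0 : 0 < A by lra.
pose K := prod_kernel M.
have gK : gram K := gram_prod_kernel gM.
have e0 : 0 <= 2 / A by rewrite divr_ge0 // ltW.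
(* All cells are empty on these inputs, so querying a cell yields no progress; a query into block
   [j] affects only the factor [j] of the kernel. *)
pose z (x : X) := lookup_input x (fun=> false).
pose phi t x := qrun U (z x) t.
have gKi (i : 'I_lookup_size.+1) : gram (fun x y => (1 + 2 / A) * K x y -
     (if xbit (z x) i != xbit (z y) i then -1 else 1) * K x y).
  have same : (forall x y, xbit (z x) i = xbit (z y) i) -> gram (fun x y => (1 + 2 / A) * K x y -
     (if xbit (z x) i != xbit (z y) i then -1 else 1) * K x y).
    move=> h; apply: (eq_gram _ (gramM (gram_const _ e0) gK)) => x y.
    by rewrite (h x y) eqxx /=; ring.
  case: (unliftP ord_max i) => [k ik|im]; last by apply: same => x y; rewrite im /xbit unlift_none.
  case ek : (enum_val k : lookup_index) => [[j i']|l]; last first.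
    by apply: same => x y; rewrite ik /xbit liftK !ffunE ek.
  have zE x : xbit (z x) i = dom_bit (x j) i' by rewrite ik /xbit liftK ffunE ek.
  have gprod : gram (fun x y : X => \prod_(j' | j' != j) M (x j') (y j')).
    apply: (eq_gram _ (gram_prod (A := fun j' (x y : X) => M (x j') (y j'))
      [seq j' <- index_enum 'I_m | j' != j] (fun j' => gram_comp (fun x : X => x j') gM))).
    by move=> x y; rewrite big_filter.
  apply: (eq_gram _ (gramM (gram_comp (fun x : X => x j) (gMi i')) gprod)) => x y.
  rewrite !zE /K /prod_kernel /differ_sign [in RHS](bigD1 j) //=. set s := (if _ then _ else _). set p := \big[_/_]_(_ | _) _. by ring.
have prog t : (t <= T)%N -> progress K (phi t) <= rc ((1 + 2 / A) ^+ t * 2).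
  have q0 : 0 <= 1 + rc (2 / A) by rewrite addr_ge0 // -(rmorph0 rc) rc_le.
  elim: t => [_|t IH tT].
    rewrite expr0 mul1r /progress /phi /= .
    have -> : \sum_(x : X) \sum_(y : X) rc (K x y) * dot (apply_op (U 0%N) (ket (qinit _ _ _)))
        (apply_op (U 0%N) (ket (qinit _ dk dj))) = rc ((\sum_x \sum_y M x y) ^+ m).
      have -> : (\sum_x \sum_y M x y) ^+ m = \sum_x \sum_y K x y.
        rewrite -[m in LHS]card_ord -prodr_const bigA_distr_bigA /=.
        apply: eq_bigr => x _; rewrite bigA_distr_bigA /=.
        by apply: eq_bigr => y _.
      rewrite rmorph_sum; apply: eq_bigr => x _; rewrite rmorph_sum; apply: eq_bigr => y _.
      by rewrite dot_unitary; [rewrite dot_ketl /ket eqxx mulr1|exact: uU].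
    rewrite rc_le; apply: le_trans (_ : (1 + eta) ^+ m <= _).
      have s0 : 0 <= \sum_x \sum_y M x y.
        have := gram_form_ge0 (fun=> 1) gM.
        rewrite (_ : \sum_x _ = rc (\sum_x \sum_y M x y)).
          by rewrite -(rmorph0 rc) rc_le.
        rewrite rmorph_sum; apply: eq_bigr => x _; rewrite rmorph_sum; apply: eq_bigr => y _.
        by rewrite rmorph1 !mulr1.
      by rewrite ler_pXn2r // ?nnegrE // addr_ge0 // ltW.
    apply: pow1_bound; first exact: ltW.
    by rewrite /eta le_eqVlt; apply/orP; left; apply/eqP; field; rewrite gt_eqF.
  have -> : progress K (phi t.+1) = progress K (fun x => apply_op (query (z x)) (phi t x)).
    exact: (progress_unitary K (fun x => apply_op (query (z x)) (phi t x)) (uU _ tT)).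
  apply: le_trans (progress_query _ e0 gK gKi) _.
  apply: le_trans (ler_wpM2l q0 (IH (ltnW tT))) _.
  by rewrite -[1 + rc _](rmorphD rc 1) -rmorphM exprS mulrA.
(* Filling only the addressed cell changes the value from false to true, so the algorithm must
   distinguish two inputs that differ in this single bit. *)
have w_lb x : 1 / 144 <= T%:R * \sum_(t < T) query_weight (phi t x) (cell_index (address x)).
  pose z' := lookup_input x (fun l => l == address x).
  have fz : lookup (z x) = Some false by rewrite lookup_inputE.
  have fz' : lookup z' = Some true by rewrite lookup_inputE eqxx.
  have [d [hd d6]] := dist _ _ _ _ fz fz' isT.
  apply: (distinguishing_weight uU _ hd d6) => k kne; rewrite !ffunE.
  case ek : (enum_val k : lookup_index) => [//|l]; apply/esym/negbTE.
  by apply: contraNneq kne => <-; rewrite -ek enum_valK.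
pose w (x : X) := \prod_j b (x j) : RR.
have w0 x : 0 <= w x by rewrite prodr_ge0.
have w1 : \sum_(x : X) w x = 1.
  rewrite -(expr1n RR m) -b1 -[m in RHS]card_ord -prodr_const bigA_distr_bigA.
  by [].
(* Average of [w_lb] under the product weight. The 4 is the initial progress 2 times the growth
   factor 2, and $576 = 144 \cdot 4$. *)
have main : 1 / 144 <= T%:R * \sum_(t < T) rc ((2 / 3) ^+ m * 4).
  have -> : 1 / 144 = \sum_x rc (w x) * (1 / 144) by rewrite -mulr_suml -rmorph_sum w1 rmorph1 [RHS]mul1r.
  apply: le_trans (_ : \sum_x rc (w x) * (T%:R * \sum_(t < T) query_weight (phi t x) (cell_index (address x))) <= _).
    by apply: ler_sum => x _; rewrite ler_wpM2l // -(rmorph0 rc) rc_le.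
  under eq_bigr => x _ do rewrite mulrCA mulr_sumr.
  rewrite -mulr_sumr ler_wpM2l ?ler0n // exchange_big; apply: ler_sum => t _.
  apply: le_trans (cell_weight b0 gM gMb (phi t)) _.
  rewrite rmorphM; apply: ler_wpM2l.
    by rewrite -(rmorph0 rc) rc_le exprn_ge0 // divr_ge0.
  apply: le_trans (prog t (ltnW (ltn_ord t))) _; rewrite rc_le.
  have : (1 + 2 / A) ^+ t <= 2.
    apply: pow1_bound e0 _; rewrite mulrA ler_pdivrMr //.
    have : t%:R <= T%:R :> RR by rewrite ler_nat ltnW.
    by lra.
  by lra.
move: main; rewrite sumr_const card_ord.
have -> : T%:R * (rc ((2 / 3) ^+ m * 4) *+ T) = rc (T%:R * (T%:R * ((2 / 3) ^+ m * 4))).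
  by rewrite !rmorphM !rmorph_nat /=; ring.
have -> : 1 / 144 = rc (1 / 144) by rewrite fmorph_div rmorph1 rmorph_nat.
rewrite rc_le expr_div_n => main.
have p3 : 0 < 3 ^+ m :> RR by rewrite exprn_gt0.
have : (3 ^ m)%:R <= (576 * T ^ 2 * 2 ^ m)%:R :> RR.
  rewrite !natrM !natrX.
  have -> : 576 * T%:R ^+ 2 * 2 ^+ m = 144 * (T%:R * (T%:R * (2 ^+ m / 3 ^+ m * 4))) * 3 ^+ m :> RR.
    by field; rewrite gt_eqF.
  rewrite -[leLHS]mul1r ler_pM2r //; lra.
by rewrite ler_nat leqNgt Tm.
Qed.

End Lookup.

(** * Reading the whole input *)

Lemma apply_op_perm_ket (T : finType) (p q : T -> T) s : cancel q p -> cancel p q ->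
  apply_op (op_perm p) (ket s) = ket (p s).
Proof.
move=> qK pK; rewrite (apply_op_perm _ qK pK); apply/funext => t.
by rewrite /ket /= -(can_eq pK) qK.
Qed.

(** The difference of the two projections is diagonal with singular values 1 at [k] and [l]; the
    sign at [l] goes into the right unitary. *)
Lemma trace_dist_basis (d : nat) (k l : 'I_d.+1) : k != l ->
  trace_dist_is (fun a b : 'I_d.+1 => (a == k)%:R * (b == k)%:R)
                (fun a b : 'I_d.+1 => (a == l)%:R * (b == l)%:R) 1.
Proof.
move=> kl; exists 2; split; last by rewrite divff ?pnatr_eq0.
exists (@op1 _), (op_diag (fun c => if c == l then -1 else 1)), (fun c => (c == k)%:R + (c == l)%:R).
split.
- exact: unitary1.
- by apply: unitary_diag => c; case: ifP; rewrite ?normrN normr1.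
- by move=> c; rewrite addr_ge0 ?ler0n.
- move=> a b; rewrite [RHS](bigD1 a) //= [X in _ = _ + X]big1 ?addr0 => [|c ca]; last first.
    by rewrite /op1 eq_sym (negbTE ca) !mul0r.
  rewrite /op1 /op_diag eqxx mul1r; have [->|ba] := eqVneq b a; last first.
    rewrite mul0r rmorph0 mulr0; case: (eqVneq a k) => [ak|_]; case: (eqVneq a l) => [al|_].
    - by move: kl; rewrite -ak al eqxx.
    - by rewrite -ak (negbTE ba) mulr0 mul0r subrr.
    - by rewrite -al (negbTE ba) mulr0 mul0r subrr.
    - by rewrite !mul0r subrr.
  rewrite mul1r; case: (eqVneq a k) => [ak|_]; case: (eqVneq a l) => [al|_].
  - by move: kl; rewrite -ak al eqxx.
  - by rewrite rmorph1 /= ?mulr1n ?mulr0n; ring.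
  - by rewrite rmorphN rmorph1 /= ?mulr1n ?mulr0n; ring.
  - by rewrite rmorph1 /= ?mulr1n ?mulr0n; ring.
rewrite big_split /=.
have sum1 (c : 'I_d.+1) : \sum_a (a == c)%:R = 1 :> CC.
  by rewrite (bigD1 c) //= eqxx big1 ?addr0 // => a /negbTE ->.
by rewrite !sum1.
Qed.

Section ReadAll.
Variable n : nat.
Let S := qstate n (bits n * unit)%type.

Definition store (k : bits n) (i : 'I_n) (b : bool) : bits n :=
  [ffun j => if j == i then b else k j].

(** Swaps the answer qubit with the stored bit at the current index, then moves to the next index.
    As the store is initially blank, this also resets the answer qubit. *)
Definition read_step (s : S) : S :=
  match unlift ord_max s.1.1 with
  | Some i => ((ordS s.1.1, s.2.1 i), (store s.2.1 i s.1.2, s.2.2))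
  | None => ((ordS s.1.1, s.1.2), s.2)
  end.

Definition read_back (s : S) : S :=
  match unlift ord_max (ord_pred s.1.1) with
  | Some i => ((ord_pred s.1.1, s.2.1 i), (store s.2.1 i s.1.2, s.2.2))
  | None => ((ord_pred s.1.1, s.1.2), s.2)
  end.

Lemma storeK k i b : store (store k i b) i (k i) = k.
Proof. by apply/ffunP => j; rewrite !ffunE; case: eqP => [->|]. Qed.

Lemma read_stepK : cancel read_step read_back.
Proof.
move=> [[i b] [k []]]; rewrite /read_step /read_back /=.
case ei : (unlift _ i) => [j|] /=; rewrite ordSK ei /=.
  by rewrite storeK ffunE eqxx.
by [].
Qed.

Lemma read_backK : cancel read_back read_step.
Proof.
move=> [[i b] [k []]]; rewrite /read_step /read_back /=.
case ei : (unlift ord_max (ord_pred i)) => [j|] /=; rewrite ei /= ord_predK.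
  by rewrite storeK ffunE eqxx.
by [].
Qed.

(** Shows that the minimum defining [QS] is attained, so that it is not the default value 0 of
    [minnat]. *)
Lemma QS_read_all (f : pfun n) : QS_distinguishes f n.
Proof.
pose V (t : nat) : op S := if t is 0 then @op1 S else op_perm read_step.
have uV t : (t <= n)%N -> unitary (V t).
  by case: t => [|t] _; [exact: unitary1|exact: unitary_perm read_backK read_stepK].
have [dk [dj [hk [hj [U [[hk' hkK hk'K] [hj' hjK hj'K] uU rU]]]]]] :=
  qrun_transport ([ffun=> false] : bits n) tt uV.
exists dk, dj, U; split=> // x y vx vy fx fy vxy.
pose part (x : bits n) t : bits n := [ffun i : 'I_n => if (i < t)%N then x i else false].
have run z t : (t <= n)%N -> run_queries V (ket ((ord0, false), ([ffun=> false], tt))) z t =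
    ket ((inord t, false), (part z t, tt)).
  elim: t => [_|t IH tn].
    by rewrite /= apply_op1; congr (ket (_, _, (_, tt))); apply: val_inj; rewrite /= inordK.
  rewrite /= IH ?(ltnW tn) // (apply_op_perm_ket _ (flip_queryK z) (flip_queryK z)).
  rewrite (apply_op_perm_ket _ read_backK read_stepK); congr ket.
  have lt1 : (t < n.+1)%N by rewrite ltnS ltnW.
  have it : inord t = lift ord_max (Ordinal tn) :> 'I_n.+1.
    by apply: val_inj; rewrite /= inordK // /bump leqNgt tn.
  rewrite /flip_query /read_step /= it liftK /=; congr (_, _, (_, _)).
  - apply: val_inj; rewrite /= inordK ?ltnS // /bump leqNgt tn /= add0n modn_small //.
  - by rewrite ffunE /= ltnn.
  apply/ffunP => i; rewrite !ffunE /xbit liftK.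
  have [->|ne] := eqVneq i (Ordinal tn); first by rewrite /= ltnS leqnn.
  rewrite ltnS [in RHS]leq_eqVlt; suff -> : (val i == t) = false by [].
  by apply: contraNF ne => /eqP it'; apply/eqP/val_inj.
have red z : reduced (qrun U z n) =
    fun a b : 'I_dk.+1 => (a == hk' z)%:R * (b == hk' z)%:R.
  apply/funext => a; apply/funext => b; rewrite /reduced.
  have zE : part z n = z by apply/ffunP => i; rewrite ffunE ltn_ord.
  have psi i b' k j : qrun U z n ((i, b'), (k, j)) = (i == inord n)%:R * (b' == false)%:R * (k == hk' z)%:R * (j == hj' tt)%:R.
    rewrite rU run // zE /ket /= !xpair_eqE -!natrM !mulnb -andbA; congr (nat_of_bool _)%:R.
    by rewrite -(can_eq hk'K) hkK -(can_eq hj'K) hjK andbA andbA -!andbA.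
  rewrite (bigD1 (inord n)) //= [X in _ + X]big1 ?addr0 => [|i ni]; last first.
    by do 2!(apply: big1 => ? _); rewrite psi (negbTE ni) !mul0r.
  rewrite big_bool /= [X in X + _]big1 ?add0r => [|j _]; last by rewrite psi mulr0 !mul0r.
  rewrite (bigD1 (hj' tt)) //= [X in _ + X]big1 ?addr0 => [|j nj]; last first.
    by rewrite psi (negbTE nj) mulr0 mul0r.
  by rewrite !psi !eqxx !mul1r !mulr1 rmorph_nat.
exists 1; rewrite !red; split; last by rewrite ler_pdivrMr ?ltr0n // mul1r ler1n.
apply: trace_dist_basis; apply: contraNneq vxy => /(can_inj hk'K) xy.
by move: fx fy; rewrite xy => -> [->].
Qed.

End ReadAll.

(** * Communication protocols over arbitrary private spaces *)

Section Channel.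
Variables (SA SB : finType).

Definition chspace : finType := ((SA * bool) * SB)%type.

Definition mkA (x : SA * bool) (b : SB) : chspace := (x, b).
Definition mkB (x : bool * SB) (a : SA) : chspace := ((a, x.1), x.2).

Definition actA (U : op (SA * bool)%type) : op chspace :=
  op_ext (fun s : chspace => s.1) (fun s : chspace => s.2) (fun _ => U).

Definition actB (V : op (bool * SB)%type) : op chspace :=
  op_ext (fun s : chspace => (s.1.2, s.2)) (fun s : chspace => s.1.1) (fun _ => V).

Lemma apply_actA U v a c b :
  apply_op (actA U) v ((a, c), b) = apply_op U (fun x => v (x, b)) (a, c).
Proof. by rewrite (apply_op_ext (mk := mkA)) // => -[]. Qed.

Lemma apply_actB V v a c b :
  apply_op (actB V) v ((a, c), b) = apply_op V (fun x => v ((a, x.1), x.2)) (c, b).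
Proof. by rewrite (apply_op_ext (mk := mkB)) // => [[? ?]|[[? ?] ?]]. Qed.

Lemma unitary_actA U : unitary U -> unitary (actA U).
Proof. by move=> uU; apply: (unitary_ext (mk := mkA)) => // -[]. Qed.

Lemma unitary_actB V : unitary V -> unitary (actB V).
Proof. by move=> uV; apply: (unitary_ext (mk := mkB)) => // [[? ?]|[[? ?] ?]]. Qed.

(** One action of Alice followed by one of Bob, so a round costs two qubits of communication. *)
Definition round : Type := (op (SA * bool)%type * op (bool * SB)%type)%type.

Definition unitary_round (r : round) := unitary r.1 /\ unitary r.2.

Definition play (r : round) (v : vec chspace) : vec chspace :=
  apply_op (actB r.2) (apply_op (actA r.1) v).

Fixpoint rounds (P : nat -> round) (v : vec chspace) (k : nat) : vec chspace :=
  if k is k'.+1 then play (P k') (rounds P v k') else v.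

Lemma eq_rounds P P' v k : (forall i, (i < k)%N -> P i = P' i) -> rounds P v k = rounds P' v k.
Proof.
elim: k => //= k IH h; rewrite h // IH // => i ik; exact: h (ltnW ik).
Qed.

Lemma rounds_add P v k l :
  rounds P v (k + l) = rounds (fun i => P (k + i)%N) (rounds P v k) l.
Proof. by elim: l => [|l IH]; rewrite ?addn0 // addnS /= IH. Qed.

Lemma dot_rounds P v k : (forall i, unitary_round (P i)) -> dot (rounds P v k) (rounds P v k) = dot v v.
Proof.
move=> uP; elim: k => //= k IH; have [uA uB] := uP k.
by rewrite /play (dot_unitary _ _ (unitary_actB uB)) (dot_unitary _ _ (unitary_actA uA)).
Qed.

End Channel.

Lemma Qcc_computes_rounds (XA YB : finType) (F : XA -> YB -> option bool) (k : nat)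
    (SA SB : finType) (a0 : SA) (b0 : SB)
    (PA : nat -> XA -> op (SA * bool)%type) (PB : nat -> YB -> op (bool * SB)%type) :
  (forall i x, unitary (PA i x)) -> (forall i y, unitary (PB i y)) ->
  (forall x y v, F x y = Some v -> 2 / 3 <= \sum_a \sum_b
     `|rounds (fun i => (PA i x, PB i y)) (ket ((a0, false), b0)) k ((a, v), b)| ^+ 2) ->
  Qcc_computes F k.*2.
Proof.
move=> uA uB hF.
have [da [ha [ha' [haK ha'K ha0]]]] := pointed_ordinal a0.
have [db [hb [hb' [hbK hb'K hb0]]]] := pointed_ordinal b0.
pose gA (s : 'I_da.+1 * bool) : SA * bool := (ha' s.1, s.2).
pose gA' (s : SA * bool) : 'I_da.+1 * bool := (ha s.1, s.2).
have gAK : cancel gA' gA by move=> [a c]; rewrite /gA /gA' /= haK.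
have gA'K : cancel gA gA' by move=> [a c]; rewrite /gA /gA' /= ha'K.
pose gB (s : bool * 'I_db.+1) : bool * SB := (s.1, hb' s.2).
pose gB' (s : bool * SB) : bool * 'I_db.+1 := (s.1, hb s.2).
have gBK : cancel gB' gB by move=> [c b]; rewrite /gB /gB' /= hbK.
have gB'K : cancel gB gB' by move=> [c b]; rewrite /gB /gB' /= hb'K.
pose g (s : cspace da db) : chspace SA SB := ((ha' s.1.1, s.1.2), hb' s.2).
exists da, db, (fun t x => op_transport gA (PA t./2 x)), (fun t y => op_transport gB (PB t./2 y)).
have run x y t : crun (fun t x => op_transport gA (PA t./2 x)) (fun t y => op_transport gB (PB t./2 y))
    x y t.*2 = rounds (fun i => (PA i x, PB i y)) (ket ((a0, false), b0)) t \o g.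
  elim: t => [|t IH].
    apply/funext => s; rewrite /= /ket /cinit /g; case: s => [[a c] b] /=.
    by rewrite !xpair_eqE -ha0 -hb0 -(can_eq ha'K) -(can_eq hb'K) haK hbK.
  rewrite doubleS /= odd_double /= IH; apply/funext => -[[a c] b].
  rewrite /play -[@liftB _ _ _]/(actB _) -[@liftA _ _ _]/(actA _) /= uphalf_double doubleK.
  rewrite apply_actB /= /g /= apply_actB.
  rewrite -[(c, hb' b)]/(gB (c, b)) -[RHS]/((_ \o gB) _) -(apply_op_transport gBK gB'K).
  congr (apply_op _ _ _); apply/funext => -[c' b']; rewrite /= !apply_actA.
  rewrite -[(ha' a, c')]/(gA (a, c')) -[RHS]/((_ \o gA) _) -(apply_op_transport gAK gA'K).
  by congr (apply_op _ _ _); apply/funext => -[].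
split=> [t x|t y|x y v Fxy].
- exact: unitary_transport gAK gA'K _ (uA _ _).
- exact: unitary_transport gBK gB'K _ (uB _ _).
apply: le_trans (hF x y v Fxy) _; rewrite run le_eqVlt; apply/orP; left; apply/eqP.
rewrite /cprob_out.
pose g' (s : chspace SA SB) : cspace da db := ((ha s.1.1, s.1.2), hb s.2).
have gK : cancel g' g by move=> [[a c] b]; rewrite /g /g' /= haK hbK.
have g'K : cancel g g' by move=> [[a c] b]; rewrite /g /g' /= ha'K hb'K.
rewrite (sum_transport g'K gK).
transitivity (\sum_a \sum_c \sum_b (if c == v then
   `|rounds (fun i => (PA i x, PB i y)) (ket ((a0, false), b0)) k ((a, c), b)| ^+ 2 else 0)).
  apply: eq_bigr => a _; rewrite (bigD1 v) //= [X in _ = _ + X]big1 ?addr0 => [|c cv].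
    by apply: eq_bigr => b _; rewrite eqxx.
  by apply: big1 => b _; rewrite (negbTE cv).
rewrite pair_big pair_big [RHS]big_mkcond /=; apply: eq_bigr => -[[a c] b] _.
by rewrite /= gK.
Qed.

Lemma apply_op_ext_prod (S P A : finType) (p : S -> P) (a : S -> A) (mk : P -> A -> S)
    (U : op P) (f : vec P) (g : A -> CC) :
  (forall x c, p (mk x c) = x) -> (forall x c, a (mk x c) = c) -> (forall s, mk (p s) (a s) = s) ->
  apply_op (op_ext p a (fun _ => U)) (fun s => f (p s) * g (a s)) =
  fun s => apply_op U f (p s) * g (a s).
Proof.
move=> pK aK mkK; apply/funext => s; rewrite (apply_op_ext pK aK mkK) /apply_op mulr_suml.
by apply: eq_bigr => x _; rewrite pK aK mulrA.
Qed.

Section ProductProtocol.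
Variables (SA1 SA2 SB1 SB2 : finType).
Let SA : finType := (SA1 * SA2)%type.
Let SB : finType := (SB1 * SB2)%type.

Definition liftA1 (U : op (SA1 * bool)%type) : op (SA * bool)%type :=
  op_ext (fun s : SA * bool => (s.1.1, s.2)) (fun s => s.1.2) (fun _ => U).
Definition liftA2 (U : op (SA2 * bool)%type) : op (SA * bool)%type :=
  op_ext (fun s : SA * bool => (s.1.2, s.2)) (fun s => s.1.1) (fun _ => U).
Definition liftB1 (V : op (bool * SB1)%type) : op (bool * SB)%type :=
  op_ext (fun s : bool * SB => (s.1, s.2.1)) (fun s => s.2.2) (fun _ => V).
Definition liftB2 (V : op (bool * SB2)%type) : op (bool * SB)%type :=
  op_ext (fun s : bool * SB => (s.1, s.2.2)) (fun s => s.2.1) (fun _ => V).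

Let mA1 (x : SA1 * bool) (a : SA2) : SA * bool := ((x.1, a), x.2).
Let mA2 (x : SA2 * bool) (a : SA1) : SA * bool := ((a, x.1), x.2).
Let mB1 (x : bool * SB1) (b : SB2) : bool * SB := (x.1, (x.2, b)).
Let mB2 (x : bool * SB2) (b : SB1) : bool * SB := (x.1, (b, x.2)).

Lemma unitary_liftA1 U : unitary U -> unitary (liftA1 U).
Proof. by move=> uU; apply: (unitary_ext (mk := mA1)) => // [[]|[[]]]. Qed.
Lemma unitary_liftA2 U : unitary U -> unitary (liftA2 U).
Proof. by move=> uU; apply: (unitary_ext (mk := mA2)) => // [[]|[[]]]. Qed.
Lemma unitary_liftB1 U : unitary U -> unitary (liftB1 U).
Proof. by move=> uU; apply: (unitary_ext (mk := mB1)) => // [[]|[? []]]. Qed.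
Lemma unitary_liftB2 U : unitary U -> unitary (liftB2 U).
Proof. by move=> uU; apply: (unitary_ext (mk := mB2)) => // [[]|[? []]]. Qed.

Definition lift_round1 (r : round SA1 SB1) : round SA SB := (liftA1 r.1, liftB1 r.2).
Definition lift_round2 (r : round SA2 SB2) : round SA SB := (liftA2 r.1, liftB2 r.2).

(** The channel qubit belongs to the running protocol. The idle factor [w] may be entangled between
    Alice and Bob. *)
Definition tensor1 (v : vec (chspace SA1 SB1)) (w : SA2 -> SB2 -> CC) : vec (chspace SA SB) :=
  fun s => v ((s.1.1.1, s.1.2), s.2.1) * w s.1.1.2 s.2.2.
Definition tensor2 (v : vec (chspace SA2 SB2)) (w : SA1 -> SB1 -> CC) : vec (chspace SA SB) :=
  fun s => v ((s.1.1.2, s.1.2), s.2.2) * w s.1.1.1 s.2.1.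

Lemma play_lift1 r v w : play (lift_round1 r) (tensor1 v w) = tensor1 (play r v) w.
Proof.
have eA u : apply_op (actA (liftA1 r.1)) (tensor1 u w) = tensor1 (apply_op (actA r.1) u) w.
  apply/funext => -[[[a1 a2] c] [b1 b2]]; rewrite apply_actA /tensor1 /= apply_actA.
  have h := @apply_op_ext_prod _ _ _ (fun s : SA * bool => (s.1.1, s.2)) (fun s => s.1.2) mA1 r.1
     (fun x => u (x, b1)) (fun a => w a b2).
  by rewrite /liftA1 h //= => [[]|[[]]].
have eB u : apply_op (actB (liftB1 r.2)) (tensor1 u w) = tensor1 (apply_op (actB r.2) u) w.
  apply/funext => -[[[a1 a2] c] [b1 b2]]; rewrite apply_actB /tensor1 /= apply_actB.
  have h := @apply_op_ext_prod _ _ _ (fun s : bool * SB => (s.1, s.2.1)) (fun s => s.2.2) mB1 r.2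
     (fun x => u ((a1, x.1), x.2)) (fun b => w a2 b).
  by rewrite /liftB1 h //= => [[]|[? []]].
by rewrite /play /= eA eB.
Qed.

Lemma play_lift2 r v w : play (lift_round2 r) (tensor2 v w) = tensor2 (play r v) w.
Proof.
have eA u : apply_op (actA (liftA2 r.1)) (tensor2 u w) = tensor2 (apply_op (actA r.1) u) w.
  apply/funext => -[[[a1 a2] c] [b1 b2]]; rewrite apply_actA /tensor2 /= apply_actA.
  have h := @apply_op_ext_prod _ _ _ (fun s : SA * bool => (s.1.2, s.2)) (fun s => s.1.1) mA2 r.1
     (fun x => u (x, b2)) (fun a => w a b1).
  by rewrite /liftA2 h //= => [[]|[[]]].
have eB u : apply_op (actB (liftB2 r.2)) (tensor2 u w) = tensor2 (apply_op (actB r.2) u) w.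
  apply/funext => -[[[a1 a2] c] [b1 b2]]; rewrite apply_actB /tensor2 /= apply_actB.
  have h := @apply_op_ext_prod _ _ _ (fun s : bool * SB => (s.1, s.2.2)) (fun s => s.2.1) mB2 r.2
     (fun x => u ((a2, x.1), x.2)) (fun b => w a1 b).
  by rewrite /liftB2 h //= => [[]|[? []]].
by rewrite /play /= eA eB.
Qed.

Lemma rounds_lift1 P v w k :
  rounds (fun i => lift_round1 (P i)) (tensor1 v w) k = tensor1 (rounds P v k) w.
Proof. by elim: k => //= k ->; rewrite play_lift1. Qed.

Lemma rounds_lift2 P v w k :
  rounds (fun i => lift_round2 (P i)) (tensor2 v w) k = tensor2 (rounds P v k) w.
Proof. by elim: k => //= k ->; rewrite play_lift2. Qed.

End ProductProtocol.

Arguments liftA1 {SA1 SA2}.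
Arguments liftA2 {SA1 SA2}.
Arguments liftB1 {SB1 SB2}.
Arguments liftB2 {SB1 SB2}.
Arguments lift_round1 {SA1 SA2 SB1 SB2}.
Arguments lift_round2 {SA1 SA2 SB1 SB2}.

(** * Sampling protocols *)

(* After [k] rounds the channel is back to [|0>] and measuring Alice's register gives [o]
   with probability [mu x y o]. *)
Definition samples (XA YB OA : finType) (k : nat) (mu : XA -> YB -> OA -> RR) : Prop :=
  exists (SA SB : finType) (a0 : SA) (b0 : SB) (PA : nat -> XA -> op (SA * bool)%type)
    (PB : nat -> YB -> op (bool * SB)%type) (rd : SA -> OA),
  [/\ (forall i x, unitary (PA i x)), (forall i y, unitary (PB i y)),
      (forall x y a b, rounds (fun i => (PA i x, PB i y)) (ket ((a0, false), b0)) k ((a, true), b) = 0)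
    & forall x y o, rc (mu x y o) = \sum_(a | rd a == o) \sum_b
        `|rounds (fun i => (PA i x, PB i y)) (ket ((a0, false), b0)) k ((a, false), b)| ^+ 2].

Section Samples.
Variables (XA YB : finType).

Lemma samples_ge0 (OA : finType) k (mu : XA -> YB -> OA -> RR) x y o : samples k mu -> 0 <= mu x y o.
Proof.
move=> [SA [SB [a0 [b0 [PA [PB [rd [_ _ _ muE]]]]]]]].
rewrite -rc_le muE rmorph0 sumr_ge0 // => a _; rewrite sumr_ge0 // => b _.
exact: exprn_ge0.
Qed.

Lemma sum_readout (SA OA : finType) (rd : SA -> OA) (F : SA -> CC) (R : pred OA) :
  \sum_(o | R o) \sum_(a | rd a == o) F a = \sum_(a | R (rd a)) F a.
Proof.
rewrite [RHS](partition_big rd R) //=; apply: eq_bigr => o Ro.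
by apply: eq_bigl => a; case: eqP => [->|]; rewrite ?Ro ?andbT ?andbF.
Qed.

Lemma sum_samples (OA : finType) k (mu : XA -> YB -> OA -> RR) x y :
  samples k mu -> \sum_o mu x y o = 1.
Proof.
move=> [SA [SB [a0 [b0 [PA [PB [rd [uA uB z muE]]]]]]]].
apply: (@complexI RR); rewrite -/rc rmorph_sum rmorph1.
under eq_bigr => o _ do rewrite /= muE.
rewrite sum_readout.
have <- : dot (ket ((a0, false), b0)) (ket ((a0, false), b0)) = 1 by rewrite dot_ketl /ket eqxx.
have uP i : unitary_round (PA i x, PB i y) by split; [exact: uA|exact: uB].
rewrite -(dot_rounds _ k uP) dot_normsq.
transitivity (\sum_a \sum_c \sum_b
   `|rounds (fun i : nat => (PA i x, PB i y)) (ket (a0, false, b0)) k (a, c, b)| ^+ 2).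
  apply: eq_bigr => a _; rewrite big_bool /= [X in _ = X + _]big1 ?add0r // => b _.
  by rewrite z normr0 expr0n.
by rewrite pair_big pair_big /=; apply: eq_bigr => -[[a c] b].
Qed.

Lemma samples_comap (XA' YB' OA : finType) (fA : XA' -> XA) (fB : YB' -> YB) k
    (mu : XA -> YB -> OA -> RR) :
  samples k mu -> samples k (fun x y => mu (fA x) (fB y)).
Proof.
move=> [SA [SB [a0 [b0 [PA [PB [rd [uA uB z muE]]]]]]]].
by exists SA, SB, a0, b0, (fun i x => PA i (fA x)), (fun i y => PB i (fB y)), rd.
Qed.

(** The first protocol returns the channel to zero, so the second starts as if alone, with the final
    state of the first as an idle factor. *)
Lemma samples_pair (O1 O2 : finType) k1 k2 (mu1 : XA -> YB -> O1 -> RR) (mu2 : XA -> YB -> O2 -> RR) :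
  samples k1 mu1 -> samples k2 mu2 ->
  samples (k1 + k2) (fun x y (o : O1 * O2) => mu1 x y o.1 * mu2 x y o.2).
Proof.
move=> [SA1 [SB1 [a1 [b1 [PA1 [PB1 [rd1 [uA1 uB1 z1 muE1]]]]]]]].
move=> [SA2 [SB2 [a2 [b2 [PA2 [PB2 [rd2 [uA2 uB2 z2 muE2]]]]]]]].
pose PA i x : op ((SA1 * SA2) * bool)%type :=
  if (i < k1)%N then liftA1 (PA1 i x) else liftA2 (PA2 (i - k1)%N x).
pose PB i y : op (bool * (SB1 * SB2))%type :=
  if (i < k1)%N then liftB1 (PB1 i y) else liftB2 (PB2 (i - k1)%N y).
exists (SA1 * SA2)%type, (SB1 * SB2)%type, (a1, a2), (b1, b2), PA, PB, (fun a => (rd1 a.1, rd2 a.2)).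
have runE x y a a' c b b' :
    rounds (fun i => (PA i x, PB i y)) (ket (((a1, a2), false), (b1, b2))) (k1 + k2) (((a, a'), c), (b, b')) =
    rounds (fun i => (PA2 i x, PB2 i y)) (ket ((a2, false), b2)) k2 ((a', c), b') *
    rounds (fun i => (PA1 i x, PB1 i y)) (ket ((a1, false), b1)) k1 ((a, false), b).
  rewrite rounds_add.
  set r1 := rounds (fun i => (PA1 i x, PB1 i y)) _ k1.
  have -> : rounds (fun i => (PA i x, PB i y)) (ket (((a1, a2), false), (b1, b2))) k1 =
     tensor2 (ket ((a2, false), b2)) (fun a b => r1 ((a, false), b)).
    transitivity (tensor1 r1 (fun a b => ((a == a2) && (b == b2))%:R)).
      rewrite -rounds_lift1.
      rewrite (eq_rounds (P' := fun i => lift_round1 (PA1 i x, PB1 i y))) => [|i ik]; last first.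
        by rewrite /PA /PB ik.
      congr rounds; apply/funext => -[[[u u'] d] [t t']].
      rewrite /tensor1 /ket /= !xpair_eqE -natrM mulnb; congr (nat_of_bool _)%:R.
      by case: (u == a1); case: (u' == a2); case: d; case: (t == b1); case: (t' == b2).
    apply/funext => -[[[u u'] d] [t t']]; rewrite /tensor1 /tensor2 /ket /= !xpair_eqE.
    case: d; first by rewrite /r1 z1 mul0r andbF andFb mul0r.
    by rewrite mulrC andbT.
  rewrite (eq_rounds (P' := fun i => lift_round2 (PA2 i x, PB2 i y))) => [|i ik].
    by rewrite rounds_lift2.
  by rewrite /PA /PB ltnNge leq_addr /= addKn.
split.
- by move=> i x; rewrite /PA; case: ifP => _; [exact: unitary_liftA1|exact: unitary_liftA2].
- by move=> i y; rewrite /PB; case: ifP => _; [exact: unitary_liftB1|exact: unitary_liftB2].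
- by move=> x y [a a'] [b b']; rewrite runE z2 mul0r.
move=> x y [o o']; rewrite rmorphM /= muE1 muE2.
rewrite big_distrlr /= pair_big /=; apply: eq_big => [[a a']|[a a'] _] //=.
rewrite big_distrlr /= pair_big /=; apply: eq_bigr => -[b b'] _.
by rewrite /= runE normrM exprMn mulrC.
Qed.

End Samples.

Lemma samples_const (XA YB OA : finType) (o0 : OA) :
  samples 0 (fun (_ : XA) (_ : YB) o => (o == o0)%:R).
Proof.
exists unit, unit, tt, tt, (fun _ _ => @op1 _), (fun _ _ => @op1 _), (fun=> o0).
split=> [i x|i y|x y a b|x y o].
- exact: unitary1.
- exact: unitary1.
- by case: a; case: b.
rewrite rmorph_nat eq_sym /=; have [_|_] := eqVneq o0 o; last by rewrite big_pred0.
rewrite (big_pred1 tt) => [|[]] //; rewrite (big_pred1 tt) => [|[]] //.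
by rewrite /ket eqxx normr1 expr1n.
Qed.

Lemma crun_rounds (XA YB : Type) (da db : nat) (UA : nat -> XA -> op ('I_da.+1 * bool)%type)
    (UB : nat -> YB -> op (bool * 'I_db.+1)%type) x y t :
  crun UA UB x y t.*2 = rounds (fun i => (UA i.*2 x, UB i.*2.+1 y)) (ket (cinit da db)) t.
Proof. by elim: t => //= t IH; rewrite odd_double /= IH. Qed.

Lemma crun_idle (XA YB : Type) (da db : nat) (UA : nat -> XA -> op ('I_da.+1 * bool)%type)
    (UB : nat -> YB -> op (bool * 'I_db.+1)%type) x y T t : (T <= t)%N ->
  crun (fun i x => if (i < T)%N then UA i x else @op1 _)
       (fun i y => if (i < T)%N then UB i y else @op1 _) x y t = crun UA UB x y T.
Proof.
elim: t => [|t IH].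
  by rewrite leqn0 => /eqP ->.
rewrite leq_eqVlt => /predU1P[->|].
  suff h s : (s <= t.+1)%N -> crun (fun i x => if (i < t.+1)%N then UA i x else @op1 _)
       (fun i y => if (i < t.+1)%N then UB i y else @op1 _) x y s = crun UA UB x y s by apply: h.
  by elim: s => //= s IHs st; rewrite st IHs // ltnW.
rewrite ltnS => Tt; rewrite /= ltnNge Tt /= IH //; case: (odd t).
  by rewrite -[@liftB _ _ _]/(actB _); apply/funext => -[[a c] b]; rewrite apply_actB apply_op1.
by rewrite -[@liftA _ _ _]/(actA _); apply/funext => -[[a c] b]; rewrite apply_actA apply_op1.
Qed.

(** The protocol is padded with identities to a whole number of rounds. One more round swaps the
    answer on the channel with a fresh qubit of Alice, which leaves the channel at zero. *)
Lemma samples_of_Qcc (XA YB : finType) (F : XA -> YB -> option bool) T : Qcc_computes F T ->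
  exists mu, samples (uphalf T).+1 mu /\ forall x y v, F x y = Some v -> 2 / 3 <= mu x y v.
Proof.
move=> [da [db [UA [UB [uA uB hF]]]]].
pose VA i x := if (i < T)%N then UA i x else @op1 _.
pose VB i y := if (i < T)%N then UB i y else @op1 _.
set k := uphalf T.
have Tk : (T <= k.*2)%N by rewrite -leq_uphalf_double.
pose psi x y := crun UA UB x y T.
have psiE x y : rounds (fun i => (VA i.*2 x, VB i.*2.+1 y)) (ket (cinit da db)) k = psi x y.
  by rewrite -crun_rounds /VA /VB crun_idle.
pose sw (s : ('I_da.+1 * bool) * bool) := ((s.1.1, s.2), s.1.2).
have swK : cancel sw sw by move=> [[a o] c].
pose PA i x : op (('I_da.+1 * bool) * bool)%type :=
  if (i < k)%N then liftA1 (VA i.*2 x) else op_perm sw.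
pose PB i y : op (bool * ('I_db.+1 * unit))%type :=
  if (i < k)%N then liftB1 (VB i.*2.+1 y) else @op1 _.
exists (fun x y v => complex.Re (cprob_out (psi x y) v)).
have prob0 x y v : 0 <= cprob_out (psi x y) v.
  by rewrite sumr_ge0 // => s _; exact: exprn_ge0.
have probE x y v : rc (complex.Re (cprob_out (psi x y) v)) = cprob_out (psi x y) v.
  by rewrite /rc RRe_real // ger0_real.
split; last first.
  move=> x y v Fxy; rewrite -rc_le probE; apply: le_trans (hF x y v Fxy).
  by rewrite fmorph_div !rmorph_nat.
exists ('I_da.+1 * bool)%type, ('I_db.+1 * unit)%type, (ord0, false), (ord0, tt), PA, PB, snd.
have fin x y a o c b : rounds (fun i => (PA i x, PB i y)) (ket (((ord0, false), false), (ord0, tt))) k.+1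
   (((a, o), c), b) = psi x y ((a, o), b.1) * (c == false)%:R.
  rewrite /=; have -> : rounds (fun i => (PA i x, PB i y)) (ket (((ord0, false), false), (ord0, tt))) k =
     tensor1 (psi x y) (fun o _ => (o == false)%:R).
    rewrite -psiE -rounds_lift1.
    rewrite (eq_rounds (P' := fun i => lift_round1 (VA i.*2 x, VB i.*2.+1 y))) => [|i ik]; last first.
      by rewrite /PA /PB ik.
    congr rounds; apply/funext => -[[[u u'] d] [t t']].
    rewrite /tensor1 /ket /cinit /= !xpair_eqE -natrM mulnb; congr (nat_of_bool _)%:R.
    by case: (u == ord0); case: u'; case: d; case: (t == ord0); case: t'.
  rewrite /play /PA /PB ltnn /=; case: b => b [].
  rewrite apply_actB apply_op1 /= apply_actA (apply_op_perm _ swK swK) /=.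
  by rewrite /tensor1.
split.
- move=> i x; rewrite /PA; case: ifP => _; last exact: (unitary_perm swK swK).
  by apply: unitary_liftA1; rewrite /VA; case: ifP => _; [exact: uA|exact: unitary1].
- move=> i y; rewrite /PB; case: ifP => _; last exact: unitary1.
  by apply: unitary_liftB1; rewrite /VB; case: ifP => _; [exact: uB|exact: unitary1].
- by move=> x y [a o] b; rewrite fin mulr0.
move=> x y v; rewrite probE /cprob_out.
transitivity (\sum_(a : 'I_da.+1 * bool | a.2 == v) \sum_b `|psi x y (a, b)| ^+ 2).
  by rewrite pair_big /=; apply: eq_big => [[a b]|[a b] _] //=; rewrite andbT.
apply: eq_bigr => -[a o] _.
transitivity (\sum_b \sum_(u : unit) `|psi x y ((a, o), b)| ^+ 2).
  by apply: eq_bigr => b _; rewrite big_const card_unit /= addr0.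
by rewrite pair_big; apply: eq_bigr => -[b u] _; rewrite (fin _ _ _ _ _ (b, u)) mulr1.
Qed.

(** * Sampling protocols for relations, and error reduction *)

Section Solves.
Variables (XA YB : finType).

Definition solves (OA : finType) k (e : RR) (R : XA -> YB -> OA -> bool) :=
  exists mu, samples k mu /\ forall x y, 1 - e <= \sum_(o | R x y o) mu x y o.

Lemma samples_map (O1 O2 : finType) (h : O1 -> O2) k (mu : XA -> YB -> O1 -> RR) :
  samples k mu -> samples k (fun x y o => \sum_(o' | h o' == o) mu x y o').
Proof.
move=> [SA [SB [a0 [b0 [PA [PB [rd [uA uB z muE]]]]]]]].
exists SA, SB, a0, b0, PA, PB, (h \o rd); split=> // x y o.
rewrite rmorph_sum; under eq_bigr => o' _ do rewrite /= muE.
exact: sum_readout.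
Qed.

Lemma solves_map (O1 O2 : finType) (h : O1 -> O2) k e (R1 : XA -> YB -> O1 -> bool)
    (R2 : XA -> YB -> O2 -> bool) :
  (forall x y o, R1 x y o -> R2 x y (h o)) -> solves k e R1 -> solves k e R2.
Proof.
move=> hR [mu [smu hmu]]; exists (fun x y o => \sum_(o' | h o' == o) mu x y o').
split; first exact: samples_map.
move=> x y; apply: le_trans (hmu x y) _.
have -> : \sum_(o | R2 x y o) \sum_(o' | h o' == o) mu x y o' = \sum_(o' | R2 x y (h o')) mu x y o'.
  rewrite [RHS](partition_big h (R2 x y)) //=; apply: eq_bigr => o Ro.
  by apply: eq_bigl => a; case: eqP => [->|]; rewrite ?Ro ?andbT ?andbF.
rewrite big_mkcond [leRHS]big_mkcond; apply: ler_sum => o _.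
have := hR x y o; have := samples_ge0 x y o smu.
by case: (R1 x y o) => [|]; case: (R2 x y (h o)) => // _ /(_ isT).
Qed.

Lemma samples_event (OA : finType) k (mu : XA -> YB -> OA -> RR) x y (R : pred OA) :
  samples k mu -> \sum_(o | R o) mu x y o <= 1.
Proof.
move=> smu; rewrite -(sum_samples x y smu) big_mkcond; apply: ler_sum => o _.
by case: ifP => // _; exact: samples_ge0 smu.
Qed.

Lemma solves_pair (O1 O2 : finType) k1 k2 e1 e2 (R1 : XA -> YB -> O1 -> bool)
    (R2 : XA -> YB -> O2 -> bool) : solves k1 e1 R1 -> solves k2 e2 R2 ->
  solves (k1 + k2) (e1 + e2) (fun x y (o : O1 * O2) => R1 x y o.1 && R2 x y o.2).
Proof.
move=> [mu1 [s1 h1]] [mu2 [s2 h2]]; eexists; split; first exact: samples_pair s1 s2.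
move=> x y; rewrite -(pair_big _ _ (fun o o' => mu1 x y o * mu2 x y o')) /= -big_distrlr /=.
have := h1 x y; have := h2 x y.
have := samples_event x y (R1 x y) s1; have := samples_event x y (R2 x y) s2.
set p := \sum_(o | R1 x y o) _; set q := \sum_(o | R2 x y o) _ => q1 p1 hq hp.
have : 0 <= (1 - p) * (1 - q) by rewrite mulr_ge0 // subr_ge0.
by rewrite mulrBr mulr1 mulrBl mul1r; lra.
Qed.

Definition agrees (F : XA -> YB -> option bool) x y (v : bool) : bool :=
  if F x y is Some w then v == w else true.

(** A majority of three turns an error $q$ into $q(3q - 2q^2)$, and the bracket is at most 7/9 for
    $q \le 1/3$. A geometric decrease is enough, since the error only has to fall below $1/m$. *)
Lemma solves_maj3 k e (F : XA -> YB -> option bool) : e <= 1 / 3 ->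
  solves k e (agrees F) -> solves (3 * k) (7 / 9 * e) (agrees F).
Proof.
move=> e3 [mu [s h]].
pose maj (t : bool * bool * bool) := (t.1.1 && t.1.2) || (t.2 && (t.1.1 || t.1.2)).
have s3 := samples_pair (samples_pair s s) s.
have -> : (3 * k = k + k + k)%N by lia.
exists (fun x y o => \sum_(t | maj t == o) mu x y t.1.1 * mu x y t.1.2 * mu x y t.2).
split; first exact: samples_map.
move=> x y; have := h x y; have := sum_samples x y s; have p0 v := samples_ge0 x y v s.
rewrite big_bool /agrees; case: (F x y) => [w|]; last first.
  have -> : \sum_o \sum_(t | maj t == o) mu x y t.1.1 * mu x y t.1.2 * mu x y t.2 = 1.
    exact: sum_samples (samples_map maj s3).
  by rewrite big_bool => /= ->; lra.
rewrite !(big_pred1 w) //.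
have -> : \sum_(t | maj t == w) mu x y t.1.1 * mu x y t.1.2 * mu x y t.2 =
   mu x y w ^+ 3 + 3 * mu x y w ^+ 2 * mu x y (~~ w).
  transitivity (\sum_a \sum_b \sum_c
    (if maj (a, b, c) == w then mu x y a * mu x y b * mu x y c else 0)).
    by rewrite pair_big pair_big big_mkcond; apply: eq_bigr => -[[a b] c].
  by rewrite !big_bool /maj /=; case: w => /=; ring.
move=> sum1 pe.
have qE : mu x y (~~ w) = 1 - mu x y w by move: sum1; case: w {pe} => /=; lra.
have := p0 (~~ w); have := p0 w; rewrite qE; move: pe; set p := mu x y w => pe p0' q0.
have -> : p ^+ 3 + 3 * p ^+ 2 * (1 - p) = 1 - (1 - p) * (3 * (1 - p) - 2 * (1 - p) ^+ 2) by ring.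
have : (1 - p) * (3 * (1 - p) - 2 * (1 - p) ^+ 2) <= (1 - p) * (7 / 9).
  rewrite ler_wpM2l // -subr_ge0.
  have -> : 7 / 9 - (3 * (1 - p) - 2 * (1 - p) ^+ 2) = (1 / 3 - (1 - p)) * (7 / 3 - 2 * (1 - p)) by field.
  by rewrite mulr_ge0 // subr_ge0; lra.
by lra.
Qed.

Lemma solves_amplify l k (F : XA -> YB -> option bool) :
  solves k (1 / 3) (agrees F) -> solves (3 ^ l * k) ((7 / 9) ^+ l * (1 / 3)) (agrees F).
Proof.
move=> h; elim: l => [|l IH]; first by rewrite mul1n mul1r.
rewrite expnS exprS -mulnA -mulrA; apply: solves_maj3 => //.
have : (7 / 9) ^+ l <= 1 :> RR by rewrite exprn_ile1 //; lra.
by lra.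
Qed.

(** Union bound, with the coordinates of the answer filled in one at a time. *)
Lemma solves_family m k e (F : 'I_m -> XA -> YB -> option bool) :
  (forall j, solves k e (agrees (F j))) ->
  solves (m * k) (m%:R * e) (fun x y (o : {ffun 'I_m -> bool}) => [forall j, agrees (F j) x y (o j)]).
Proof.
move=> hF.
have step r : (r <= m)%N -> solves (r * k) (r%:R * e)
    (fun x y (o : {ffun 'I_m -> bool}) => [forall j : 'I_m, (j < r)%N ==> agrees (F j) x y (o j)]).
  elim: r => [_|r IH rm].
    rewrite mul0n mul0r; eexists; split; first exact: (samples_const XA YB [ffun=> false]).
    move=> x y; rewrite (bigD1 [ffun=> false]) /= ?eqxx; last by apply/forallP.
    by rewrite subr0 lerDl sumr_ge0 // => o _; exact: ler0n.
  have -> : (r.+1 * k = r * k + k)%N by rewrite mulSn addnC.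
  have -> : r.+1%:R * e = r%:R * e + e by rewrite -[r.+1]addn1 natrD mulrDl mul1r.
  pose upd (t : {ffun 'I_m -> bool} * bool) : {ffun 'I_m -> bool} :=
    [ffun j => if j == Ordinal rm then t.2 else t.1 j].
  apply: (solves_map (h := upd) _ (solves_pair (IH (ltnW rm)) (hF (Ordinal rm)))).
  move=> x y [o v] /= /andP[/forallP ho hv]; apply/forallP => j; rewrite ffunE.
  apply/implyP; rewrite ltnS leq_eqVlt; have [->//|jr] := eqVneq j (Ordinal rm).
  have -> : (val j == r) = false by apply: contraNF jr => /eqP jr; apply/eqP/val_inj.
  exact: (implyP (ho j)).
apply: (solves_map (h := id) _ (step m (leqnn m))).
by move=> x y o /= /forallP h; apply/forallP => j; exact: (implyP (h j)).
Qed.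

End Solves.

(** * From a sample held by Alice to a protocol whose output is computed by Bob *)

Section Send.
Variables (XA YB OA : finType) (k K : nat) (mu : XA -> YB -> OA -> RR).
Variables (h : XA -> OA -> 'I_K -> bool) (res : YB -> bits K -> bool).

(** Alice does not measure: in each branch of her register she sends [K] classical bits, one per
    round, and in a last round Bob writes the result on the channel. Branches stay orthogonal, so
    probabilities add as if she had measured first. *)
Lemma Qcc_send (F : XA -> YB -> option bool) : samples k mu ->
  (forall x y v, F x y = Some v -> 2 / 3 <= \sum_(o | res y [ffun j => h x o j] == v) mu x y o) ->
  Qcc_computes F (k + K).+1.*2.
Proof.
move=> [SA [SB [a0 [b0 [PA [PB [rd [uA uB z muE]]]]]]]] hF.
pose SA' : finType := (SA * unit)%type; pose SB' : finType := (SB * bits K)%type.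
pose pA j x (s : SA' * bool) : SA' * bool := (s.1, s.2 (+) h x (rd s.1.1) j).
(* Bob swaps the channel with his blank bit [j], so the channel is back at zero for the next bit. *)
pose pB j (s : bool * SB') : bool * SB' := (s.2.2 j, (s.2.1, store s.2.2 j s.1)).
pose pO y (s : bool * SB') : bool * SB' := (s.1 (+) res y s.2.2, s.2).
have pAK j x : cancel (pA j x) (pA j x) by move=> [a c]; rewrite /pA /= addbK.
have pBK j : cancel (pB j) (pB j).
  by move=> [c [b w]]; rewrite /pB /= storeK /store ffunE eqxx.
have pOK y : cancel (pO y) (pO y) by move=> [c w]; rewrite /pO /= addbK.
pose QA i x : op (SA' * bool)%type :=
  if (i < k)%N then liftA1 (PA i x) else if insub (i - k)%N is Some j then op_perm (pA j x) else @op1 _.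
pose QB i y : op (bool * SB')%type :=
  if (i < k)%N then liftB1 (PB i y) else if insub (i - k)%N is Some j then op_perm (pB j) else op_perm (pO y).
apply: (@Qcc_computes_rounds _ _ F (k + K).+1 SA' SB' (a0, tt) (b0, [ffun=> false]) QA QB).
- move=> i x; rewrite /QA; case: ifP => _; first exact: unitary_liftA1.
  by case: insub => [j|]; [exact: (unitary_perm (pAK j x) (pAK j x))|exact: unitary1].
- move=> i y; rewrite /QB; case: ifP => _; first exact: unitary_liftB1.
  by case: insub => [j|]; [exact: (unitary_perm (pBK j) (pBK j))|exact: (unitary_perm (pOK y) (pOK y))].
move=> x y v Fxy; have := hF x y v Fxy.
pose psi := rounds (fun i => (PA i x, PB i y)) (ket (a0, false, b0)) k.
have zpsi a b : psi ((a, true), b) = 0 by exact: z.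
pose msg (a : SA) : bits K := [ffun j => h x (rd a) j].
pose part (t : nat) (a : SA) : bits K := [ffun j : 'I_K => if (j < t)%N then h x (rd a) j else false].
pose st t : vec (chspace SA' SB') := fun s =>
  psi ((s.1.1.1, false), s.2.1) *
  ((s.1.2 == false) && (s.2.2 == part t s.1.1.1))%:R.
have start : rounds (fun i => (QA i x, QB i y)) (ket (((a0, tt), false), (b0, [ffun=> false]))) k = st 0%N.
  rewrite (eq_rounds (P' := fun i => lift_round1 (PA i x, PB i y))) => [|i ik]; last by rewrite /QA /QB ik.
  transitivity (tensor1 psi
     (fun (_ : unit) (w : bits K) => (w == [ffun=> false])%:R)).
    rewrite -rounds_lift1; congr rounds; apply/funext => -[[[a u] c] [b w]].
    rewrite /tensor1 /ket /= !xpair_eqE -natrM mulnb; congr (nat_of_bool _)%:R.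
    by case: u; case: (a == a0); case: c; case: (b == b0).
  apply/funext => -[[[a u] c] [b w]]; rewrite /tensor1 /st /=.
  have -> : part 0%N a = [ffun=> false] by apply/ffunP => j; rewrite !ffunE.
  by case: c; rewrite /= ?zpsi ?mul0r ?mulr0.
have step t : (t <= K)%N ->
    rounds (fun i => (QA i x, QB i y)) (ket (((a0, tt), false), (b0, [ffun=> false]))) (k + t) = st t.
  elim: t => [_|t IH tK]; first by rewrite addn0.
  rewrite addnS /= IH ?(ltnW tK) // /play /= /QA /QB ltnNge leq_addr /= addKn.
  rewrite insubT /=; set j := Sub t tK : 'I_K.
  apply/funext => -[[[a u] c] [b w]]; rewrite apply_actB (apply_op_perm _ (pBK j) (pBK j)) /=.
  rewrite apply_actA (apply_op_perm _ (pAK j x) (pAK j x)) /= /st /=.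
  congr (_ * (nat_of_bool _)%:R).
  have jt : (j < t)%N = false by exact: ltnn.
  have jt1 : (j < t.+1)%N by exact: ltnSn.
  have lt1 (i : 'I_K) : i != j -> (i < t.+1)%N = (i < t)%N.
    move=> ij; rewrite ltnS leq_eqVlt; suff -> : (val i == t) = false by [].
    by apply: contraNF ij => /eqP it; apply/eqP/val_inj.
  apply/andP/andP => [[/eqP hj /eqP hw]|[/eqP -> /eqP ->]].
    have c0 : c = false by have := congr1 (fun f : bits K => f j) hw; rewrite !ffunE eqxx jt.
    split; first by rewrite c0.
    apply/eqP/ffunP => i; have := congr1 (fun f : bits K => f i) hw; rewrite !ffunE.
    have [->|ij] := eqVneq i j; last by rewrite lt1.
    by rewrite jt1 => _; move: hj; case: (w j); case: (h x (rd a) j).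
  rewrite ffunE jt1 addbb; split=> //; apply/eqP/ffunP => i; rewrite !ffunE.
  by have [->|ij] := eqVneq i j; [rewrite jt|rewrite lt1].
have final a c b w : rounds (fun i => (QA i x, QB i y)) (ket (((a0, tt), false), (b0, [ffun=> false]))) (k + K).+1
    (((a, tt), c), (b, w)) = psi ((a, false), b) * ((c == res y w) && (w == msg a))%:R.
  rewrite /= step // /play /= /QA /QB ltnNge leq_addr /= addKn insubF ?ltnn //.
  rewrite apply_actB (apply_op_perm _ (pOK y) (pOK y)) /= apply_actA apply_op1 /st /=.
  have -> : part K a = msg a by apply/ffunP => j; rewrite !ffunE ltn_ord.
  by case: c; case: (res y w).
rewrite -rc_le fmorph_div !rmorph_nat => /le_trans; apply.
rewrite le_eqVlt; apply/orP; left; apply/eqP; rewrite rmorph_sum.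
under eq_bigr => o _ do rewrite /= muE.
rewrite sum_readout big_mkcond.
transitivity (\sum_a \sum_(u : unit) \sum_b \sum_(w : bits K)
    (if (v == res y w) && (w == msg a) then `|psi ((a, false), b)| ^+ 2 else 0)).
  apply: eq_bigr => a _; rewrite (big_pred1 tt) => [|[]] //.
  have [e|ne] := boolP (res y _ == v); last first.
    apply/esym; apply: big1 => b _; apply: big1 => w _; case: ifP => // /andP[/eqP e /eqP we].
    by move: ne; rewrite -/(msg a) -we -e eqxx.
  apply: eq_bigr => b _; rewrite (bigD1 (msg a)) //= [X in _ = _ + X]big1 ?addr0 => [|w /negbTE ->].
    by rewrite eqxx andbT eq_sym e.
  by rewrite andbF.
rewrite pair_bigA; apply: eq_bigr => -[a []] _.
rewrite pair_bigA; apply: eq_bigr => -[b w] _; rewrite final normrM exprMn.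
by case: (_ && _); rewrite ?normr1 ?expr1n ?mulr1 ?normr0 ?expr0n ?mulr0.
Qed.

End Send.

(** Alice sends the indicator vector of her input. This shows that the minimum defining [Qcc] is
    attained. *)
Lemma Qcc_computes_exists (XA YB : finType) (F : XA -> YB -> option bool) : exists T, Qcc_computes F T.
Proof.
exists (0 + #|XA|).+1.*2.
pose hh (x : XA) (_ : unit) (j : 'I_#|XA|) := enum_val j == x.
pose res y (w : bits #|XA|) := odflt false (obind (fun j => F (enum_val j) y) [pick j | w j]).
apply: (Qcc_send (h := hh) (res := res) (samples_const XA YB tt)) => x y v Fxy.
rewrite (big_pred1 tt) => [|[]]; first by rewrite eqxx mulr1n; lra.
rewrite /= /res; case: pickP => [j|/(_ (enum_rank x))]; rewrite ffunE /hh; last by rewrite enum_rankK eqxx.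
by move=> /eqP e; rewrite /= e Fxy /= eqxx.
Qed.

Lemma minnat_spec (P : nat -> Prop) : (exists k, P k) -> P (minnat P).
Proof.
rewrite /minnat => h; case: pselect => // h'.
by case: ex_minnP => k /asboolP.
Qed.

Lemma minnat_le (P : nat -> Prop) k : P k -> (minnat P <= k)%N.
Proof.
rewrite /minnat => h; case: pselect => [h'|[]]; last by exists k.
by case: ex_minnP => j _; apply; apply/asboolP.
Qed.

Lemma lookup_protocol (X Y : finType) (G : X -> Y -> bool) n m (f : pfun n) l :
  m%:R * ((7 / 9) ^+ l * (1 / 3)) <= 1 / 3 :> RR ->
  (Qcc (compose_gadget (@lookup n m f) G) <=
     (m * (3 ^ l * (uphalf (Qcc (compose_gadget f G))).+1) + (m + #|X|)).+1.*2)%N.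
Proof.
move=> err; apply: minnat_le.
have [mu [smu hmu]] := samples_of_Qcc (minnat_spec (Qcc_computes_exists (compose_gadget f G))).
rewrite -/(Qcc _) in smu; set q := (uphalf _).+1 in smu *.
set N := lookup_size n m.
pose F (j : 'I_m) (a : {ffun 'I_N -> X}) (b : {ffun 'I_N -> Y}) :=
  compose_gadget f G (lookup_block a j) (lookup_block b j).
have solveF j : solves q (1 / 3) (agrees (F j)).
  exists (fun a b => mu (lookup_block a j) (lookup_block b j)); split.
    exact: (samples_comap (fun a : {ffun 'I_N -> X} => lookup_block a j)
      (fun b : {ffun 'I_N -> Y} => lookup_block b j) smu).
  move=> a b; rewrite /agrees; case Fab : (F j a b) => [v|].
    rewrite (big_pred1 v) //; have := hmu _ _ _ Fab; lra.
  by rewrite (sum_samples _ _ smu); lra.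
have [nu [snu hnu]] := solves_family (fun j => solves_amplify l (solveF j)).
pose J : finType := ('I_m + X)%type.
have -> : (m + #|X|)%N = #|J| by rewrite card_sum card_ord.
(* The message consists of the [m] address bits and the indicator vector of Alice's gadget input in
   the addressed cell, from which Bob evaluates [G] on that cell. *)
pose hh (a : {ffun 'I_N -> X}) (o : {ffun 'I_m -> bool}) (j : 'I_#|J|) : bool :=
  match enum_val j with inl i => o i | inr x => lookup_cell a o == x end.
pose res (b : {ffun 'I_N -> Y}) (w : bits #|J|) : bool :=
  let o : {ffun 'I_m -> bool} := [ffun i => w (enum_rank (inl i : J))] in
  if [pick x | w (enum_rank (inr x : J))] is Some x then G x (lookup_cell b o) else false.
apply: (Qcc_send (h := hh) (res := res) snu) => a b v Fab.
have := hnu a b => h23.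
apply: (@le_trans _ _ (\sum_(o : {ffun 'I_m -> bool} | [forall j, agrees (F j) a b (o j)]) nu a b o)).
  by lra.
rewrite big_mkcond [leRHS]big_mkcond; apply: ler_sum => o _.
case: ifP => [/forallP ho|_]; last by case: ifP => // _; exact: samples_ge0 snu.
suff -> : res b [ffun j => hh a o j] == v by [].
have resE : res b [ffun j => hh a o j] = G (lookup_cell a o) (lookup_cell b o).
  rewrite /res; have -> : [ffun i => [ffun j => hh a o j] (enum_rank (inl i : J))] = o.
    by apply/ffunP => i; rewrite !ffunE /hh enum_rankK.
  case: pickP => [x|/(_ (lookup_cell a o))]; rewrite ffunE /hh enum_rankK; last by rewrite eqxx.
  by move=> /eqP ->.
rewrite resE; move: Fab; rewrite /compose_gadget /lookup /lookup_address.
set z : bits N := [ffun i => G (a i) (b i)].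
have blockE j : lookup_block z j = [ffun i => G (lookup_block a j i) (lookup_block b j i)].
  by apply/ffunP => i; rewrite !ffunE.
case: ifP => // /forallP dm [<-]; apply/eqP.
have -> : [ffun j => odflt false (f (lookup_block z j))] = o.
  apply/ffunP => j; rewrite ffunE; have := ho j; have := dm j.
  by rewrite blockE /agrees /F /compose_gadget; case: (f _) => //= w _ /eqP.
by rewrite /lookup_cell ffunE.
Qed.

(** * Asymptotics *)

Definition log (x : RR) : RR := Rpower.ln x.

Lemma log_le x y : 0 < x -> x <= y -> log x <= log y.
Proof.
move=> x0; rewrite le_eqVlt => /predU1P[->//|xy]; apply/ltW/RltP; apply: Rpower.ln_increasing; exact/RltP.
Qed.

Lemma logM x y : 0 < x -> 0 < y -> log (x * y) = log x + log y.
Proof. by move=> x0 y0; apply: Rpower.ln_mult; apply/RltP. Qed.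

Lemma log1 : log 1 = 0. Proof. exact: Rpower.ln_1. Qed.

Lemma log_exp (x : RR) : log (Rtrigo_def.exp x) = x.
Proof. exact: Rpower.ln_exp. Qed.

Lemma exp_log (x : RR) : 0 < x -> Rtrigo_def.exp (log x) = x.
Proof. by move=> /RltP; exact: Rpower.exp_ln. Qed.

Lemma exp_gt0 (x : RR) : 0 < Rtrigo_def.exp x.
Proof. by apply/RltP; exact: Exp_prop.exp_pos. Qed.
Lemma exp_ge (x : RR) : 1 + x <= Rtrigo_def.exp x.
Proof. by apply/RleP; exact: Rpower.exp_ineq1_le. Qed.

Lemma expD (x y : RR) : Rtrigo_def.exp (x + y) = Rtrigo_def.exp x * Rtrigo_def.exp y.
Proof. exact: Exp_prop.exp_plus. Qed.

Lemma log_half : log (1 / 2) <= - (1 / 2).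
Proof.
rewrite -[leRHS]log_exp; apply: log_le; first by lra.
by have := exp_ge (- (1 / 2)); lra.
Qed.

Lemma log2_ge : 1 / 2 <= log 2.
Proof.
have := log_half; have : log (2 * (1 / 2)) = log 2 + log (1 / 2) by rewrite logM //; lra.
have -> : 2 * (1 / 2) = 1 :> RR by lra.
by rewrite log1; lra.
Qed.

Lemma exp_mulrn n (x : RR) : Rtrigo_def.exp (x *+ n) = Rtrigo_def.exp x ^+ n.
Proof. by elim: n => [|n IH]; rewrite ?Rtrigo_def.exp_0 // mulrS expD IH exprS. Qed.

(** With $s = (1 + \log x)/(p+1)$, one has $s^p \le e^{ps} \le e^{(p+1)s} = e\,x$. *)
Lemma log_power_bound p : exists2 K : RR, 0 < K & forall x, 1 <= x -> (1 + log x) ^+ p <= K * x.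
Proof.
have d0 : 0 < p.+1%:R :> RR by rewrite ltr0n.
exists (p.+1%:R ^+ p * Rtrigo_def.exp 1); first by rewrite mulr_gt0 ?exp_gt0 ?exprn_gt0.
move=> x x1; have x0 : 0 < x by lra.
have l0 : 0 <= log x by rewrite -log1 log_le.
set t := 1 + log x; have t0 : 0 <= t by rewrite addr_ge0.
have -> : p.+1%:R ^+ p * Rtrigo_def.exp 1 * x = p.+1%:R ^+ p * Rtrigo_def.exp t.
  by rewrite /t expD exp_log // mulrA.
have -> : t = p.+1%:R * (t / p.+1%:R) by rewrite mulrC divfK // gt_eqF.
set s := t / p.+1%:R; have s0 : 0 <= s by rewrite divr_ge0 // ltW.
have es : 1 <= Rtrigo_def.exp s by have := exp_ge s; lra.
rewrite exprMn ler_wpM2l ?exprn_ge0 ?(ltW d0) // mulr_natl exp_mulrn exprSr.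
have h : s ^+ p <= Rtrigo_def.exp s ^+ p.
  by rewrite lerXn2r ?nnegrE //; have := exp_ge s; lra.
apply: le_trans h _; rewrite -[leLHS]mulr1 ler_wpM2l ?exprn_ge0 //; lra.
Qed.

(** The quotient $x/\log^c x$ is monotone only for large $x$, so a constant is allowed. For $x =
    yr$, $\log x \le \log y\,(1 + \log r)$, and [log_power_bound] absorbs the last factor into
    $r$. *)
Lemma ratio_mono c : exists2 K : RR, 0 < K & forall x y, 1 <= y -> 1 <= log y -> y <= x ->
  K * (y / log y ^+ c) <= x / log x ^+ c.
Proof.
have [K K0 hK] := log_power_bound c; exists K^-1; first by rewrite invr_gt0.
move=> x y y1 ly yx.
have y0 : 0 < y by lra.
have x0 : 0 < x by lra.
pose r := x / y.
have r1 : 1 <= r by rewrite ler_pdivlMr // mul1r.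
have r0 : 0 < r by lra.
have xE : x = y * r by rewrite /r mulrC divfK // gt_eqF.
have lr0 : 0 <= log r by rewrite -log1 log_le.
have lx : log x <= log y * (1 + log r).
  by rewrite xE logM // mulrDr mulr1 lerD2l ler_peMl.
have lx1 : 0 < log x by have := log_le y0 yx; lra.
have lc : log x ^+ c <= log y ^+ c * (K * r).
  apply: (@le_trans _ _ ((log y * (1 + log r)) ^+ c)).
    by rewrite lerXn2r ?nnegrE // ?mulr_ge0 ?addr_ge0 ?(ltW lx1) //; lra.
  by rewrite exprMn ler_wpM2l ?exprn_ge0 ?hK //; lra.
have ly0 : 0 < log y ^+ c by rewrite exprn_gt0 //; lra.
have lxc0 : 0 < log x ^+ c by rewrite exprn_gt0.
rewrite ler_pdivlMr //.
apply: (@le_trans _ _ (K^-1 * (y / log y ^+ c) * (log y ^+ c * (K * r)))).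
  by rewrite ler_wpM2l // mulr_ge0 ?invr_ge0 ?(ltW K0) // divr_ge0 ?(ltW y0) ?(ltW ly0).
rewrite [leRHS]xE le_eqVlt; apply/orP; left; apply/eqP; field.
by rewrite !gt_eqF.
Qed.

(** For $a$ the logarithm plus one, $T^2 2^{4a} < 64^a \le 81^a = 3^{4a}$ whenever $T < 2^a$; the
    additional 24 pays for the constant, as $576 \cdot 2^{24} \le 3^{24}$. *)
Definition address_length (q : nat) : nat := 4 * (trunc_log 2 q).+1 + 24.

Lemma QS_lookup_lower n (f : pfun n) : (200 <= Q f)%N ->
  (Q f)%:R / 200 <= (QS (@lookup n (address_length (Q f)) f))%:R :> RR.
Proof.
set q := Q f => q200; set m := address_length q; set T := QS _.
rewrite leNgt; apply/negP; rewrite ltr_pdivlMr // => Tq.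
have Tq' : (T * 200 < q)%N by rewrite -(ltr_nat RR) natrM.
have dist : QS_distinguishes (@lookup n m f) T.
  by apply: minnat_spec; exists (lookup_size n m); exact: QS_read_all.
(* The largest [L] with [2 * L < q], so minimality of [Q f] excludes an algorithm with [2 * L]
   queries. *)
pose L := (q.-1)./2.
have q0 : (0 < q)%N by apply: leq_trans q200.
have hL : (odd q.-1 + L.*2 = q.-1)%N by exact: odd_double_half.
have L99 : (99 <= L)%N by move: hL q200; rewrite -mul2n; case: (odd _); lia.
have TL : (T * 100 <= L)%N by move: hL Tq' q0; rewrite -mul2n; case: (odd _); lia.
have L2 : (2 * L < q)%N by move: hL q0; rewrite -mul2n; case: (odd _); lia.
have L99' : 99 <= L%:R :> RR by rewrite ler_nat.
have TL' : T%:R * 100 <= L%:R :> RR by rewrite -natrM ler_nat.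
(* [W] is the largest value with [18 * (W + 1) <= L]; then [4 * T <= W] follows from [T * 100 <= L]
   and [99 <= L]. *)
apply: (@lookup_lower n m f (L%:R / 18 - 1) L T) dist.
- by rewrite /m /address_length addn_gt0 orbT.
- by apply: leq_trans L99.
- by lra.
- by lra.
- by move=> /minnat_le; rewrite -/(Q f) -/q leqNgt L2.
- by lra.
rewrite /m /address_length; set a := (trunc_log 2 q).+1.
have qa : (q < 2 ^ a)%N by rewrite trunc_log_ltn.
have Ta : (T < 2 ^ a)%N by apply: leq_ltn_trans qa; lia.
have T2 : (T ^ 2 < 4 ^ a)%N by rewrite -[4%N]/(2 ^ 2)%N -expnM mulnC expnM ltn_exp2r.
have c2 : (4 ^ a * 2 ^ (4 * a) <= 3 ^ (4 * a))%N by rewrite !expnM -expnMn leq_exp2r.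
(* Stated for variables, since conversion would unfold the large numerals in unary. *)
have key k u v : (0 < k -> 0 < u -> k * u <= v -> k * T ^ 2 * (2 ^ (4 * a) * u) < 3 ^ (4 * a) * v)%N.
  move=> k0 u0 uv; have -> : (k * T ^ 2 * (2 ^ (4 * a) * u) = (T ^ 2 * 2 ^ (4 * a)) * (k * u))%N.
    by move: (2 ^ (4 * a))%N (T ^ 2)%N => w t; ring.
  apply: (@leq_ltn_trans ((T ^ 2 * 2 ^ (4 * a)) * v)%N); first by rewrite leq_mul2l uv orbT.
  have v0 : (0 < v)%N by apply: leq_trans uv; rewrite muln_gt0 k0.
  rewrite ltn_mul2r v0 /=; apply: leq_trans c2.
  by rewrite ltn_mul2r expn_gt0.
by rewrite !expnD; apply: key; [|rewrite expn_gt0|lia].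
Qed.

(** Amplification uses $3(t+1)$ levels of majority with $2^t \le m$, hence a factor $27^{t+1} \le 27
    \cdot 32^t \le 27 m^5$. The constant 58 is twice 27 + 1 + 1, for the sampling, the address bits
    and the last round. *)
Lemma lookup_cost m x q : (0 < m)%N ->
  ((m * (3 ^ (3 * (trunc_log 2 m).+1) * (uphalf q).+1) + (m + x)).+1.*2 <=
   (58 + 2 * x) * (m ^ 6 * q.+1))%N.
Proof.
move=> m0; set t := trunc_log 2 m.
have tm : (2 ^ t <= m)%N by rewrite trunc_logP.
have t27 : (3 ^ (3 * t.+1) <= 27 * m ^ 5)%N.
  have pow r : (27 ^ r <= (2 ^ r) ^ 5)%N.
    rewrite -expnM mulnC expnM; elim: r => [//|r IH].
    by rewrite !(expnS _ r); apply: leq_mul IH.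
  rewrite expnM -[(3 ^ 3)%N]/27%N expnS leq_mul2l /=.
  by apply: leq_trans (pow t) _; rewrite leq_exp2r.
have uq : (uphalf q <= q)%N by rewrite leq_uphalf_double -addnn leq_addr.
have h1 : (m * (3 ^ (3 * t.+1) * (uphalf q).+1) <= 27 * (m ^ 6 * q.+1))%N.
  have -> : (27 * (m ^ 6 * q.+1) = m * (27 * m ^ 5 * q.+1))%N by rewrite [(m ^ 6)%N]expnS; ring.
  by rewrite leq_mul2l; apply/orP; right; apply: leq_mul.
have A0 : (0 < m ^ 6 * q.+1)%N by rewrite muln_gt0 expn_gt0 m0.
have mA : (m <= m ^ 6 * q.+1)%N.
  rewrite expnS -mulnA -[X in (X <= _)%N]muln1 leq_mul2l; apply/orP; right.
  by rewrite muln_gt0 expn_gt0 m0.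
move: h1 A0 mA; move: (m * _)%N (m ^ 6 * q.+1)%N => u A h1 A0 mA.
rewrite -mul2n.
have xA : (x <= x * A)%N by rewrite leq_pmulr.
by rewrite mulnDl -mulnA; lia.
Qed.

Lemma Qcc_lookup_upper (X Y : finType) (G : X -> Y -> bool) n m (f : pfun n) : (0 < m)%N ->
  (Qcc (compose_gadget (@lookup n m f) G) <=
    (58 + 2 * #|X|) * (m ^ 6 * (Qcc (compose_gadget f G)).+1))%N.
Proof.
move=> m0; apply: leq_trans (lookup_cost _ _ m0); apply: lookup_protocol.
set b := (trunc_log 2 m).+1.
have mb : m%:R <= 2 ^+ b :> RR by rewrite -natrX ler_nat ltnW // trunc_log_ltn.
(* Three levels of majority halve the error, since $(7/9)^3 < 1/2$; so [b] triples bring it below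
   $1/m$. *)
have e79 : (7 / 9) ^+ (3 * b) <= (1 / 2) ^+ b :> RR.
  rewrite exprM lerXn2r ?nnegrE ?exprn_ge0 ?divr_ge0 //.
  by rewrite !exprS expr0; lra.
have p0 : 0 <= (7 / 9) ^+ (3 * b) :> RR by rewrite exprn_ge0 // divr_ge0.
have : m%:R * (7 / 9) ^+ (3 * b) <= 1 :> RR.
  apply: le_trans (ler_pM _ p0 mb e79) _; first exact: ler0n.
  by rewrite -exprMn (_ : 2 * (1 / 2) = 1) ?expr1n //; lra.
by rewrite mulrA; lra.
Qed.

Lemma address_length_log q : (2 <= q)%N -> (address_length q)%:R <= 64 * log q%:R.
Proof.
move=> q2; have q0 : 0 < q%:R :> RR by rewrite ltr0n (leq_trans _ q2).
have lq : 1 / 2 <= log q%:R.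
  by apply: le_trans log2_ge _; apply: log_le => //; rewrite ler_nat.
set t := trunc_log 2 q.
have logX k : log (2 ^+ k) = k%:R * log 2.
  elim: k => [|k IH]; first by rewrite expr0 log1 mul0r.
  by rewrite exprS logM ?exprn_gt0 // IH -[k.+1]addn1 natrD; ring.
have tl : t%:R * log 2 <= log q%:R.
  rewrite -logX; apply: log_le; first by rewrite exprn_gt0.
  by rewrite -natrX ler_nat trunc_logP // (leq_trans _ q2).
have t2 : t%:R * (1 / 2) <= t%:R * log 2 by rewrite ler_wpM2l // log2_ge.
rewrite /address_length -/t natrD natrM -[t.+1]addn1 natrD; lra.
Qed.

Theorem theorem20 (X Y : finType) (G : X -> Y -> bool) :
  OmegaTilde (fun n f => Qcc (compose_gadget f G)) (fun n f => QS f) ->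
  OmegaTilde (fun n f => Qcc (compose_gadget f G)) (fun n f => Q f).
Proof.
move=> [c [kappa [N0 [kappa0 H]]]].
have [K1 K10 ratio] := ratio_mono c.
have [K2 K20 power] := log_power_bound (c + 6).+1.
pose C : RR := (58 + 2 * #|X|)%:R * 64 ^+ 6.
have C0 : 0 < C by apply: mulr_gt0; [rewrite ltr0n|apply: exprn_gt0].
pose delta := kappa * K1 / (200 * C).
have delta0 : 0 < delta by rewrite divr_gt0 ?mulr_gt0.
(* Three thresholds on [q]: [e1] gives $\log(q/200) \ge 1$, [e2] makes the final lower bound at
   least 2, and [200 * (N0 + 2)] makes [QS g] large enough for the hypothesis. *)
pose e1 : RR := 200 * Rtrigo_def.exp 1.
pose e2 : RR := Rtrigo_def.exp (2 * K2 / delta).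
pose big := (Num.Def.archi_bound e1 + Num.Def.archi_bound e2 + 200 * (N0 + 2))%N.
exists (c + 6)%N, (delta / 2), big; split; first by rewrite divr_gt0.
move=> n f; set q := Q f => qN q2.
have q200 : (200 * (N0 + 2) <= q)%N by apply: leq_trans qN; exact: leq_addl.
have e1q : e1 <= q%:R.
  have e10 : 0 <= e1 by rewrite mulr_ge0 // ltW // exp_gt0.
  apply: le_trans (ltW (archi_boundP e10)) _; rewrite ler_nat; apply: leq_trans qN.
  by rewrite /big -addnA leq_addr.
have e2q : e2 <= q%:R.
  apply: le_trans (ltW (archi_boundP (ltW (exp_gt0 _)))) _; rewrite ler_nat; apply: leq_trans qN.
  by rewrite /big -/e2 addnAC leq_addl.
have q0 : 0 < q%:R :> RR by rewrite ltr0n (leq_trans _ q2).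
set m := address_length q; set g := @lookup n m f.
have q200' : (200 <= q)%N by apply: leq_trans q200; rewrite leq_pmulr // addn2.
have sq := QS_lookup_lower q200'; rewrite -/q -/m -/g in sq.
pose y : RR := q%:R / 200.
have ye : Rtrigo_def.exp 1 <= y by rewrite ler_pdivlMr // mulrC.
have y0 : 0 < y by apply: lt_le_trans (exp_gt0 _) ye.
have ly : 1 <= log y by rewrite -[leLHS]log_exp log_le ?exp_gt0.
have y1 : 1 <= y by apply: le_trans ye; have := exp_ge 1; lra.
have sN : (N0 + 2 <= QS g)%N.
  rewrite -(ler_nat RR); apply: le_trans sq; rewrite ler_pdivlMr // mulrC -natrM ler_nat.
  exact: q200.
have s1 := H _ g (leq_trans (leq_addr _ _) sN) (leq_trans (leq_addl _ _) sN).
rewrite -/(log _) in s1 *.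
have s2 := ratio _ _ y1 ly sq.
have lq : log y <= log q%:R by apply: log_le => //; rewrite ler_pdivrMr // ler_peMr ?ltW //; lra.
have lq0 : 0 < log q%:R by lra.
(* The sixth power of the address length becomes $\log^6 q$, which accounts for the exponent
   [c + 6]. *)
have up : (Qcc (compose_gadget g G))%:R <= C * log q%:R ^+ 6 * ((Qcc (compose_gadget f G))%:R + 1).
  have m0 : (0 < m)%N by rewrite /m /address_length addn_gt0 orbT.
  apply: (@le_trans _ _ ((58 + 2 * #|X|) * (m ^ 6 * (Qcc (compose_gadget f G)).+1))%:R).
    by rewrite ler_nat; exact: Qcc_lookup_upper.
  have -> : C * log q%:R ^+ 6 * ((Qcc (compose_gadget f G))%:R + 1) =
     (58 + 2 * #|X|)%:R * ((64 * log q%:R) ^+ 6 * ((Qcc (compose_gadget f G))%:R + 1)).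
    by rewrite /C exprMn; move: (64 ^+ 6) (log q%:R ^+ 6) (_ + 1) => u v w; rewrite !mulrA.
  rewrite [leLHS]natrM; apply: ler_wpM2l => //.
  rewrite natrM natrX -[(Qcc _).+1]addn1 natrD; apply: ler_wpM2r; first by rewrite addr_ge0.
  rewrite lerXn2r ?nnegrE ?mulr_ge0 ?(ltW lq0) //.
  exact: address_length_log.
have lc0 : 0 < log q%:R ^+ c by rewrite exprn_gt0.
have l60 : 0 < log q%:R ^+ 6 by rewrite exprn_gt0.
set Qc := Qcc (compose_gadget f G) in up *.
have low : delta * q%:R / log q%:R ^+ (c + 6) <= Qc%:R + 1.
  rewrite exprD ler_pdivrMr ?mulr_gt0 //.
  have h1 : K1 * (y / log q%:R ^+ c) <= K1 * (y / log y ^+ c).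
    rewrite ler_pM2l // ler_pM2l // lef_pV2 ?posrE ?exprn_gt0 //; last by lra.
    by rewrite lerXn2r ?nnegrE ?(ltW lq0) //; lra.
  have h2 : kappa * (K1 * (y / log q%:R ^+ c)) <= C * log q%:R ^+ 6 * (Qc%:R + 1).
    apply: le_trans up; apply: le_trans s1; rewrite -mulrA ler_pM2l //.
    exact: le_trans h1 s2.
  have -> : delta * q%:R = (kappa * (K1 * (y / log q%:R ^+ c))) * (log q%:R ^+ c / C).
    by rewrite /delta /y; field; rewrite !gt_eqF.
  apply: (@le_trans _ _ (C * log q%:R ^+ 6 * (Qc%:R + 1) * (log q%:R ^+ c / C))).
    by rewrite ler_wpM2r // divr_ge0 ?ltW.
  by rewrite le_eqVlt; apply/orP; left; apply/eqP; field; rewrite gt_eqF.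
(* The bound [low] still contains an additive 1 on the side of [Qc]. Once the left side is at least
   2, removing it costs a factor 2, which is the origin of [delta / 2]. *)
have large : 2 <= delta * q%:R / log q%:R ^+ (c + 6).
  have lpow : log q%:R ^+ (c + 6).+1 <= K2 * q%:R.
    apply: le_trans (power _ _); last by rewrite ler1n (leq_trans _ q2).
    by rewrite lerXn2r ?nnegrE ?addr_ge0 ?(ltW lq0) //; lra.
  have lbig : 2 * K2 / delta <= log q%:R by rewrite -[leLHS]log_exp log_le ?exp_gt0.
  have p0 : 0 < log q%:R ^+ (c + 6) by rewrite exprn_gt0.
  rewrite ler_pdivlMr // -(ler_pM2l K20).
  apply: (@le_trans _ _ (delta * log q%:R ^+ (c + 6).+1)).
    have -> : K2 * (2 * log q%:R ^+ (c + 6)) = delta * ((2 * K2 / delta) * log q%:R ^+ (c + 6)).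
      by field; rewrite gt_eqF.
    by rewrite exprS ler_pM2l // ler_pM2r.
  by rewrite mulrCA ler_pM2l.
move: low large; rewrite [delta / 2 * _]mulrAC [X in _ -> _ -> X <= _]mulrAC; lra.
Qed.
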